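(* Let $\Omega\subset\mathbb{R}^n$ be a bounded open set with Lipschitz boundary, let $\xi_0\in\mathbb{R}^n$, and let $f:\mathbb{R}^n\to\mathbb{R}$ be a continuous function such that $f(\xi)\ge\gamma(|\xi|)$ for all $\xi\in\mathbb{R}^n$, where $\gamma:\mathbb{R}^+\to\mathbb{R}^+$ is a continuous increasing function with $\lim_{t\to+\infty}\gamma(t)=+\infty$. Assume that $f^{\rm lslc}(\xi_0)<f(\xi_0)$. Let $K:=\{\xi\in\mathbb{R}^n:\ f^{\rm lslc}(\xi)<f(\xi)\}$ and assume that $K$ is connected; otherwise replace $K$ by its connected component containing $\xi_0$. Consider the problem $$(P)\quad \inf\Big\{\operatorname*{ess\,sup}_{x\in\Omega}f(\nabla u(x)):\ u\in u_{\xi_0}+W^{1,\infty}_0(\Omega)\Big\}.$$ (i) (Necessary condition.) If $(P)$ has a minimizer, then there exist $\nu\in\mathbb{R}^n\setminus\{0\}$ and $\varepsilon>0$ such that $f^{\rm lslc}$ is constant in the set $\{\xi\in B_\varepsilon(\xi_0):\ \langle\xi-\xi_0,\nu\rangle\ge 0\}$ and this set is contained in $R_{f^{\rm lslc}(\xi_0)}(f^{\rm lslc})$. (ii) (Sufficient condition.) If there exists $E\subset\partial K$ such that $\xi_0\in{\rm int}\,{\rm co}(E)$ and the restriction of $f^{\rm lslc}$ to $\{\xi_0\}\cup E$ is constant, then $(P)$ has a solution.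
   Context: Notation and definitions. $\mathbb{R}^+=[0,+\infty)$. Functions $u$ are scalar valued. $W^{1,\infty}_0(\Omega)$ is the closure of $C_0^\infty(\Omega)$ in $W^{1,1}(\Omega)$ intersected with $W^{1,\infty}(\Omega)$. A function $g:\mathbb{R}^n\to[-\infty,+\infty]$ is level convex if its sublevel sets $L_c(g)=\{\xi: g(\xi)\le c\}$ are convex for every $c\in\mathbb{R}$, and lower semicontinuous if they are all closed. The lower semicontinuous level convex envelope of $f$ is $$f^{\rm lslc}(\xi)=\sup\{g(\xi):\ g:\mathbb{R}^n\to[-\infty,+\infty],\ g\text{ lower semicontinuous and level convex},\ g\le f\}.$$ $R_c(g):=\{\xi\in\mathbb{R}^n:\ g(\xi)=c\}$. $B_\varepsilon(\xi_0)$ is the ball of center $\xi_0$ and radius $\varepsilon$; ${\rm int}\,{\rm co}(E)$ is the interior of the convex hull of $E$. $u_{\xi_0}$ denotes an affine function $u_{\xi_0}(x)=\langle\xi_0,x\rangle+c$ for some $c\in\mathbb{R}$. A solution (minimizer) is an admissible $u$ at which the infimum is attained. *)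

(* Defs.v *)
From HB Require Import structures.
From mathcomp Require Import all_boot all_order all_algebra.
From mathcomp Require Import all_classical all_reals all_analysis.
From mathcomp Require Import ess_sup_inf.
Set Implicit Arguments.
Unset Strict Implicit.
Unset Printing Implicit Defensive.
Import Order.TTheory GRing.Theory Num.Theory.
Import numFieldNormedType.Exports.
Local Open Scope classical_set_scope.
Local Open Scope ring_scope.

Section measurable_rV.
Context {R : realType} {n : nat}.

Let coors (i : 'I_n) (x : 'rV[R]_n) : measurableTypeR R := x ord0 i.

Let rV_set0 : g_sigma_preimage coors set0.
Proof. exact: sigma_algebra0. Qed.

Let rV_setC A : g_sigma_preimage coors A -> g_sigma_preimage coors (~` A).
Proof. exact: sigma_algebraC. Qed.

Let rV_bigcup (F : (set 'rV[R]_n)^nat) :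
  (forall i, g_sigma_preimage coors (F i)) ->
  g_sigma_preimage coors (\bigcup_i (F i)).
Proof. exact: sigma_algebra_bigcup. Qed.

HB.instance Definition _ :=
  @isMeasurable.Build (measure_tuple_display default_measure_display)
  'rV[R]_n (g_sigma_preimage coors) rV_set0 rV_setC rV_bigcup.

Lemma measurable_coor (i : 'I_n) :
  measurable_fun [set: 'rV[R]_n]
    (fun x : 'rV[R]_n => x ord0 i : measurableTypeR R).
Proof.
move=> _ Y mY; rewrite setTI; apply: sub_sigma_algebra => /=.
rewrite -bigcup_seq/=; exists i => /=; first by rewrite mem_index_enum.
by exists Y => //; rewrite setTI.
Qed.

Lemma measurable_fun_rV d (T : measurableType d) (f : T -> 'rV[R]_n) :
  (forall i, measurable_fun [set: T]
     (fun x => f x ord0 i : measurableTypeR R)) ->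
  measurable_fun [set: T] f.
Proof.
move=> mf _ A mA; rewrite setTI.
have : preimage_set_system [set: T] f (g_sigma_preimage coors) `<=` measurable.
  rewrite -g_sigma_preimageE; apply: smallest_sub.
    exact: sigma_algebra_measurable.
  rewrite /preimage_set_system => _ [B + <-].
  rewrite -bigcup_seq/= => -[i _ [C mC <-]].
  by rewrite setTI; exact: mf.
by apply; exists A => //; rewrite setTI.
Qed.

End measurable_rV.

Section lebesgue_measure_rV.
Context {R : realType}.
Local Open Scope ereal_scope.

Definition rV_cons n (p : measurableTypeR R * 'rV[R]_n) : 'rV[R]_n.+1 :=
  row_mx (p.1 : R)%:M p.2 : 'rV[R]_(1 + n).

Definition rV_uncons n (x : 'rV[R]_n.+1) : measurableTypeR R * 'rV[R]_n :=
  (x ord0 ord0, \row_i x ord0 (lift ord0 i)).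

Lemma rV_cons0 n p : @rV_cons n p ord0 ord0 = p.1.
Proof.
have -> : ord0 = lshift n (ord0 : 'I_1) by exact/val_inj.
by rewrite [LHS](row_mxEl (p.1 : R)%:M p.2) mxE eqxx mulr1n.
Qed.

Lemma rV_consS n p i : @rV_cons n p ord0 (lift ord0 i) = p.2 ord0 i.
Proof.
have -> : lift ord0 i = rshift 1 i by exact/val_inj.
exact: (row_mxEr (p.1 : R)%:M p.2).
Qed.

Lemma rV_consK n : cancel (@rV_cons n) (@rV_uncons n).
Proof.
move=> [a x]; rewrite /rV_uncons rV_cons0; congr pair.
by apply/rowP => i; rewrite mxE rV_consS.
Qed.

Lemma measurable_rV_cons n : measurable_fun [set: _] (@rV_cons n).
Proof.
apply: measurable_fun_rV => i; case: (unliftP ord0 i) => [j|] ->.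
  under eq_fun do rewrite rV_consS.
  exact: (measurableT_comp (measurable_coor j) measurable_snd).
by under eq_fun do rewrite rV_cons0; exact: measurable_fst.
Qed.

Lemma measurable_rV_uncons n : measurable_fun [set: _] (@rV_uncons n).
Proof.
apply/measurable_fun_pairP; split => /=; first exact: measurable_coor.
apply: measurable_fun_rV => i /=; rewrite /comp/=.
by under eq_fun do rewrite mxE; exact: measurable_coor.
Qed.

Section step.
Variables (n : nat) (mu : {sigma_finite_measure set 'rV[R]_n -> \bar R}).

Definition lebesgue_rV_step : set 'rV[R]_n.+1 -> \bar R :=
  pushforward (@lebesgue_measure R \x mu) (@rV_cons n).

Let step0 : lebesgue_rV_step set0 = 0.
Proof. by rewrite /lebesgue_rV_step /pushforward preimage_set0 measure0. Qed.

Let step_ge0 A : 0 <= lebesgue_rV_step A.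
Proof. by rewrite /lebesgue_rV_step /pushforward; exact: measure_ge0. Qed.

Let step_sigma_additive : semi_sigma_additive lebesgue_rV_step.
Proof.
pose nu : {measure set 'rV[R]_n.+1 -> \bar R} :=
  measure_function_pushforward__canonical__measure_function_Measure
    (@lebesgue_measure R \x mu) (@measurable_rV_cons n).
exact: (@measure_semi_sigma_additive _ _ _ nu).
Qed.

HB.instance Definition _ := isMeasure.Build _ _ _ lebesgue_rV_step
  step0 step_ge0 step_sigma_additive.

Let step_sigma_finite : sigma_finite [set: 'rV[R]_n.+1] lebesgue_rV_step.
Proof.
have /sigma_finiteP[F [TF ndF Foo]] := sigma_finiteT (@lebesgue_measure R).
have /sigma_finiteP[G [TG ndG Goo]] := sigma_finiteT mu.
have mFG k : measurable (F k `*` G k).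
  by apply: measurableX; [exact: (Foo k).1|exact: (Goo k).1].
exists (fun k => @rV_uncons n @^-1` (F k `*` G k)).
  rewrite -preimage_bigcup (_ : \bigcup_k (F k `*` G k) = setT) //.
  rewrite -setXTT TF TG predeqE => -[x y]; split.
    by move=> [k _ []/= ? ?]; split; exists k.
  move=> [/= [k _ Fkx] [l _ Gly]]; exists (maxn k l) => //; split.
  - by move: x Fkx; exact/subsetPset/ndF/leq_maxl.
  - by move: y Gly; exact/subsetPset/ndG/leq_maxr.
move=> k; split.
  by rewrite -[X in measurable X]setTI; exact: measurable_rV_uncons.
rewrite /lebesgue_rV_step /pushforward -comp_preimage.
rewrite (_ : _ \o _ = id); last by apply/funext => p /=; rewrite rV_consK.
have [? ?] := Foo k; have [? ?] := Goo k.
by rewrite preimage_id product_measure1E// lte_mul_pinfty// ge0_fin_numE.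
Qed.

HB.instance Definition _ := Measure_isSigmaFinite.Build _ _ _ lebesgue_rV_step
  step_sigma_finite.

End step.

Fixpoint lebesgue_rV n : {sigma_finite_measure set 'rV[R]_n -> \bar R} :=
  match n return {sigma_finite_measure set 'rV[R]_n -> \bar R} with
  | 0 => dirac (0%R : 'rV[R]_0)
  | m.+1 => lebesgue_rV_step (lebesgue_rV m)
  end.

Definition rV_box n (a b : 'rV[R]_n) : set 'rV[R]_n :=
  [set x | forall i, (a ord0 i <= x ord0 i <= b ord0 i)%R].

Lemma lebesgue_rV_box n (a b : 'rV[R]_n) :
  (forall i, a ord0 i <= b ord0 i)%R ->
  measurable (rV_box a b) /\
  lebesgue_rV n (rV_box a b) = (\prod_(i < n) (b ord0 i - a ord0 i))%:E.
Proof.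
elim: n a b => [|n IH] a b ab.
  have -> : rV_box a b = setT by apply/seteqP; split => // x _ [].
  by rewrite big_ord0 /= diracT.
have [|mB LB] := IH (rV_uncons a).2 (rV_uncons b).2.
  by move=> i /=; rewrite !mxE.
set B := rV_box _ _ in mB LB.
have -> : rV_box a b =
    @rV_uncons n @^-1` (`[a ord0 ord0, b ord0 ord0] `*` B).
  apply/seteqP; split => x.
    move=> Ax; split => /=; first by rewrite in_itv/=; exact: Ax.
    by move=> i; rewrite !mxE; exact: Ax.
  move=> [/=]; rewrite in_itv/= => x0 xB i.
  by case: (unliftP ord0 i) => [j|] -> //; have := xB j; rewrite !mxE.
have mI : measurable (`[a ord0 ord0, b ord0 ord0] : set (measurableTypeR R)).
  exact: measurable_itv.
have mAB := measurableX mI mB.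
split.
  by rewrite -[X in measurable X]setTI; exact: measurable_rV_uncons.
rewrite /= /lebesgue_rV_step /pushforward -comp_preimage.
rewrite (_ : _ \o _ = id); last by apply/funext => p /=; rewrite rV_consK.
rewrite preimage_id product_measure1E// LB big_ord_recl.
under eq_bigr do rewrite !mxE.
rewrite EFinM; congr (_ * _).
have := lebesgue_measure_itv `[a ord0 ord0, b ord0 ord0].
rewrite /= lte_fin => ->; have [//|ba] := ltP (a ord0 ord0) (b ord0 ord0).
by rewrite (_ : b ord0 ord0 = a ord0 ord0) ?subrr//; apply/le_anti; rewrite ba ab.
Qed.

End lebesgue_measure_rV.

Section euclidean.
Context {R : realType} {n : nat}.
Implicit Types (x y nu : 'rV[R]_n) (A Omega : set 'rV[R]_n).

Definition dotv x y : R := \sum_(i < n) x ord0 i * y ord0 i.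

(* The library's norm and balls on 'rV[R]_n are those of the sup norm. *)
Definition enorm x : R := Num.sqrt (dotv x x).

Definition eball x (r : R) : set 'rV[R]_n := [set y | enorm (y - x) < r].

Definition frontier A : set 'rV[R]_n := closure A `\` interior A.

Definition convex_hull A : set 'rV[R]_n :=
  smallest (fun C : set (convex_lmodType 'rV[R]_n) => convex_set C) A.

(* Near each boundary point, Omega is the strict subgraph of a Lipschitz
   function of the coordinates orthogonal to some unit vector nu, i.e. in a
   rotated orthonormal frame with last axis nu; y - <y, nu> nu is the
   projection of y on the hyperplane orthogonal to nu. *)
Definition lipschitz_boundary Omega : Prop :=
  forall x, frontier Omega x ->
  exists (r : R) nu (g : 'rV[R]_n -> R) (L : R),
    [/\ 0 < r, enorm nu = 1,
        forall y z, `|g y - g z| <= L * enorm (y - z) &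
        forall y, eball x r y ->
          (Omega y <-> dotv y nu < g (y - dotv y nu *: nu))].

End euclidean.

Section sobolev.
Context {R : realType} {n : nat}.
Implicit Types (Omega : set 'rV[R]_n) (u phi : 'rV[R]_n -> R)
  (v : 'rV[R]_n -> 'rV[R]_n).
Local Notation mu := (@lebesgue_rV R n).

Definition partial (i : 'I_n) u : 'rV[R]_n -> R :=
  fun x => 'D_(delta_mx ord0 i) u x.

Fixpoint class_C (k : nat) u : Prop :=
  continuous u /\
  if k is k'.+1 then
    forall i, (forall x, derivable u x (delta_mx ord0 i)) /\
              class_C k' (partial i u)
  else True.

(* C_0^oo(Omega), each function being extended by 0 outside Omega. *)
Definition test_function Omega phi : Prop :=
  [/\ forall k, class_C k phi,
      compact (closure [set x | phi x != 0]) &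
      closure [set x | phi x != 0] `<=` Omega].

Definition loc_integrable Omega u : Prop :=
  measurable_fun Omega u /\
  forall K, compact K -> K `<=` Omega -> mu.-integrable K (EFin \o u).

Definition weak_gradient Omega u v : Prop :=
  [/\ loc_integrable Omega u,
      forall i, loc_integrable Omega (fun x => v x ord0 i) &
      forall phi i, test_function Omega phi ->
        \int[mu]_(x in Omega) (u x * partial i phi x) =
        - \int[mu]_(x in Omega) (v x ord0 i * phi x)].

(* A representative of the weak gradient, unique up to a null set of Omega;
   the value is 0 when u has no weak gradient. *)
Definition grad Omega u : 'rV[R]_n -> 'rV[R]_n :=
  xget (fun=> 0) [set v | weak_gradient Omega u v].

Definition W11 Omega : set ('rV[R]_n -> R) :=
  [set u | mu.-integrable Omega (EFin \o u) /\
    exists2 v, weak_gradient Omega u v &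
      forall i, mu.-integrable Omega (fun x => (v x ord0 i)%:E)].

Definition norm_W11 Omega u : \bar R :=
  (\int[mu]_(x in Omega) (`|u x| + enorm (grad Omega u x))%:E)%E.

Definition Linfty Omega : set ('rV[R]_n -> R) :=
  [set u | measurable_fun Omega u /\
    (Lnorm mu +oo (EFin \o (u \_ Omega)) < +oo)%E].

Definition W1oo Omega : set ('rV[R]_n -> R) :=
  [set u | Linfty Omega u /\
    exists2 v, weak_gradient Omega u v &
      forall i, Linfty Omega (fun x => v x ord0 i)].

Definition W11_0 Omega : set ('rV[R]_n -> R) :=
  [set u | W11 Omega u /\
    forall e : R, 0 < e -> exists2 phi, test_function Omega phi &
      (norm_W11 Omega (u \- phi)%R < e%:E)%E].

Definition W1oo_0 Omega : set ('rV[R]_n -> R) := W11_0 Omega `&` W1oo Omega.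

End sobolev.

Section supremal.
Context {R : realType} {n : nat}.
Implicit Types (Omega E : set 'rV[R]_n) (f : 'rV[R]_n -> R)
  (g : 'rV[R]_n -> \bar R) (xi : 'rV[R]_n).
Local Open Scope ereal_scope.

Definition sublevel g (c : R) : set 'rV[R]_n := [set xi | g xi <= c%:E].

Definition level_convex g : Prop :=
  forall c, convex_set (sublevel g c : set (convex_lmodType 'rV[R]_n)).

Definition lsc g : Prop := forall c, closed (sublevel g c).

Definition lslc f xi : \bar R :=
  ereal_sup [set g xi | g in
    [set g | [/\ lsc g, level_convex g & forall eta, g eta <= (f eta)%:E]]].

Definition level_set g (c : \bar R) : set 'rV[R]_n := [set xi | g xi = c].

Definition constant_on E g : Prop := exists c, forall xi, E xi -> g xi = c.

Definition gap_set f : set 'rV[R]_n := [set xi | lslc f xi < (f xi)%:E].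

Definition gap_component f xi0 : set 'rV[R]_n :=
  if `[< connected (gap_set f) >] then gap_set f
  else connected_component (gap_set f) xi0.

Definition affine_fun xi0 (c : R) : 'rV[R]_n -> R :=
  fun x => (dotv xi0 x + c)%R.

Definition admissible Omega xi0 (c : R) : set ('rV[R]_n -> R) :=
  [set u | W1oo_0 Omega (u \- affine_fun xi0 c)%R].

(* Setting the integrand to -oo outside Omega makes the essential supremum over
   'rV[R]_n the essential supremum over Omega. *)
Definition energy Omega f (u : 'rV[R]_n -> R) : \bar R :=
  ess_sup (@lebesgue_rV R n)
    (patch (fun=> -oo) Omega (fun x => (f (grad Omega u x))%:E)).

Definition minimizer Omega f xi0 c (u : 'rV[R]_n -> R) : Prop :=
  admissible Omega xi0 c u /\
  energy Omega f u =
    ereal_inf [set energy Omega f w | w in admissible Omega xi0 c].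

End supremal.

(* Main.v *)
Require Import Defs.
From HB Require Import structures.
From mathcomp Require Import all_boot all_order all_algebra.
From mathcomp Require Import all_classical all_reals all_analysis.
From mathcomp Require Import measurable_realfun ess_sup_inf lra.
Set Implicit Arguments.
Unset Strict Implicit.
Unset Printing Implicit Defensive.
Import Order.TTheory GRing.Theory Num.Theory.
Import numFieldNormedType.Exports.
Local Open Scope classical_set_scope.
Local Open Scope ring_scope.

(** Write [c0] for the value of the envelope [lslc f] at [xi0].  Everything rests
    on one notion: a finite list [s] surrounds [x] when, for every direction, some
    point of [s] lies behind [x] by a definite amount; then [x] is interior to the
    convex hull of [s], and every closed convex set that contains [s] contains a
    ball around [x].  A set contains a list that surrounds [x], or it lies in a
    closed half space with [x] on its boundary
    ([surrounds_or_halfspace]).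

    If an admissible [u] has energy at most [k < f xi0], then the sublevel set
    [f <= k] contains a list that surrounds [xi0] ([energy_surrounds]).
    Otherwise it lies in a half space with normal [nu], the derivative of
    [u - <xi0, .>] in the direction [nu] has a sign, it has integral zero because
    of the boundary values, hence it vanishes; by Poincare's inequality [u] is
    then affine with gradient [xi0] and its energy is [f xi0].

    Conversely, let [s] surround [xi0] and not contain it.  Then some admissible
    [u] has its gradient in [s] almost everywhere ([gradient_inclusion]).  The
    minimum of the affine functions [r + <xi - xi0, x - a>], for [xi] in [s], is a
    pyramid which is positive on a bounded cell around [a], vanishes on the
    boundary of the cell and has its gradients in [s - xi0].  A Vitali covering
    fills almost all of [Omega] with disjoint cells, whatever the shape of
    [Omega], and the sum of the pyramids is added to the affine function.

    For [k > c0] the sublevel set [f <= k] contains a list that surrounds [xi0],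
    for otherwise a half space would give a minorant of [f] above [c0] at [xi0]
    ([lslc_lt_surrounds]).  Hence the infimum of the energy is [c0] ([inf_energy]).

    For (i), a minimizer has energy [c0 < f xi0], so a list in [f <= c0]
    surrounds [xi0] and [lslc f <= c0] near [xi0].  On the other hand no list in
    [f < c0] surrounds [xi0], so this set lies in a half space, and
    [lslc f >= c0] on the opposite half space ([lslc_ge_at_halfspace]).

    For (ii), [f] coincides with its envelope on the frontier of the gap set
    ([frontier_gap_component]), so [f = c0] on [E], and [E] contains a list that
    surrounds [xi0]; the function constructed above has energy at most [c0]. *)

(** * Scalar product, sup norm and surrounding lists *)

Section euclidean_space.
Context {R : realType} {n : nat}.
Implicit Types (x y z v : 'rV[R]_n) (s : seq 'rV[R]_n).

Lemma dotvC x y : dotv x y = dotv y x.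
Proof. by apply: eq_bigr => i _; rewrite mulrC. Qed.

Lemma dotvDl x y z : dotv (x + y) z = dotv x z + dotv y z.
Proof. by rewrite -big_split; apply: eq_bigr => i _; rewrite mxE mulrDl. Qed.

Lemma dotvNl x y : dotv (- x) y = - dotv x y.
Proof. by rewrite -sumrN; apply: eq_bigr => i _; rewrite mxE mulNr. Qed.

Lemma dotvBl x y z : dotv (x - y) z = dotv x z - dotv y z.
Proof. by rewrite dotvDl dotvNl. Qed.

Lemma dotvZl a x y : dotv (a *: x) y = a * dotv x y.
Proof. by rewrite /dotv mulr_sumr; apply: eq_bigr => i _; rewrite mxE mulrA. Qed.

Lemma dotvDr x y z : dotv x (y + z) = dotv x y + dotv x z.
Proof. by rewrite !(dotvC x) dotvDl. Qed.

Lemma dotvNr x y : dotv x (- y) = - dotv x y.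
Proof. by rewrite !(dotvC x) dotvNl. Qed.

Lemma dotvBr x y z : dotv x (y - z) = dotv x y - dotv x z.
Proof. by rewrite !(dotvC x) dotvBl. Qed.

Lemma dotvZr a x y : dotv x (a *: y) = a * dotv x y.
Proof. by rewrite !(dotvC x) dotvZl. Qed.

Lemma dotv0r x : dotv x 0 = 0.
Proof. by apply: big1 => i _; rewrite mxE mulr0. Qed.

Lemma dotv_delta x i : dotv x (delta_mx ord0 i) = x ord0 i.
Proof.
rewrite /dotv (bigD1 i)//= mxE !eqxx mulr1 big1 ?addr0// => j ji.
by rewrite mxE (negbTE ji) andbF mulr0.
Qed.

Lemma dotvv_ge0 x : 0 <= dotv x x.
Proof. by apply: sumr_ge0 => i _; rewrite -expr2 sqr_ge0. Qed.

Lemma coord_le_norm x i : `|x ord0 i| <= `|x|.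
Proof.
rewrite [leRHS]/Num.norm /= mx_normrE.
by apply/bigmax_geP; right => /=; exists (ord0, i).
Qed.

Lemma norm_le_coord x (a : R) :
  0 <= a -> (forall i, `|x ord0 i| <= a) -> `|x| <= a.
Proof.
move=> a0 xa; rewrite [leLHS]/Num.norm /= mx_normrE.
by apply/bigmax_leP; split => // -[i j] _ /=; rewrite (ord1 i).
Qed.

Lemma norm_lt_coord x (a : R) :
  0 < a -> (forall i, `|x ord0 i| < a) -> `|x| < a.
Proof.
move=> a0 xa; rewrite [ltLHS]/Num.norm /= mx_normrE.
by apply/bigmax_ltP; split => // -[i j] _ /=; rewrite (ord1 i).
Qed.

Lemma dotv_le_norm x y : `|dotv x y| <= n%:R * `|x| * `|y|.
Proof.
apply: (le_trans (ler_norm_sum _ _ _)).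
rewrite -mulrA mulr_natl -[X in _ *+ X](card_ord n) -sumr_const.
by apply: ler_sum => i _; rewrite normrM ler_pM// coord_le_norm.
Qed.

Lemma enorm_ge0 x : 0 <= enorm x.
Proof. exact: sqrtr_ge0. Qed.

Lemma coord_le_enorm x i : `|x ord0 i| <= enorm x.
Proof.
rewrite -sqrtr_sqr ler_sqrt ?dotvv_ge0// /dotv (bigD1 i)//= expr2 lerDl.
by apply: sumr_ge0 => j _; rewrite -expr2 sqr_ge0.
Qed.

Lemma norm_le_enorm x : `|x| <= enorm x.
Proof. by apply: norm_le_coord; [exact: enorm_ge0|exact: coord_le_enorm]. Qed.

Lemma enorm_le_norm x : enorm x <= n%:R * `|x|.
Proof.
have nx0 : 0 <= n%:R * `|x| by rewrite mulr_ge0// normr_ge0.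
rewrite -[leRHS]ger0_norm// -sqrtr_sqr ler_sqrt ?sqr_ge0//.
apply: (le_trans (le_trans (ler_norm _) (dotv_le_norm x x))).
rewrite exprMn -mulrA -expr2 ler_wpM2r ?sqr_ge0//.
by rewrite -natrX ler_nat; case: (n) => // k; rewrite expnS expn1 leq_pmulr.
Qed.

Lemma dotvv_gt0 x : x != 0 -> 0 < dotv x x.
Proof.
move=> x0; rewrite lt_neqAle dotvv_ge0 andbT eq_sym.
apply: contra x0 => /eqP xx0; rewrite -normr_eq0 eq_le normr_ge0 andbT.
by apply: le_trans (norm_le_enorm x) _; rewrite /enorm xx0 sqrtr0.
Qed.

Lemma continuous_epsdelta (f : 'rV[R]_n -> R) : continuous f <->
  forall x (e : R), 0 < e ->
    exists2 d : R, 0 < d & forall y, `|x - y| < d -> `|f x - f y| < e.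
Proof.
split=> [cf x e e0|H x].
  have /(@cvgrPdist_lt _ _ _ (nbhs x)) /(_ _ e0) /nbhs_ballP[d /= d0 dP] := cf x.
  by exists d => // y xy; apply: dP; rewrite -ball_normE.
apply/(@cvgrPdist_lt _ _ _ (nbhs x)) => e e0; have [d d0 dP] := H x e e0.
by apply/nbhs_ballP; exists d => // y; rewrite -ball_normE => /dP.
Qed.

Lemma open_epsdelta (A : set 'rV[R]_n) : open A <->
  forall x, A x -> exists2 d : R, 0 < d & forall y, `|x - y| < d -> A y.
Proof.
rewrite openE; split=> H x /H.
  by move/nbhs_ballP => [d /= d0 dP]; exists d => // y xy; apply: dP; rewrite -ball_normE.
by move=> [d d0 dP]; apply/nbhs_ballP; exists d => // y; rewrite -ball_normE => /dP.
Qed.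

Lemma interior_epsdelta (A : set 'rV[R]_n) x : interior A x <->
  exists2 d : R, 0 < d & forall y, `|x - y| < d -> A y.
Proof.
split.
  by move/nbhs_ballP => [d /= d0 dP]; exists d => // y xy; apply: dP; rewrite -ball_normE.
by move=> [d d0 dP]; apply/nbhs_ballP; exists d => // y; rewrite -ball_normE => /dP.
Qed.

Lemma closure_epsdelta (A : set 'rV[R]_n) x : closure A x <->
  forall d : R, 0 < d -> exists2 y, A y & `|x - y| < d.
Proof.
split=> [cA d d0|H B /nbhs_ballP[d /= d0 dB]].
  have /cA[y [Ay]] := @nbhsx_ballx _ _ x _ d0.
  by rewrite -ball_normE /= => xy; exists y.
by have [y Ay xy] := H _ d0; exists y; split => //; apply: dB; rewrite -ball_normE.
Qed.

Lemma lipschitz_continuous (f : 'rV[R]_n -> R) (k : R) :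
  (forall x y, `|f x - f y| <= k * `|x - y|) -> continuous f.
Proof.
move=> fk; apply/continuous_epsdelta => x e e0.
have k0 : 0 < `|k| + 1 by rewrite ltr_wpDl.
exists (e / (`|k| + 1)) => [|y]; first exact: divr_gt0.
rewrite ltr_pdivlMr// mulrC; apply: le_lt_trans; apply: (le_trans (fk x y)).
by rewrite ler_wpM2r// (le_trans (ler_norm k))// lerDl.
Qed.

Lemma continuous_dotv x : continuous (dotv x).
Proof.
apply: (@lipschitz_continuous _ (n%:R * `|x|)) => y z.
by rewrite -dotvBr; exact: dotv_le_norm.
Qed.

Lemma continuous_dotv_sub x v : continuous (fun y => dotv (y - x) v).
Proof.
apply: (@lipschitz_continuous _ (n%:R * `|v|)) => y z.
by rewrite -dotvBl opprB addrA subrK dotvC; exact: dotv_le_norm.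
Qed.

Lemma compact_unit_sphere : compact [set v : 'rV[R]_n | `|v| = 1].
Proof.
apply: bounded_closed_compact.
  exists 1; split => // M M1 x /= ->; exact: ltW.
rewrite (_ : [set v | _] = (fun v : 'rV[R]_n => `|v| : R) @^-1` [set 1]) //.
apply: preimage_closed; last exact: closed_eq.
by move=> x _; apply: norm_continuous.
Qed.

(** For [d > 0] this says that [x] is interior to the convex hull of [s]; it is
    stated by duality, so that no convex combination has to be exhibited. *)
Definition surrounds s x (d : R) :=
  forall v, exists2 xi, xi \in s & dotv (xi - x) v <= - d * `|v|.

Lemma unit_vector : (0 < n)%N -> exists v : 'rV[R]_n, `|v| = 1.
Proof.
move=> n0; exists (const_mx 1); apply/le_anti/andP; split.
  by apply: norm_le_coord => // i; rewrite mxE normr1.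
by apply: le_trans (coord_le_norm _ (Ordinal n0)); rewrite mxE normr1.
Qed.

(** If [A] lies in no such half space, then for each unit vector [v] some [xi] in
    [A] satisfies [dotv (xi - x) v < 0]; this is an open condition on [v], so by
    compactness of the sphere finitely many [xi] and one common bound suffice. *)
Lemma surrounds_or_halfspace (A : set 'rV[R]_n) x : (0 < n)%N ->
  (exists s d, [/\ (forall xi, xi \in s -> A xi), 0 < d & surrounds s x d]) \/
  (exists2 v, v != 0 & forall xi, A xi -> 0 <= dotv (xi - x) v).
Proof.
move=> n0.
have [[v v0 vP]|H] := pselect (exists2 v, v != 0 &
    forall xi, A xi -> 0 <= dotv (xi - x) v); first by right; exists v.
(* the sphere is covered by the sets where some [xi] is behind by [1/(k+1)] *)
left; have := compact_unit_sphere; rewrite compact_cover.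
move=> /(_ ('rV[R]_n * nat)%type [set p | A p.1]
  (fun p => [set v | dotv (p.1 - x) v < - p.2.+1%:R^-1])) [].
- move=> [xi k] _ /=.
  rewrite (_ : mkset _ = dotv (xi - x) @^-1` [set r | r < - k.+1%:R^-1])//.
  by apply: open_comp => [v _|]; [exact: continuous_dotv|exact: open_lt].
- move=> v /= v1; apply: contrapT => nv; apply: H; exists v.
    by rewrite -normr_eq0 v1 oner_eq0.
  move=> xi Axi; rewrite leNgt; apply/negP => xiv; apply: nv.
  have [k kP] : exists k : nat, k.+1%:R^-1 < - dotv (xi - x) v.
    have [k kv] : exists k : nat, 0 + k.+1%:R^-1 < - dotv (xi - x) v.
      by apply: ltr_add_invr; rewrite oppr_gt0.
    by exists k; rewrite add0r in kv.
  by exists (xi, k) => //=; rewrite ltrNr.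
move=> D' D'A D'c; exists [seq p.1 | p <- finmap.enum_fset D'].
pose k := \max_(p <- finmap.enum_fset D') p.2.
exists k.+1%:R^-1; split; [|by rewrite invr_gt0|].
  by move=> xi /mapP[p pD' ->]; have := D'A _ pD'; rewrite inE.
have key v : `|v| = 1 -> exists2 xi, xi \in [seq p.1 | p <- finmap.enum_fset D'] &
    dotv (xi - x) v <= - k.+1%:R^-1.
  move=> v1; have [p /= pD' pv] := D'c _ v1.
  exists p.1; first by apply/mapP; exists p.
  apply: (le_trans (ltW pv)); rewrite lerN2 lef_pV2 ?posrE// ler_nat ltnS.
  exact: leq_bigmax_seq.
move=> v; have [->|v0] := eqVneq v 0.
  have [v1 v11] := unit_vector n0; have [xi xis _] := key _ v11.
  by exists xi => //; rewrite dotv0r normr0 mulr0.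
have [|xi xis] := key (`|v|^-1 *: v).
  by rewrite normrZ normfV normr_id mulVf// normr_eq0.
rewrite dotvZr => xiv; exists xi => //.
by rewrite -ler_pdivrMr ?normr_gt0// mulrC.
Qed.

End euclidean_space.

(** * Separation of a point from a closed convex set *)

Section separation.
Context {R : realType} {n : nat}.
Implicit Types (x y z v : 'rV[R]_n) (s : seq 'rV[R]_n) (C : set 'rV[R]_n).

Lemma convex_setP C : convex_set (C : set (convex_lmodType 'rV[R]_n)) <->
  forall x y (t : R), 0 <= t -> t <= 1 -> C x -> C y ->
    C (t *: x + (1 - t) *: y).
Proof.
split=> [cC x y t t0 t1 Cx Cy|H x y t].
  have t01 : Itv.spec (@Itv.num_sem R) (Itv.Real `[0%Z, 1%Z]) t.
    by apply/and3P; split; rewrite /= ?bnd_simp ?ger0_real//= ?in_itv /= ?t0 ?t1.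
  have := cC x y (Itv.mk t01); rewrite !inE; exact.
rewrite !inE => Cx Cy; apply: H => //.
Qed.

Lemma continuous_sqdist y : continuous (fun z : 'rV[R]_n => dotv (y - z) (y - z)).
Proof.
apply: continuous_big => [|i _]; first exact: add_continuous.
have ci : continuous (fun z : 'rV[R]_n => (y - z) ord0 i).
  apply: (@lipschitz_continuous _ _ _ 1) => a b.
  rewrite mul1r distrC (_ : _ - _ = (a - b) ord0 i) ?coord_le_norm//.
  by rewrite !mxE; lra.
by move=> z; apply: continuousM; exact: ci.
Qed.

Lemma closed_convex_projection C y : closed C ->
  convex_set (C : set (convex_lmodType 'rV[R]_n)) -> C !=set0 ->
  exists2 p, C p & forall xi, C xi -> dotv (y - p) (xi - p) <= 0.
Proof.
move=> clC /convex_setP cvC [z0 Cz0].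
pose q z := dotv (y - z) (y - z).
pose K := C `&` [set z | q z <= q z0].
have cq : continuous q by exact: continuous_sqdist.
have cK : compact K.
  apply: bounded_closed_compact.
    exists (`|y| + Num.sqrt (q z0)); split => // M MM z [_ /= qz].
    apply: le_trans (ltW MM); rewrite -[z](subKr y) (le_trans (ler_normB _ _))//.
    rewrite lerD2l (le_trans (norm_le_enorm _))// /enorm ler_sqrt//.
    by rewrite (le_trans _ qz) ?dotvv_ge0.
  apply: closedI => //.
  rewrite (_ : mkset _ = q @^-1` [set r | r <= q z0])//.
  by apply: preimage_closed => [z _|]; [exact: cq|exact: closed_le].
have [|p] := EVT_min_rV _ cK (continuous_subspaceT cq).
  by exists z0; split => /=.
rewrite inE => -[Cp /= pz0] pmin; exists p => // xi Cxi.
have pq z : C z -> q p <= q z.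
  move=> Cz; have [zz0|/ltW zz0] := leP (q z) (q z0); last exact: le_trans zz0.
  by apply: pmin; rewrite inE; split.
rewrite leNgt; apply/negP; set a := dotv _ _ => a0.
pose b := dotv (xi - p) (xi - p).
have b0 : 0 <= b by exact: dotvv_ge0.
(* if the angle at [p] were acute, moving from [p] towards [xi] by [a / b], or by
   [1] when this is too far, would come closer to [y] *)
have key t : 0 <= t -> t <= 1 -> 2 * t * a <= t ^+ 2 * b.
  move=> t0 t1; have := pq _ (cvC xi p t t0 t1 Cxi Cp).
  have -> : t *: xi + (1 - t) *: p = p + t *: (xi - p).
    by apply/rowP => i; rewrite !mxE; lra.
  have -> : q (p + t *: (xi - p)) = q p - 2 * t * a + t ^+ 2 * b.
    have E u w : dotv (u - w) (u - w) = dotv u u - 2 * dotv u w + dotv w w.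
      by rewrite dotvBl !dotvBr (dotvC w u); lra.
    by rewrite /q opprD addrA E dotvZr dotvZl dotvZr -/a -/b; lra.
  by lra.
have [ab|ab] := leP a b.
  have bp : 0 < b by exact: lt_le_trans ab.
  have := key (a / b); rewrite divr_ge0 ?(ltW a0)// ler_pdivrMr// mul1r ab.
  rewrite expr2 => /(_ isT isT).
  have -> : a / b * (a / b) * b = a / b * a by rewrite -mulrA divfK ?gt_eqF.
  have : 0 < a / b * a by rewrite !mulr_gt0// invr_gt0.
  by lra.
by have := key 1; rewrite ler01 lexx expr1n => /(_ isT isT); lra.
Qed.

(** If [y] were outside [C], with projection [p], the whole list would lie on the
    far side of the hyperplane through [p] orthogonal to [y - p]; but some point of
    the list is behind [x] by [d] in the direction [p - y], which is more than the
    distance from [y] to [x] can compensate. *)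
Lemma surrounds_sub_convex s x d C y : closed C ->
  convex_set (C : set (convex_lmodType 'rV[R]_n)) ->
  (forall xi, xi \in s -> C xi) -> surrounds s x d -> n%:R * `|y - x| < d -> C y.
Proof.
move=> clC cvC sC sx yd.
have [xi0 xi0s _] := sx 0.
have [|p Cp pC] := closed_convex_projection y clC cvC.
  by exists xi0; exact: sC.
have [<-//|yp] := eqVneq p y.
have ypgt : 0 < dotv (y - p) (y - p).
  by apply: dotvv_gt0; rewrite subr_eq0 eq_sym.
have [xi xis] := sx (p - y).
have /pC := sC _ xis.
have -> : xi - p = (xi - x) + ((y - p) - (y - x)) by apply/rowP => i; rewrite !mxE; lra.
rewrite -(opprB y p) dotvNr normrN dotvDr (dotvBr _ (y - p)) (dotvC (xi - x)).
have := dotv_le_norm (y - p) (y - x).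
rewrite ler_norml => /andP[_].
have : n%:R * `|y - x| * `|y - p| <= d * `|y - p| by rewrite ler_wpM2r// ltW.
by move: ypgt; set A := dotv _ _; set B := dotv _ _; set D := dotv _ _; lra.
Qed.
End separation.

(** * The lower semicontinuous level convex envelope *)

Section envelope.
Context {R : realType} {n : nat}.
Implicit Types (x y xi v : 'rV[R]_n) (s : seq 'rV[R]_n) (f : 'rV[R]_n -> R).

Lemma lte_between_fin (g : \bar R) (c : R) : (g < c%:E)%E ->
  exists2 c' : R, (g < c'%:E)%E & c' < c.
Proof.
case: g => [r| |] //=; last by move=> _; exists (c - 1); rewrite ?ltNyr//; lra.
by rewrite lte_fin => rc; exists ((r + c) / 2); rewrite ?lte_fin; lra.
Qed.

Lemma lslc_le f x : (lslc f x <= (f x)%:E)%E.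
Proof. by apply: ge_ereal_sup => _ [g [_ _ gf] <-]. Qed.

Lemma lslc_le_surrounds f s x d y (c : R) :
  (forall xi, xi \in s -> f xi <= c) -> surrounds s x d ->
  n%:R * `|y - x| < d -> (lslc f y <= c%:E)%E.
Proof.
move=> sf sx yd; apply: ge_ereal_sup => _ [g [gl gc gf] <-].
apply: (surrounds_sub_convex (gl c) (gc c) _ sx yd) => xi /sf fc.
by rewrite /sublevel /= (le_trans (gf xi))// lee_fin.
Qed.

(** The function equal to [-oo] on a closed half space that misses [x] and to [c]
    elsewhere is a lower semicontinuous level convex minorant of [f]. *)
Lemma lslc_ge_halfspace f x v (c t : R) : 0 < t ->
  (forall xi, f xi < c -> t <= dotv (xi - x) v) -> (c%:E <= lslc f x)%E.
Proof.
move=> t0 H.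
pose g xi : \bar R := if t <= dotv (xi - x) v then -oo%E else c%:E.
have -> : c%:E = g x by rewrite /g subrr dotvC dotv0r leNgt t0.
apply: ereal_sup_ubound; exists g => //; split.
- move=> k; have [ck|kc] := leP c k.
    rewrite (_ : sublevel g k = setT); first exact: closedT.
    by apply/seteqP; split => // xi _; rewrite /sublevel /= /g; case: ifP; rewrite ?leNye ?lee_fin.
  rewrite (_ : sublevel g k = (fun xi => dotv (xi - x) v) @^-1` [set r | t <= r]).
    apply: preimage_closed => [z _|]; last exact: closed_ge.
    exact: continuous_dotv_sub.
  apply/seteqP; split => xi; rewrite /sublevel /= /g; case: ifP => //.
    by rewrite lee_fin [c <= k]leNgt kc.
  by move=> _ _; rewrite leNye.
- move=> k; apply/convex_setP => xi eta u u0 u1; rewrite /sublevel /= /g.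
  case: ifP => [tx _|_ ck]; last first.
    by move=> _; case: ifP => // _; rewrite leNye.
  case: ifP => [ty _|_ ck]; last by case: ifP => // _; rewrite leNye.
  suff -> : t <= dotv (u *: xi + (1 - u) *: eta - x) v by rewrite leNye.
  have -> : u *: xi + (1 - u) *: eta - x = u *: (xi - x) + (1 - u) *: (eta - x).
    by apply/rowP => i; rewrite !mxE; lra.
  rewrite dotvDl !dotvZl.
  have := ler_wpM2l u0 tx; have : 0 <= 1 - u by lra.
  by move=> u1'; have := ler_wpM2l u1' ty; lra.
- move=> xi; rewrite /g; case: ifP; rewrite ?leNye// => tx.
  by rewrite lee_fin leNgt; apply/negP => /H; rewrite tx.
Qed.

Lemma coercive_sublevel_compact f (gamma : R -> R) : continuous f ->
  gamma t @[t --> +oo] --> +oo -> (forall xi, gamma (enorm xi) <= f xi) ->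
  forall c, compact [set xi | f xi <= c].
Proof.
move=> cf gy fg c; apply: bounded_closed_compact; last first.
  rewrite (_ : mkset _ = f @^-1` [set r | r <= c])//.
  by apply: preimage_closed => [z _|]; [exact: cf|exact: closed_le].
have /cvgryPgt /(_ c) [M [Mr MP]] := gy.
exists M; split => // N MN xi /= fc; apply: (le_trans (norm_le_enorm _)).
apply: le_trans (ltW MN); rewrite leNgt; apply/negP => /MP.
by rewrite ltNge (le_trans (fg xi)).
Qed.

(** If [f <= c] lay in the half space [0 <= dotv (xi - x) v], then for [c'] between
    [lslc f x] and [c] the compact set [f <= c'] would lie in its interior, because
    [f] stays below [c] a little beyond the points of [f <= c']; so it would keep a
    positive distance from the boundary and [lslc_ge_halfspace] would apply. *)
Lemma lslc_lt_surrounds f x (c : R) : (0 < n)%N -> continuous f ->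
  (forall c, compact [set xi | f xi <= c]) -> (lslc f x < c%:E)%E ->
  exists s d, [/\ (forall xi, xi \in s -> f xi <= c), 0 < d & surrounds s x d].
Proof.
move=> n0 cf kf gc.
have [//|[v v0 vP]] := surrounds_or_halfspace [set xi | f xi <= c] x n0.
have [c' gc' c'c] := lte_between_fin gc.
suff [t t0 tP] : exists2 t, 0 < t & forall xi, f xi < c' -> t <= dotv (xi - x) v.
  by have := lslc_ge_halfspace t0 tP; rewrite leNgt gc'.
have [K0|/set0P/negP/negPn/eqP K0] := pselect ([set xi | f xi <= c'] !=set0); last first.
  exists 1 => // xi /ltW fc'.
  by have : [set xi | f xi <= c'] xi by []; rewrite K0.
have cd : continuous (fun xi => dotv (xi - x) v).
  exact: continuous_dotv_sub.
have [p] := EVT_min_rV K0 (kf c') (continuous_subspaceT cd).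
rewrite inE /= => fp pmin.
have [|d d0 dP] := (continuous_epsdelta f).1 cf p (c - c'); first lra.
have vn : 0 < `|v| by rewrite normr_gt0.
pose t := d / (2 * `|v|).
have t0 : 0 < t by rewrite divr_gt0 ?mulr_gt0.
exists (t * dotv v v) => [|xi fxi]; first by rewrite mulr_gt0 ?dotvv_gt0.
apply: le_trans (pmin xi _); last by rewrite inE /= ltW.
have : f (p - t *: v) <= c.
  have := dP (p - t *: v); rewrite subKr normrZ (gtr0_norm t0).
  have -> : t * `|v| = d / 2 by rewrite /t invfM mulrA divfK ?gt_eqF.
  by rewrite ltr_norml => /(_ _)/andP[]; lra.
by move=> /vP; rewrite addrAC (dotvBl (p - x)) dotvZl; lra.
Qed.

Lemma lslc_usc f x (c : R) : (0 < n)%N -> continuous f ->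
  (forall c, compact [set xi | f xi <= c]) -> (lslc f x < c%:E)%E ->
  exists2 d : R, 0 < d & forall y, `|x - y| < d -> (lslc f y <= c%:E)%E.
Proof.
move=> n0 cf kf /(lslc_lt_surrounds n0 cf kf)[s [d [sf d0 sx]]].
exists (d / n%:R) => [|y xy]; first by rewrite divr_gt0 ?ltr0n.
by apply: (lslc_le_surrounds sf sx); rewrite mulrC -ltr_pdivlMr ?ltr0n// distrC.
Qed.

Lemma open_gap_set f : (0 < n)%N -> continuous f ->
  (forall c, compact [set xi | f xi <= c]) -> open (gap_set f).
Proof.
move=> n0 cf kf; apply/open_epsdelta => x gx.
have [c gc cfx] := lte_between_fin gx.
have [d d0 dP] := lslc_usc n0 cf kf gc.
have [|d' d'0 d'P] := (continuous_epsdelta f).1 cf x (f x - c); first lra.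
exists (Num.min d d'); first by rewrite lt_min d0.
move=> y; rewrite lt_min => /andP[/dP gy /d'P]; rewrite ltr_norml => /andP[_ ?].
by rewrite /gap_set /=; apply: (le_lt_trans gy); rewrite lte_fin; lra.
Qed.

Lemma connected_segment x z : connected [set x + t *: (z - x) | t in `[0, 1]].
Proof.
apply: connected_continuous_connected; first exact: segment_connected.
apply: continuous_subspaceT => t.
apply/(@cvgrPdist_lt _ _ _ (nbhs t)) => e e0.
have d0 : 0 < `|z - x| + 1 by rewrite ltr_wpDl.
apply/nbhs_ballP; exists (e / (`|z - x| + 1)) => [|u]; first exact: divr_gt0.
rewrite -ball_normE /= ltr_pdivlMr// => tu.
rewrite opprD addrACA subrr add0r -scalerBl normrZ.
by apply: le_lt_trans tu; rewrite ler_wpM2l// lerDl.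
Qed.

(** A frontier point that belonged to the gap set would have a ball around it
    inside the gap set; the ball is connected and meets the component, so it would
    lie in the component and the point would be interior. *)
Lemma frontier_gap_component f x0 : open (gap_set f) ->
  forall x, frontier (gap_component f x0) x -> lslc f x = (f x)%:E.
Proof.
move=> oK x [clx nintx]; apply/eqP; rewrite eq_le lslc_le /= leNgt.
apply/negP => gx; apply: nintx; move: clx; rewrite /gap_component.
case: ifP => [_ _|_ clx]; first by rewrite ((interior_id _).1 oK).
have /open_epsdelta /(_ _ gx)[d d0 dP] := oK.
have [y Ky xy] := (closure_epsdelta _ _).1 clx d d0.
have seg z : `|x - z| < d -> connected_component (gap_set f) x z.
  move=> xz; pose S := [set x + t *: (z - x) | t in `[0, 1]].
  apply: (@connected_component_max _ _ S).
  - by exists 0; [rewrite /= in_itv /= lexx ler01|rewrite scale0r addr0].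
  - move=> _ [t /= + <-]; rewrite in_itv /= => /andP[t0 t1]; apply: dP.
    rewrite opprD addNKr normrN normrZ ger0_norm// distrC.
    by apply: le_lt_trans xz; rewrite ler_piMl.
  - exact: connected_segment.
  - by exists 1; [rewrite /= in_itv /= lexx ler01|rewrite scale1r addrC subrK].
apply/interior_epsdelta; exists d => // z /seg xz.
apply: connected_component_trans Ky _.
by apply: connected_component_trans xz; apply: connected_component_sym; exact: seg.
Qed.

(** A half space through [x] that contains [E] contains its convex hull, which
    leaves no room for a ball around [x]. *)
Lemma surrounds_interior_hull (E : set 'rV[R]_n) x : (0 < n)%N ->
  interior (convex_hull E) x ->
  exists s d, [/\ (forall xi, xi \in s -> E xi), 0 < d & surrounds s x d].
Proof.
move=> n0 /interior_epsdelta[d d0 dP].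
have [//|[v v0 vP]] := surrounds_or_halfspace E x n0.
have vn : 0 < `|v| by rewrite normr_gt0.
pose t := d / (2 * `|v|).
have t0 : 0 < t by rewrite divr_gt0 ?mulr_gt0.
have := dP (x - t *: v); rewrite subKr normrZ (gtr0_norm t0).
have -> : t * `|v| = d / 2 by rewrite /t invfM mulrA divfK ?gt_eqF.
move=> /(_ _) H; have {H} : convex_hull E (x - t *: v) by apply: H; lra.
move=> /(_ [set y | 0 <= dotv (y - x) v])/(_ _) H.
have : [set y | 0 <= dotv (y - x) v] (x - t *: v).
  apply: H; split => //; apply/convex_setP => a b u u0 u1 /= ha hb.
  have -> : u *: a + (1 - u) *: b - x = u *: (a - x) + (1 - u) *: (b - x).
    by apply/rowP => i; rewrite !mxE; lra.
  have u1' : 0 <= 1 - u by lra.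
  by rewrite dotvDl !dotvZl addr_ge0// mulr_ge0.
rewrite /= addrAC subrr add0r dotvNl dotvZl.
by have := mulr_gt0 t0 (dotvv_gt0 v0); lra.
Qed.

(** A list in the open sublevel set [f < lslc f x0] takes a maximal value below
    [lslc f x0], so it cannot surround [x0]; hence this set lies in a half space
    through [x0].  That bounds the envelope from below in the opposite open half
    space, and upper semicontinuity extends the bound to the boundary. *)
Lemma lslc_ge_at_halfspace f x0 : (0 < n)%N -> continuous f ->
  (forall c, compact [set xi | f xi <= c]) -> lslc f x0 \is a fin_num ->
  exists2 v, v != 0 & forall y, 0 <= dotv (y - x0) v -> (lslc f x0 <= lslc f y)%E.
Proof.
move=> n0 cf kf g0; rewrite -(fineK g0); set c0 := fine _.
have [[s [d [sf d0 sx]]]|[v v0 vP]] :=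
    surrounds_or_halfspace [set xi | f xi < c0] x0 n0.
  have [c cc0 sc] : exists2 c, c < c0 & (forall xi, xi \in s -> f xi <= c).
    elim: s sf {sx} => [_|a s IH sf]; first by exists (c0 - 1) => //; lra.
    have [|c cc0 sc] := IH; first by move=> z zs; apply: sf; rewrite inE zs orbT.
    have fa : f a < c0 by apply: sf; rewrite inE eqxx.
    exists (Num.max c (f a)); first by rewrite gt_max cc0.
    move=> z; rewrite inE => /predU1P[->|/sc fz]; rewrite le_max ?fz ?lexx ?orbT//.
  have := lslc_le_surrounds (y := x0) sc sx.
  rewrite subrr normr0 mulr0 => /(_ d0); rewrite -(fineK g0) lee_fin -/c0.
  by move=> H; move: cc0; rewrite ltNge H.
have [w w0 wP] : exists2 w, w != 0 & forall y, 0 < dotv (y - x0) w ->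
    (c0%:E <= lslc f y)%E.
  exists (- v) => [|y]; first by rewrite oppr_eq0.
  rewrite dotvNr => yv; apply: (@lslc_ge_halfspace _ _ v c0 (- dotv (y - x0) v)) => //.
  by move=> xi /vP; rewrite !dotvBl; lra.
exists w => // y yw; rewrite leNgt; apply/negP => gy.
have [c gc cc0] := lte_between_fin gy.
have [d d0 dP] := lslc_usc n0 cf kf gc.
have vn : 0 < `|w| by rewrite normr_gt0.
pose t := d / (2 * `|w|).
have t0 : 0 < t by rewrite divr_gt0 ?mulr_gt0.
have := dP (y + t *: w); rewrite opprD addNKr normrN normrZ (gtr0_norm t0).
have -> : t * `|w| = d / 2 by rewrite /t invfM mulrA divfK ?gt_eqF.
have /wP H : 0 < dotv (y + t *: w - x0) w.
  rewrite addrAC dotvDl dotvZl.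
  by have := mulr_gt0 t0 (dotvv_gt0 w0); lra.
move=> /(_ _) H2; have {H2} H2 : (lslc f (y + t *: w) <= c%:E)%E by apply: H2; lra.
by have := le_trans H H2; rewrite lee_fin leNgt cc0.
Qed.

Lemma lslc_fin_num f x : (forall xi, 0 <= f xi) -> lslc f x \is a fin_num.
Proof.
move=> f0; rewrite ge0_fin_numE.
  by apply: le_lt_trans (lslc_le f x) _; rewrite ltry.
apply: ereal_sup_ubound; exists (cst 0%E) => //; split.
- move=> c; have [c0|c0] := leP 0 c.
    rewrite (_ : sublevel _ _ = setT); first exact: closedT.
    by apply/seteqP; split => // y _; rewrite /sublevel /= lee_fin.
  rewrite (_ : sublevel _ _ = set0); first exact: closed0.
  by apply/seteqP; split => // y; rewrite /sublevel /= lee_fin leNgt c0.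
- by move=> c; apply/convex_setP.
- by move=> y; rewrite lee_fin.
Qed.

End envelope.

Lemma lslc0 (R : realType) (f : 'rV[R]_0 -> R) x : lslc f x = (f x)%:E.
Proof.
apply/eqP; rewrite eq_le lslc_le /=; apply: ereal_sup_ubound.
have all1 (y : 'rV[R]_0) : y = x by apply/rowP => -[].
exists (fun y => (f y)%:E) => //; split => //.
- move=> c; rewrite -[sublevel _ _]/((fun y => (f y)%:E) @^-1` [set r | (r <= c%:E)%E]).
  have [fc|fc] := leP (f x) c.
    rewrite (_ : _ @^-1` _ = setT); first exact: closedT.
    by apply/seteqP; split => // y _ /=; rewrite lee_fin (all1 y).
  rewrite (_ : _ @^-1` _ = set0); first exact: closed0.
  by apply/seteqP; split => // y /=; rewrite lee_fin (all1 y) leNgt fc.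
- by move=> c; apply/convex_setP => a b t _ _; rewrite (all1 (_ + _)) (all1 a).
Qed.

(** * Lebesgue measure of boxes, open sets and hyperplanes *)

Section measure_rV.
Context {R : realType}.
Implicit Types (n : nat).

Definition rV_obox n (a b : 'rV[R]_n) : set 'rV[R]_n :=
  [set x | forall i, (a ord0 i < x ord0 i < b ord0 i)%R].

Lemma measurable_rV_obox n (a b : 'rV[R]_n) : measurable (rV_obox a b).
Proof.
rewrite (_ : rV_obox a b = \bigcap_(i in [set: 'I_n])
   ((fun x : 'rV[R]_n => x ord0 i : measurableTypeR R) @^-1` `]a ord0 i, b ord0 i[)).
  apply: fin_bigcap_measurable; first exact: finite_finset.
  by move=> i _; rewrite -[X in measurable X]setTI; exact: measurable_coor.
apply/seteqP; split=> [x xab i _|x xab i] /=; first by rewrite in_itv /=; exact: xab.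
by have /= := xab i Logic.I; rewrite in_itv.
Qed.

(** Rational boxes form a countable basis of the topology; the closed boxes are
    kept inside [U] because they will support test functions of [U]. *)
Lemma open_bigcup_obox n (U : set 'rV[R]_n) : open U ->
  exists (D : set ('rV[rat]_n * rat)%type) (a b : ('rV[rat]_n * rat)%type -> 'rV[R]_n),
    U = \bigcup_(p in D) rV_obox (a p) (b p) /\
    (forall p, D p -> rV_box (a p) (b p) `<=` U).
Proof.
move=> /open_epsdelta oU.
pose ctr (p : ('rV[rat]_n * rat)%type) : 'rV[R]_n := \row_i ratr (p.1 ord0 i).
pose ok (p : ('rV[rat]_n * rat)%type) :=
  rV_box (ctr p - const_mx (ratr p.2)) (ctr p + const_mx (ratr p.2)) `<=` U.
exists ok, (fun p => ctr p - const_mx (ratr p.2)), (fun p => ctr p + const_mx (ratr p.2)).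
split=> //; apply/seteqP; split=> [x Ux|x [p okp xp]]; last first.
  by apply: okp => i; have /andP[/ltW -> /ltW ->] := xp i.
have [d d0 dU] := oU x Ux.
have d20 : 0 < d / 2 by rewrite divr_gt0.
have [q] := @rat_in_itvoo R 0 (d / 2) d20.
rewrite in_itv /= => /andP[q0 qd].
have /choice[c cP] : forall i : 'I_n, exists c : rat, `|x ord0 i - ratr c| < ratr q.
  move=> i; have [|c] := @rat_in_itvoo R (x ord0 i - ratr q) (x ord0 i + ratr q); first lra.
  by rewrite in_itv /= => /andP[? ?]; exists c; rewrite ltr_norml; apply/andP; lra.
pose p : ('rV[rat]_n * rat)%type := (\row_i c i, q).
exists p.
  move=> y yp; apply: dU; apply: (@le_lt_trans _ _ (2 * ratr q)); last lra.
  apply: norm_le_coord => [|i]; first lra.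
  have := yp i; have := cP i; rewrite !mxE /= ltr_norml ler_norml.
  by move=> /andP[? ?] /andP[? ?]; apply/andP; lra.
move=> i; rewrite !mxE /=.
by have := cP i; rewrite ltr_norml => /andP[? ?]; apply/andP; lra.
Qed.

Lemma open_measurable_rV n (U : set 'rV[R]_n) : open U -> measurable U.
Proof.
move=> /open_bigcup_obox[D [a [b [-> _]]]]; rewrite bigcup_mkcond.
apply: countable_bigcupT_measurable => [|p]; first exact: countableP.
by case: ifP => // _; exact: measurable_rV_obox.
Qed.

Lemma closed_measurable_rV n (U : set 'rV[R]_n) : closed U -> measurable U.
Proof.
move=> cU; rewrite -[U]setCK; apply: measurableC; apply: open_measurable_rV.
exact: closed_openC.
Qed.

Lemma continuous_measurable_rV n (f : 'rV[R]_n -> R) (D : set 'rV[R]_n) :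
  measurable D -> continuous f -> measurable_fun D f.
Proof.
move=> mD cf; apply: (measurability _ (RGenOpens.measurableE R)).
move=> _ [_ [a [b ->] <-]]; apply: measurableI => //.
by apply: open_measurable_rV; apply: open_comp => //; exact: interval_open.
Qed.

Local Open Scope ereal_scope.

Lemma lebesgue_rV_ball n (x : 'rV[R]_n) (r : R) : (0 <= r)%R ->
  measurable (rV_box (x - const_mx r) (x + const_mx r)) /\
  lebesgue_rV n (rV_box (x - const_mx r) (x + const_mx r)) = ((2 * r) ^+ n)%:E.
Proof.
move=> r0; have [|m ->] := @lebesgue_rV_box R n (x - const_mx r) (x + const_mx r).
  by move=> i; rewrite !mxE; lra.
split=> //; rewrite (eq_bigr (fun=> 2 * r)%R) => [|i _]; last by rewrite !mxE; lra.
by rewrite prodr_const card_ord.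
Qed.

Lemma sub_rV_ball n (A : set 'rV[R]_n) (M : R) : (forall x, A x -> `|x| <= M)%R ->
  A `<=` rV_box (0 - const_mx M) (0 + const_mx M).
Proof.
move=> AM x /AM xM i; have := le_trans (coord_le_norm x i) xM.
by rewrite !mxE !add0r ler_norml.
Qed.

Lemma bounded_setP n (A : set 'rV[R]_n) : bounded_set A ->
  exists2 M : R, (0 < M)%R & forall x, A x -> (`|x| <= M)%R.
Proof.
move=> [M [_ MA]]; exists (Num.max 1 (M + 1))%R; first by rewrite lt_max ltr01.
by move=> x Ax; apply: MA => //; rewrite lt_max ltrDl ltr01 orbT.
Qed.

Lemma lebesgue_rV_bounded n (A : set 'rV[R]_n) : measurable A -> bounded_set A ->
  lebesgue_rV n A < +oo.
Proof.
move=> mA /bounded_setP[M M0 AM].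
have [mB LB] := @lebesgue_rV_ball n 0 M (ltW M0).
apply: (@le_lt_trans _ _ ((2 * M) ^+ n)%:E); last by rewrite ltry.
by rewrite -LB; apply: le_measure; rewrite ?inE//; exact: sub_rV_ball.
Qed.

Lemma lebesgue_rV_open_gt0 n (U : set 'rV[R]_n) : open U -> U !=set0 ->
  0 < lebesgue_rV n U.
Proof.
move=> oU [x Ux]; have [d d0 dU] := (open_epsdelta U).1 oU x Ux.
have d20 : (0 < d / 2)%R by rewrite divr_gt0.
have [mB LB] := @lebesgue_rV_ball n x (d / 2) (ltW d20).
apply: (@lt_le_trans _ _ ((2 * (d / 2)) ^+ n)%:E).
  by rewrite lte_fin exprn_gt0// mulr_gt0.
rewrite -LB; apply: le_measure; rewrite ?inE//; first exact: open_measurable_rV.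
move=> y yB; apply: dU; apply: (@le_lt_trans _ _ (d / 2)%R); last lra.
apply: norm_le_coord => [|i]; first exact: ltW.
by have := yB i; rewrite !mxE ler_norml => /andP[? ?]; apply/andP; lra.
Qed.

Lemma lebesgue_rVS n (A : set 'rV[R]_n.+1) : measurable A ->
  lebesgue_rV n.+1 A = \int[lebesgue_measure]_t
    lebesgue_rV n [set y | A (rV_cons (t, y))].
Proof.
move=> mA; rewrite /= /lebesgue_rV_step /pushforward /= /product_measure1 /=.
apply: eq_integral => t _ /=; congr (lebesgue_rV n _).
by apply/seteqP; split=> y; rewrite /xsection /= inE.
Qed.

Lemma dotv_cons n (v : 'rV[R]_n.+1) t y :
  dotv v (rV_cons (t, y)) = (v ord0 ord0 * t + dotv (rV_uncons v).2 y)%R.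
Proof.
rewrite /dotv big_ord_recl rV_cons0; congr (_ + _)%R.
by apply: eq_bigr => i _; rewrite rV_consS mxE.
Qed.

Lemma measurable_hyperplane n (v : 'rV[R]_n) (c : R) :
  measurable [set x | dotv v x = c].
Proof.
apply: closed_measurable_rV.
rewrite (_ : mkset _ = dotv v @^-1` [set c])//.
by apply: preimage_closed => [x _|]; [exact: continuous_dotv|exact: closed_eq].
Qed.

(** The slices of the hyperplane at a fixed first coordinate are hyperplanes of
    lower dimension, unless the normal is parallel to that axis, in which case the
    hyperplane is a product with a single point. *)
Lemma lebesgue_rV_hyperplane n (v : 'rV[R]_n) (c : R) : v != 0%R ->
  lebesgue_rV n [set x | dotv v x = c] = 0.
Proof.
elim: n v c => [v c /eqP[]|n IH v c v0]; first by apply/rowP => -[].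
have mA := measurable_hyperplane v c.
have E t : [set y | [set x | dotv v x = c] (rV_cons (t, y))] =
    [set y | dotv (rV_uncons v).2 y = c - v ord0 ord0 * t]%R.
  by apply/seteqP; split=> y /=; rewrite dotv_cons; lra.
have [w0|w0] := eqVneq (rV_uncons v).2 0%R; last first.
  by rewrite lebesgue_rVS//; apply: integral0_eq => t _; rewrite E IH.
have v00 : v ord0 ord0 != 0%R.
  apply: contra v0 => /eqP v00; apply/eqP/rowP => i.
  case: (unliftP ord0 i) => [j|] ->; last by rewrite v00 mxE.
  by have /rowP/(_ j) := w0; rewrite !mxE.
rewrite /= /lebesgue_rV_step /pushforward.
rewrite (_ : _ @^-1` _ = [set (c / v ord0 ord0)%R : measurableTypeR R] `*` setT).
  have mS : measurable [set (c / v ord0 ord0)%R : measurableTypeR R].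
    exact: measurable_set1.
  rewrite product_measure1E//.
  by rewrite [X in X * _](lebesgue_measure_set1 (c / v ord0 ord0)) mul0e.
apply/seteqP; split=> -[t y] /=; rewrite dotv_cons w0 [dotv _ y]dotvC dotv0r addr0.
  by move=> <-; rewrite mulrC mulKf.
by move=> [-> _]; rewrite mulrC divfK.
Qed.

End measure_rV.

(** * Flat functions of one variable *)

(** Stated without division by [h], a directional derivative transfers at once
    to lines, slices and affine functions. *)
Lemma is_derive_epsdelta (R : realType) (V : normedModType R) (f : V -> R)
    (x v : V) (df : R) : is_derive x v f df <->
  forall e : R, 0 < e -> exists2 d : R, 0 < d &
    forall h, `|h| < d -> `|f (x + h *: v) - f x - h * df| <= e * `|h|.
Proof.
split=> [[dfx <-] e e0|H].
  have /cvgrPdist_le /(_ _ e0) := dfx.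
  rewrite /derive -nbhs_nearE => /nbhs_ballP[d /= d0 dP]; exists d => // h hd.
  have [->|h0] := eqVneq h 0; first by rewrite scale0r addr0 mul0r !subrr normr0 mulr0.
  have := dP h; rewrite -ball_normE /= sub0r normrN => /(_ hd h0).
  rewrite -(ler_pM2r (_ : 0 < `|h|)) ?normr_gt0// -normrM mulrBl distrC.
  rewrite /GRing.scale /= /shift /= -[h *: v + x]addrC mulrAC mulVf// mul1r.
  by rewrite [_ * h]mulrC.
have cv : h^-1 *: ((f \o shift x) (h *: v) - f x) @[h --> 0^'] --> df.
  apply/cvgrPdist_le => e /H[d d0 dP].
  rewrite -nbhs_nearE; apply/nbhs_ballP; exists d => // h.
  rewrite -ball_normE /= sub0r normrN => /dP hd h0.
  rewrite -(ler_pM2r (_ : 0 < `|h|)) ?normr_gt0// -normrM mulrBl distrC.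
  rewrite /GRing.scale /= /shift /= [h *: v + x]addrC mulrAC mulVf// mul1r.
  by rewrite [df * h]mulrC.
by split; [apply/cvg_ex; exists df|exact: cvg_lim cv].
Qed.

Section smooth_functions_of_one_variable.
Context {R : realType}.
Implicit Types (p : {poly R}) (c x y t : R).

(** The polynomial factor makes the family closed under derivation, so that one
    derivative computation yields smoothness of all its members. *)
Definition flat p c x : R := if 0 < x then p.[x^-1] * expR (- c * x^-1) else 0.

Definition dflat c p : {poly R} := 'X^2 * (c *: p - p^`()).

Lemma expR_decay (m : nat) c : 0 < c ->
  exists2 K : R, 0 <= K & forall y, 0 < y -> y ^+ m * expR (- c * y) <= K.
Proof.
move=> c0; case: m => [|m].
  by exists 1 => // y y0; rewrite expr0 mul1r expR_le1 mulNr oppr_le0 mulr_ge0// ltW.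
exists ((m.+1%:R / c) ^+ m.+1); first by rewrite exprn_ge0// divr_ge0// ltW.
move=> y y0.
have -> : - c * y = m.+1%:R * (- (c * y / m.+1%:R)).
  by rewrite mulrN [_ * (_ / _)]mulrC divfK// mulNr.
rewrite expRM_natl -exprMn lerXn2r ?nnegrE ?mulr_ge0 ?divr_ge0 ?expR_ge0 ?(ltW y0) ?(ltW c0)//.
  by rewrite invr_ge0 ltW.
set z := c * y / _.
have -> : y = m.+1%:R / c * z.
  by rewrite mulrC mulrA /z divfK ?pnatr_eq0// mulrAC divff ?mul1r ?gt_eqF.
rewrite -[leLHS]mulrA ler_piMr//; first by rewrite divr_ge0// ltW.
rewrite expRN ler_pdivrMr ?expR_gt0// mul1r.
by have := expR_ge1Dx z; lra.
Qed.

Lemma poly_exp_decay p c : 0 < c ->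
  exists2 K : R, 0 <= K & forall y, 0 < y -> `|p.[y]| * expR (- c * y) <= K.
Proof.
move=> c0.
have /choice[K KP] : forall m : nat, exists K : R, 0 <= K /\
    forall y, 0 < y -> y ^+ m * expR (- c * y) <= K.
  by move=> m; have [K ? ?] := expR_decay m c0; exists K.
exists (\sum_(i < size p) `|p`_i| * K i).
  by apply: sumr_ge0 => i _; rewrite mulr_ge0//; have [] := KP i.
move=> y y0; rewrite horner_coef.
apply: (@le_trans _ _ ((\sum_(i < size p) `|p`_i| * y ^+ i) * expR (- c * y))).
  rewrite ler_wpM2r ?expR_ge0// (le_trans (ler_norm_sum _ _ _))// ler_sum// => i _.
  by rewrite normrM (ger0_norm (exprn_ge0 _ (ltW y0))).
rewrite mulr_suml ler_sum// => i _; rewrite -mulrA ler_wpM2l//.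
by have [_] := KP i; apply.
Qed.

Lemma flat_le0 p c x : x <= 0 -> flat p c x = 0.
Proof. by move=> x0; rewrite /flat ltNge x0. Qed.

Lemma flat_bound p c : 0 < c -> exists2 K : R, 0 <= K & forall x, `|flat p c x| <= K * x ^+ 2.
Proof.
move=> c0; have [K K0 KP] := poly_exp_decay ('X^2 * p) c0; exists K => // x.
rewrite /flat; case: ifPn => [x0|_]; last by rewrite normr0 mulr_ge0 ?sqr_ge0.
rewrite -ler_pdivrMr ?exprn_gt0//; apply: le_trans (KP x^-1 _); last by rewrite invr_gt0.
rewrite hornerM hornerXn normrM (ger0_norm (expR_ge0 _)) normrM.
by rewrite [`|_ ^+ 2|]ger0_norm ?sqr_ge0// exprVn [leRHS]mulrAC [leRHS]mulrC mulrA mulrAC mulrC.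
Qed.

Lemma is_derive_flat p c x : 0 < c -> is_derive x 1 (flat p c) (flat (dflat c p) c x).
Proof.
move=> c0; have [x0|x0|->] := ltgtP x 0.
- rewrite flat_le0 ?(ltW x0)//.
  have : is_derive x 1 (cst 0 : R -> R) 0 by exact: is_derive_cst.
  apply: near_eq_is_derive.
  by near=> y; rewrite /= flat_le0//; near: y; exact: lt_le_nbhsl.
- have xn0 : x != 0 by rewrite gt_eqF.
  have dV : is_derive x 1 (fun y : R => y^-1) (- x ^- 2).
    have := @is_deriveV _ id x 1 1 xn0 (is_derive_id _ _).
    by rewrite /GRing.scale /= mulr1.
  have dp := is_derive1_comp (is_derive_poly p x^-1) dV.
  have dc : is_derive x 1 (fun y : R => - c * y^-1) (- c * - x ^- 2).
    exact: is_deriveZ dV.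
  have de := @is_derive1_comp _ expR (fun y => - c * y^-1) x _ _ (is_derive_expR _) dc.
  have := is_deriveM dp de.
  have -> : flat (dflat c p) c x = (horner p \o (fun y => y^-1)) x *: (expR (- c * x^-1) * (- c * - x ^- 2)) +
     (expR \o (fun y => - c * y^-1)) x *: (p^`().[x^-1] * - x ^- 2).
    rewrite /flat x0 /dflat hornerM hornerXn hornerD hornerZ hornerN /= /GRing.scale /=.
    by rewrite exprVn; lra.
  apply: near_eq_is_derive; near=> y.
  rewrite /flat (_ : 0 < y)//=.
  by near: y; exact: lt_nbhsr.
- have [K K0 KP] := flat_bound p c0.
  rewrite flat_le0//; apply/is_derive_epsdelta => e e0.
  have K1 : 0 < K + 1 by lra.
  exists (e / (K + 1)) => [|h]; first exact: divr_gt0.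
  rewrite ltr_pdivlMr// add0r scaler1 (flat_le0 _ _ (lexx 0)) !subr0 mulr0 subr0.
  move=> hd; apply: (le_trans (KP h)).
  rewrite -real_normK ?num_real// expr2 mulrA ler_wpM2r//.
  by have := normr_ge0 h; lra.
Unshelve. all: by end_near. Qed.
End smooth_functions_of_one_variable.

(** * Smooth functions of several variables *)

Section smooth_functions.
Context {R : realType} {n : nat}.
Implicit Types (u w : 'rV[R]_n -> R) (x y : 'rV[R]_n) (i : 'I_n) (k : nat).

Definition smooth u := forall k, class_C k u.

Lemma class_CW k u : class_C k.+1 u -> class_C k u.
Proof.
elim: k u => [u [cu _]//|k IH u [cu Du]]; split=> // i.
by have [du Cu] := Du i; split=> //; apply: IH.
Qed.

Lemma class_C_continuous k u : class_C k u -> continuous u.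
Proof. by case: k => [|k] []. Qed.

Lemma is_derive_partial u i x : derivable u x (delta_mx ord0 i) ->
  is_derive x (delta_mx ord0 i) u (partial i u x).
Proof. by move=> du; split. Qed.

Lemma partialE u (du : 'I_n -> 'rV[R]_n -> R) :
  (forall i x, is_derive x (delta_mx ord0 i) u (du i x)) ->
  (forall i x, derivable u x (delta_mx ord0 i)) /\ forall i, partial i u = du i.
Proof.
move=> H; split=> [i x|i]; first by case: (H i x).
by apply/funext => x; rewrite /partial; case: (H i x).
Qed.

Lemma class_CS k u (du : 'I_n -> 'rV[R]_n -> R) : continuous u ->
  (forall i x, is_derive x (delta_mx ord0 i) u (du i x)) ->
  (forall i, class_C k (du i)) -> class_C k.+1 u.
Proof.
move=> cu /partialE[dv pE] Cdu; split=> // i; split=> //.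
by rewrite pE.
Qed.

Lemma class_C_cst k (a : R) : class_C k (cst a : 'rV[R]_n -> R).
Proof.
elim: k a => [|k IH] a; first by split=> // x; exact: cst_continuous.
apply: (@class_CS _ _ (fun _ => cst 0)) => //; first by move=> x; exact: cst_continuous.
Qed.

Lemma class_CD k u w : class_C k u -> class_C k w -> class_C k (fun x => u x + w x).
Proof.
elim: k u w => [u w [cu _] [cw _]|k IH u w [cu Du] [cw Dw]].
  by split=> // x; apply: continuousD; [exact: cu|exact: cw].
apply: (@class_CS _ _ (fun i x => partial i u x + partial i w x)).
- by move=> x; apply: continuousD; [exact: cu|exact: cw].
- by move=> i x; apply: is_deriveD; apply: is_derive_partial; [exact: (Du i).1|exact: (Dw i).1].
- by move=> i; apply: IH; [exact: (Du i).2|exact: (Dw i).2].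
Qed.

Lemma class_CM k u w : class_C k u -> class_C k w -> class_C k (fun x => u x * w x).
Proof.
elim: k u w => [u w [cu _] [cw _]|k IH u w Cu Cw].
  by split=> // x; apply: continuousM; [exact: cu|exact: cw].
have [cu Du] := Cu; have [cw Dw] := Cw.
apply: (@class_CS _ _ (fun i x => u x * partial i w x + w x * partial i u x)).
- by move=> x; apply: continuousM; [exact: cu|exact: cw].
- by move=> i x; apply: is_deriveM; apply: is_derive_partial; [exact: (Du i).1|exact: (Dw i).1].
- by move=> i; apply: class_CD; apply: IH => //; (try exact: class_CW);
    [exact: (Dw i).2|exact: (Du i).2].
Qed.

(** Directional derivatives are derivatives along lines, which gives the chain
    rule from the one for functions of one variable. *)
Lemma is_derive_line u x v (du : R) : is_derive x v u du <->
  is_derive (0 : R) 1 (fun h => u (x + h *: v)) du.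
Proof.
split=> /is_derive_epsdelta H; apply/is_derive_epsdelta => e /H[d d0 dP].
  by exists d => // h /dP; rewrite add0r scaler1 scale0r addr0.
by exists d => // h /dP; rewrite add0r scaler1 scale0r addr0.
Qed.

Lemma is_derive_comp_rV (g : R -> R) u x v (dg du : R) :
  is_derive (u x) 1 g dg -> is_derive x v u du -> is_derive x v (g \o u) (dg * du).
Proof.
move=> Dg /is_derive_line Du; apply/is_derive_line.
by apply: (@is_derive1_comp _ g (fun h => u (x + h *: v))) => //; rewrite scale0r addr0.
Qed.

(** Quantifying over a family that is closed under derivation avoids any
    formula for higher derivatives of a composition. *)
Lemma class_C_comp (F : set (R -> R)) :
  (forall g, F g -> exists2 g', F g' & forall t : R, is_derive t 1 g (g' t)) ->
  forall k g u, F g -> class_C k u -> class_C k (g \o u).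
Proof.
move=> HF.
have cg g : F g -> continuous g.
  move=> /HF[g' _ Dg] t; apply: differentiable_continuous.
  by apply/derivable1_diffP; case: (Dg t).
elim=> [g u Fg [cu _]|k IH g u Fg Cu].
  by split=> // x; apply: continuous_comp; [exact: cu|exact: cg].
have [cu Du] := Cu; have [g' Fg' Dg] := HF _ Fg.
apply: (@class_CS _ _ (fun i x => (g' \o u) x * partial i u x)).
- by move=> x; apply: continuous_comp; [exact: cu|exact: cg].
- move=> i x; apply: is_derive_comp_rV => //; apply: is_derive_partial.
  exact: (Du i).1.
- move=> i; apply: class_CM; last exact: (Du i).2.
  by apply: IH => //; exact: class_CW.
Qed.

Lemma class_C_flat k p c u : 0 < c -> class_C k u -> class_C k (flat p c \o u).
Proof.
move=> c0; apply: (@class_C_comp [set g | exists p, g = flat p c]); last by exists p.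
by move=> _ [q ->]; exists (flat (dflat c q) c) => [|t];
  [exists (dflat c q)|exact: is_derive_flat].
Qed.

Lemma is_derive_affine (a : 'rV[R]_n) (b : R) x v :
  is_derive x v (fun y => dotv a y + b) (dotv a v).
Proof.
apply/is_derive_epsdelta => e e0; exists 1 => // h _.
rewrite dotvDr dotvZr (_ : _ - _ = 0) ?normr0 ?mulr_ge0 ?(ltW e0)//.
by lra.
Qed.

Lemma class_C_affine k (a : 'rV[R]_n) (b : R) : class_C k (fun y => dotv a y + b).
Proof.
have ca : continuous (fun y : 'rV[R]_n => dotv a y + b).
  by move=> x; apply: continuousD; [exact: continuous_dotv|exact: cst_continuous].
case: k => [//|k]; apply: (@class_CS _ _ (fun i => cst (dotv a (delta_mx ord0 i)))) => //.
  by move=> i x; exact: is_derive_affine.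
by move=> i; exact: class_C_cst.
Qed.

(** The smooth function [t exp(-1/((k+1)t))] for [t > 0] approximates the positive
    part of [t] within [1/(k+1)], and its slope lies in [0, 1]. *)
Definition spos k (t : R) : R := t * flat 1 k.+1%:R^-1 t.
Definition dspos k (t : R) : R := flat (1 + (k.+1%:R^-1) *: 'X) k.+1%:R^-1 t.

Lemma is_derive_spos k (t : R) : is_derive t 1 (spos k) (dspos k t).
Proof.
have c0 : 0 < k.+1%:R^-1 :> R by rewrite invr_gt0.
have := is_deriveM (is_derive_id t 1) (is_derive_flat 1 t c0).
rewrite (_ : _ + _ = dspos k t)// /dspos /flat /GRing.scale /=.
case: ifPn => t0; last by rewrite mulr0 mul0r addr0.
rewrite /dflat derivC subr0 !hornerE /=.
have tV : t * t^-1 = 1 by rewrite mulfV// gt_eqF.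
by rewrite tV mul1r mulr1 mulrDl mul1r addrC [t^-1 / _]mulrC.
Qed.

Lemma class_C_spos j k u : class_C j u -> class_C j (spos k \o u).
Proof. by move=> Cu; apply: class_CM => //; apply: class_C_flat => //; rewrite invr_gt0. Qed.

Lemma spos_le0 k t : t <= 0 -> spos k t = 0.
Proof. by move=> t0; rewrite /spos flat_le0// mulr0. Qed.

Lemma spos_ge0 k t : 0 <= spos k t.
Proof.
rewrite /spos /flat; case: ifP => t0; rewrite ?mulr0// hornerC.
by rewrite mulr_ge0 ?(ltW t0)// mul1r expR_ge0.
Qed.

Lemma spos_bounds k t :
  Num.max t 0 - k.+1%:R^-1 <= spos k t /\ spos k t <= Num.max t 0.
Proof.
have k0 : 0 < k.+1%:R^-1 :> R by rewrite invr_gt0.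
have [t0|t0] := leP t 0; first by rewrite spos_le0//; split; lra.
rewrite /spos /flat t0 hornerC mul1r.
set z := - _ * _; have z0 : z <= 0 by rewrite /z mulNr oppr_le0 mulr_ge0 ?invr_ge0 ?(ltW t0).
split; last by rewrite ler_piMr ?(ltW t0)// expR_le1.
have -> : k.+1%:R^-1 = - (t * z).
  by rewrite /z mulNr mulrN opprK mulrCA mulfV ?mulr1// gt_eqF.
rewrite opprK -{1}[t]mulr1 -mulrDr ler_wpM2l ?(ltW t0)//.
exact: expR_ge1Dx.
Qed.

Lemma dspos_bounds k t : 0 <= dspos k t /\ dspos k t <= 1.
Proof.
rewrite /dspos /flat; case: ifPn => t0; last by lra.
rewrite !hornerE mulNr expRN.
set z := _ * t^-1; have z0 : 0 <= z by rewrite mulr_ge0 ?invr_ge0 ?(ltW t0).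
split; first by rewrite mulr_ge0 ?invr_ge0 ?expR_ge0//; lra.
by rewrite ler_pdivrMr ?expR_gt0// mul1r expR_ge1Dx.
Qed.

Lemma dspos_le0 k t : t <= 0 -> dspos k t = 0.
Proof. by move=> t0; rewrite /dspos flat_le0. Qed.

Lemma cvg_dspos (t_ : nat -> R) (t : R) : t_ @ \oo --> t -> t != 0 ->
  dspos k (t_ k) @[k --> \oo] --> ((0 < t)%R%:R : R).
Proof.
move=> tt; rewrite neq_lt => /orP[t0|t0].
  rewrite ltNge (ltW t0) /=; apply: cvg_near_cst; near=> k.
  rewrite dspos_le0//; near: k.
  exact: (cvgr_le t).
rewrite t0 /=.
have cz : k.+1%:R^-1 * (t_ k)^-1 @[k --> \oo] --> (0 : R).
  rewrite -(mul0r t^-1); apply: cvgM; first exact: cvg_harmonic.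
  by apply: cvgV => //; rewrite gt_eqF.
have cE : (1 + k.+1%:R^-1 * (t_ k)^-1) * expR (- (k.+1%:R^-1 * (t_ k)^-1)) @[k --> \oo] --> (1 : R).
  rewrite -[X in _ --> X](mulr1 1); apply: cvgM.
    by rewrite -[X in _ --> X](addr0 1); apply: cvgD => //; exact: cvg_cst.
  rewrite -[X in _ --> X](@expR0 R) -[X in _ --> expR X](@oppr0 R).
  by apply: continuous_cvg; [exact: continuous_expR|exact: cvgN].
apply: cvg_trans cE; apply: near_eq_cvg; near=> k.
rewrite /dspos /flat (_ : 0 < t_ k); last by near: k; exact: (cvgr_gt t).
by rewrite !hornerE mulNr.
Unshelve. all: by end_near. Qed.

(** As [k] grows this tends to the indicator of [0 < t]. *)
Definition sstep k (t : R) : R := flat 1 k.+1%:R^-1 t.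

Lemma sstep_bounds k t : 0 <= sstep k t /\ sstep k t <= 1.
Proof.
rewrite /sstep /flat; case: ifPn => t0; last by lra.
rewrite hornerC mul1r; split; first exact: expR_ge0.
by rewrite expR_le1 mulNr oppr_le0 mulr_ge0 ?invr_ge0 ?(ltW t0).
Qed.

Lemma cvg_sstep t : sstep k t @[k --> \oo] --> ((0 < t)%R%:R : R).
Proof.
have [t0|t0] := ltP 0 t; rewrite /=; last first.
  by under eq_fun do rewrite /sstep flat_le0//; exact: cvg_cst.
rewrite (_ : (fun k => sstep k t) = fun k => expR (- (k.+1%:R^-1 * t^-1))); last first.
  by apply/funext => k; rewrite /sstep /flat t0 hornerC mul1r mulNr.
rewrite (_ : true%:R = expR (- 0) :> R); last by rewrite oppr0 expR0.
apply: continuous_cvg; first exact: continuous_expR.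
apply: cvgN; rewrite -(mul0r t^-1); apply: cvgM; first exact: cvg_harmonic.
exact: cvg_cst.
Qed.

End smooth_functions.

(** * Partial derivatives of compactly supported functions have integral zero *)

Section integration_by_parts.
Context {R : realType}.
Implicit Types (n : nat).
Local Notation lam := (@lebesgue_measure R).

Lemma is_derive_near0 (V : normedModType R) (f : V -> R) (x v : V) (df : R) :
  is_derive x v f df -> (\forall y \near x, f y = 0) -> df = 0.
Proof.
move=> Df f0.
have D0 : is_derive x v f 0.
  apply: near_eq_is_derive (is_derive_cst (0 : R) x v).
  by apply: filterS f0 => y ->.
by case: Df => _ <-; case: D0 => _ ->.
Qed.

Lemma compact_bounded_fun n (K : set 'rV[R]_n) (F : 'rV[R]_n -> R) : continuous F -> compact K ->
  exists2 k : R, 0 <= k & forall x, K x -> `|F x| <= k.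
Proof.
move=> cF cK.
have [K0|/set0P/negP/negPn/eqP K0] := pselect (K !=set0); last first.
  by exists 0 => // x; rewrite K0.
have cg' : continuous (fun x => `|F x|).
  by move=> x; apply: continuous_comp; [exact: cF|exact: norm_continuous].
have [p _ pP] := EVT_max_rV K0 cK (continuous_subspaceT cg').
by exists `|F p| => // x Kx; apply: pP; rewrite inE.
Qed.

Lemma continuous_support_integrable n (g : 'rV[R]_n -> R) (M : R) :
  continuous g -> (forall x, M < `|x| -> g x = 0) ->
  (lebesgue_rV n).-integrable setT (EFin \o g).
Proof.
move=> cg gM.
pose B := [set x : 'rV[R]_n | `|x| <= `|M|].
have bB : bounded_set B.
  exists `|M|; split; first exact: num_real.
  by move=> N MN x; rewrite /B /= => /le_trans; apply; exact: ltW.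
have cB : compact B.
  apply: bounded_closed_compact => //.
  rewrite (_ : B = (fun v : 'rV[R]_n => `|v| : R) @^-1` [set r | r <= `|M|])//.
  by apply: preimage_closed; [move=> x _; exact: norm_continuous|exact: closed_le].
have mB : measurable B.
  by apply: closed_measurable_rV; apply: compact_closed => //; exact: norm_hausdorff.
have gE : g = g \_ B.
  apply/funext => x; rewrite patchE; case: ifPn => //.
  rewrite notin_setE /B /= => /negP; rewrite -ltNge => /(le_lt_trans (ler_norm M)).
  exact: gM.
rewrite gE -restrict_EFin -integrable_mkcond//.
apply: measurable_bounded_integrable => //.
- exact: lebesgue_rV_bounded.
- exact: continuous_measurable_rV.
have [k _ kP] := compact_bounded_fun cg cB.
exists k; split; first exact: num_real.
by move=> N kN x Bx /=; apply: le_trans (kP x Bx) (ltW kN).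
Qed.

Lemma integral_derivative_line (F f : R -> R) (M : R) :
  (forall t : R, is_derive t 1 F (f t)) -> continuous f ->
  (forall t, M <= `|t| -> F t = 0) -> (\int[lam]_t (f t)%:E = 0)%E.
Proof.
move=> DF cf FM.
pose N := `|M| + 1.
have N0 : 0 < N by rewrite ltr_wpDl.
have MN : M < N by rewrite (le_lt_trans (ler_norm M))// ltrDl.
have fN t : N <= `|t| -> f t = 0.
  move=> Nt; apply: (is_derive_near0 (DF t)).
  near=> s; apply: FM; apply: ltW; near: s.
  have : M < `|t| by exact: lt_le_trans Nt.
  move=> Mt; apply: (cvgr_gt `|t|) => //.
  by apply: cvg_norm.
have cF : continuous F.
  move=> t; apply: differentiable_continuous; apply/derivable1_diffP.
  by case: (DF t).
have -> : (\int[lam]_t (f t)%:E = \int[lam]_(t in `[(- N)%R, N]) (f t)%:E)%E.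
  rewrite [RHS]integral_mkcond; apply: eq_integral => t _.
  rewrite patchE; case: ifPn => //; rewrite notin_setE /= in_itv /= => tN.
  rewrite fN// leNgt; apply/negP => /ltW; rewrite ler_norml => ?; exact: tN.
rewrite (@continuous_FTC2 _ f F); first by rewrite !FM ?sub0e ?oppe0 ?normrN ?gtr0_norm// ltW.
- lra.
- exact: continuous_subspaceT.
- split=> [t _| |].
  + by case: (DF t).
  + by apply: cvg_at_right_filter; exact: cF.
  + by apply: cvg_at_left_filter; exact: cF.
- by move=> t _; rewrite derive1E; case: (DF t).
Unshelve. all: by end_near. Qed.

Lemma rV_consD n (t s : R) (y z : 'rV[R]_n) :
  rV_cons (t + s, y + z) = rV_cons (t, y) + rV_cons (s, z).
Proof.
apply/rowP => i; rewrite [RHS]mxE; case: (unliftP ord0 i) => [j|] ->.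
  by rewrite !rV_consS mxE.
by rewrite !rV_cons0.
Qed.

Lemma rV_consZ n (a t : R) (y : 'rV[R]_n) :
  rV_cons (a * t, a *: y) = a *: rV_cons (t, y).
Proof.
apply/rowP => i; rewrite [RHS]mxE; case: (unliftP ord0 i) => [j|] ->.
  by rewrite !rV_consS mxE.
by rewrite !rV_cons0.
Qed.

Lemma rV_cons_delta0 n : @rV_cons R n (1, 0) = delta_mx ord0 ord0.
Proof.
apply/rowP => i; rewrite [RHS]mxE; case: (unliftP ord0 i) => [j|] ->.
  by rewrite rV_consS mxE.
by rewrite rV_cons0.
Qed.

Lemma rV_cons_deltaS n (j : 'I_n) :
  @rV_cons R n (0, delta_mx ord0 j) = delta_mx ord0 (lift ord0 j).
Proof.
apply/rowP => i; rewrite [RHS]mxE; case: (unliftP ord0 i) => [l|] ->.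
  by rewrite rV_consS mxE (inj_eq lift_inj).
by rewrite rV_cons0.
Qed.

Lemma norm_rV_cons_ge n (t : R) (y : 'rV[R]_n) :
  `|t| <= `|rV_cons (t, y)| /\ `|y| <= `|rV_cons (t, y)|.
Proof.
split; first by have := coord_le_norm (rV_cons (t, y)) ord0; rewrite rV_cons0.
apply: norm_le_coord => // i.
by have := coord_le_norm (rV_cons (t, y)) (lift ord0 i); rewrite rV_consS.
Qed.

Lemma norm_rV_cons_le n (t : R) (y : 'rV[R]_n) (a : R) :
  `|t| < a -> `|y| < a -> `|rV_cons (t, y)| < a.
Proof.
move=> ta ya; have a0 : 0 < a by exact: le_lt_trans ta.
apply: norm_lt_coord => // i; case: (unliftP ord0 i) => [j|] ->.
  by rewrite rV_consS; apply: le_lt_trans ya; exact: coord_le_norm.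
by rewrite rV_cons0.
Qed.

(** By Fubini's theorem the integral is iterated so that the inner one runs along
    the line in the direction [i], where it vanishes; the induction on the dimension
    peels off the other coordinates. *)
Lemma integral_partial_eq0 n (i : 'I_n) (F dF : 'rV[R]_n -> R) (M : R) :
  (forall x, is_derive x (delta_mx ord0 i) F (dF x)) -> continuous dF ->
  (forall x, M <= `|x| -> F x = 0) ->
  (\int[lebesgue_rV n]_x (dF x)%:E = 0)%E.
Proof.
elim: n i F dF M => [[]//|n IH] i F dF M DF cdF FM.
have dFM x : M < `|x| -> dF x = 0.
  move=> Mx; apply: (is_derive_near0 (DF x)).
  have : nbhs x [set y | M < `|y|].
    apply: open_nbhs_nbhs; split => //.
    rewrite (_ : mkset _ = (fun v : 'rV[R]_n.+1 => `|v| : R) @^-1` [set r | M < r])//.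
    by apply: open_comp; [move=> v _; exact: norm_continuous|exact: open_gt].
  by apply: filterS => y /ltW /FM.
have idF := continuous_support_integrable cdF dFM.
have /integrableP[mdF _] := idF.
have mcons := @measurable_rV_cons R n.
have idF2 : (lam \x lebesgue_rV n)%E.-integrable setT ((EFin \o dF) \o @rV_cons R n).
  apply/integrableP; split; first exact: (measurableT_comp mdF mcons).
  case/integrableP : idF => _; rewrite [X in (\int[X]_x _ < _)%E -> _]/= /lebesgue_rV_step.
  rewrite (ge0_integral_pushforward mcons)//.
  exact: measurableT_comp.
have -> : (\int[lebesgue_rV n.+1]_x (dF x)%:E =
    \int[lam \x lebesgue_rV n]_p (dF (rV_cons p))%:E)%E.
  by rewrite /= /lebesgue_rV_step (integral_pushforward mcons)//= preimage_setT.
case: (unliftP ord0 i) => [j|] iE.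
- rewrite -(integral12_prod_meas1 idF2); apply: integral0_eq => t _ /=.
  apply: (IH j (fun y => F (rV_cons (t, y))) _ M).
  + move=> y; apply/is_derive_epsdelta => e e0.
    have /is_derive_epsdelta /(_ e e0)[d d0 dP] := DF (rV_cons (t, y)).
    exists d => // h /dP; rewrite iE -rV_cons_deltaS -rV_consZ mulr0 -rV_consD.
    by rewrite addr0.
  + apply/continuous_epsdelta => y e e0.
    have [d d0 dP] := (continuous_epsdelta dF).1 cdF (rV_cons (t, y)) e e0.
    exists d => // z yz; apply: dP.
    rewrite -scaleN1r -rV_consZ -rV_consD mulN1r subrr scaleN1r.
    by apply: norm_rV_cons_le; rewrite ?normr0.
  + by move=> y My; apply: FM; apply: le_trans My _; have [] := norm_rV_cons_ge t y.
- rewrite -(integral21_prod_meas1 idF2); apply: integral0_eq => y _ /=.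
  apply: (@integral_derivative_line (fun t => F (rV_cons (t, y))) _ M).
  + move=> t; apply/is_derive_epsdelta => e e0.
    have /is_derive_epsdelta /(_ e e0)[d d0 dP] := DF (rV_cons (t, y)).
    exists d => // h /dP; rewrite iE -rV_cons_delta0 -rV_consZ scaler0 -rV_consD.
    by rewrite addr0.
  + move=> t; apply/(@cvgrPdist_lt _ _ _ (nbhs t)) => e e0.
    have [d d0 dP] := (continuous_epsdelta dF).1 cdF (rV_cons (t, y)) e e0.
    apply/nbhs_ballP; exists d => // s; rewrite -ball_normE /= => ts; apply: dP.
    rewrite -scaleN1r -rV_consZ -rV_consD mulN1r scaleN1r subrr.
    by apply: norm_rV_cons_le; rewrite ?normr0.
  + by move=> t My; apply: FM; apply: le_trans My _; have [] := norm_rV_cons_ge t y.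
Qed.

End integration_by_parts.

(** * The fundamental lemma of the calculus of variations *)

Section test_functions.
Context {R : realType} {n : nat}.
Local Notation mu := (@lebesgue_rV R n).
Implicit Types (Omega Q : set 'rV[R]_n) (phi F : 'rV[R]_n -> R).

Definition compact_support_in Omega F :=
  compact (closure [set x | F x != 0]) /\ closure [set x | F x != 0] `<=` Omega.

Lemma compact_support_inW Omega phi F :
  (forall x, phi x = 0 -> F x = 0) -> compact_support_in Omega phi ->
  compact_support_in Omega F.
Proof.
move=> H [cphi sphi].
have sub : closure [set x | F x != 0] `<=` closure [set x | phi x != 0].
  by apply: closure_subset => x /=; apply: contra => /eqP /H ->.
split; last exact: subset_trans sphi.
by apply: subclosed_compact cphi sub; exact: closed_closure.
Qed.

Lemma compact_support_in_closed Omega C F : compact C -> C `<=` Omega ->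
  (forall x, ~ C x -> F x = 0) -> compact_support_in Omega F.
Proof.
move=> cC CO FC.
have clC : closed C by apply: compact_closed => //; exact: norm_hausdorff.
have sub : closure [set x | F x != 0] `<=` C.
  rewrite [X in _ `<=` X]((closure_id C).1 clC); apply: closure_subset => x /=.
  by move=> Fx; apply: contrapT => /FC Fx0; move: Fx; rewrite Fx0 eqxx.
split; last exact: subset_trans CO.
by apply: subclosed_compact cC sub; exact: closed_closure.
Qed.

Lemma test_functionP Omega phi :
  test_function Omega phi <-> smooth phi /\ compact_support_in Omega phi.
Proof. by split=> [[? ? ?]|[? [? ?]]]; split. Qed.

Lemma compact_support_out Omega F x : compact_support_in Omega F ->
  ~ Omega x -> F x = 0.
Proof.
move=> [_ sF] nx; apply: contrapT => Fx; apply: nx; apply: sF.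
by apply: subset_closure; apply/eqP.
Qed.

Lemma compact_support_bounded Omega F : compact_support_in Omega F ->
  exists M, forall x, M <= `|x| -> F x = 0.
Proof.
move=> [/compact_bounded /bounded_setP[M M0 MP] _]; exists (M + 1) => x Mx.
apply: contrapT => /eqP Fx; have : `|x| <= M.
  by apply: MP; exact: subset_closure.
by lra.
Qed.

Lemma near_closureC F x : ~ closure [set x | F x != 0] x ->
  \forall y \near x, F y = 0.
Proof.
move=> nx; have : nbhs x (~` closure [set x | F x != 0]).
  by apply: open_nbhs_nbhs; split => //; apply: closed_openC; exact: closed_closure.
apply: filterS => y ny; apply: contrapT => /eqP Fy; apply: ny.
exact: subset_closure.
Qed.

Lemma partial_near0 F i x : derivable F x (delta_mx ord0 i) ->
  (\forall y \near x, F y = 0) -> partial i F x = 0.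
Proof. by move=> /is_derive_partial /is_derive_near0. Qed.

Lemma compact_support_partial Omega F i : class_C 1 F ->
  compact_support_in Omega F -> compact_support_in Omega (partial i F).
Proof.
move=> [_ DF] [cF sF]; apply: (compact_support_in_closed cF sF) => x /near_closureC.
by apply: partial_near0; exact: (DF i).1.
Qed.

Lemma integral_compact_support_in Omega F : measurable Omega ->
  compact_support_in Omega F ->
  (\int[mu]_(x in Omega) (F x)%:E = \int[mu]_x (F x)%:E)%E.
Proof.
move=> mO sF; rewrite integral_mkcond; apply: eq_integral => x _.
rewrite patchE; case: ifPn => //; rewrite notin_setE => nx.
by rewrite (compact_support_out sF).
Qed.

Lemma integral_partial_compact_support Omega F i : measurable Omega ->
  class_C 1 F -> compact_support_in Omega F ->
  (\int[mu]_(x in Omega) (partial i F x)%:E = 0)%E.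
Proof.
move=> mO CF sF; have [_ DF] := CF.
rewrite (integral_compact_support_in mO (compact_support_partial i CF sF)).
have [M MP] := compact_support_bounded sF.
apply: (@integral_partial_eq0 _ _ i F _ M) => //.
- by move=> x; apply: is_derive_partial; exact: (DF i).1.
- by have [_ []] := DF i.
Qed.

Lemma continuous_compact_support_integrable Omega F : measurable Omega ->
  continuous F -> compact_support_in Omega F -> mu.-integrable Omega (EFin \o F).
Proof.
move=> mO cF /compact_support_bounded[M MP].
apply: (@integrableS _ _ _ _ setT) => //.
by apply: (@continuous_support_integrable _ _ _ M) => // x /ltW /MP.
Qed.

Lemma compact_support_bound Omega F : continuous F -> compact_support_in Omega F ->
  exists2 k : R, 0 <= k & forall x, `|F x| <= k.
Proof.
move=> cF sF; have [k k0 kP] := compact_bounded_fun cF sF.1.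
exists k => // x; have [->|Fx] := eqVneq (F x) 0; first by rewrite normr0.
by apply: kP; exact: subset_closure.
Qed.

(** These test functions converge to the indicator of the open box. *)
Definition bump (a b : 'rV[R]_n) k (x : 'rV[R]_n) : R :=
  \prod_(i < n) (sstep k (x ord0 i - a ord0 i) * sstep k (b ord0 i - x ord0 i)).

Lemma class_C_prod (I : Type) (r : seq I) (f : I -> 'rV[R]_n -> R) j :
  (forall i, class_C j (f i)) -> class_C j (fun x => \prod_(i <- r) f i x).
Proof.
move=> Cf; elim: r => [|i r IH].
  by under eq_fun do rewrite big_nil; exact: class_C_cst.
by under eq_fun do rewrite big_cons; apply: class_CM.
Qed.

Lemma smooth_bump a b k : smooth (bump a b k).
Proof.
move=> j; apply: class_C_prod => i; apply: class_CM.
  apply: (@class_C_flat _ _ _ _ _ (fun x : 'rV[R]_n => x ord0 i - a ord0 i)).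
    by rewrite invr_gt0.
  under eq_fun do rewrite -dotv_delta dotvC; exact: class_C_affine.
apply: (@class_C_flat _ _ _ _ _ (fun x : 'rV[R]_n => b ord0 i - x ord0 i)).
  by rewrite invr_gt0.
under eq_fun do rewrite addrC -[X in - X]dotv_delta dotvC -dotvNl.
exact: class_C_affine.
Qed.

Lemma bump_bounds a b k x : 0 <= bump a b k x /\ bump a b k x <= 1.
Proof.
split.
  apply: prodr_ge0 => i _; apply: mulr_ge0; exact: (sstep_bounds _ _).1.
apply: prodr_ile1 => i _; rewrite mulr_ge0 ?(sstep_bounds _ _).1//=.
by rewrite mulr_ile1 ?(sstep_bounds _ _).1 ?(sstep_bounds _ _).2.
Qed.

Lemma bump_out a b k x : ~ rV_obox a b x -> bump a b k x = 0.
Proof.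
move=> /existsNP[i /negP]; rewrite negb_and -!leNgt => H.
rewrite /bump (bigD1 i)//= /sstep; case/orP: H => H.
  by rewrite [flat _ _ _]flat_le0 ?subr_le0// !mul0r.
by rewrite [X in _ * X * _]flat_le0 ?subr_le0// mulr0 mul0r.
Qed.

Lemma cvg_bump a b x : rV_obox a b x -> bump a b k x @[k --> \oo] --> (1 : R).
Proof.
move=> xab; rewrite [X in _ --> X](_ : _ = \prod_(i < n) (1 : R)); last by rewrite big1.
apply: cvg_big => [|i _]; first exact: mul_continuous.
have /andP[h1 h2] := xab i.
rewrite -[X in _ --> X](mulr1 (1 : R)); apply: cvgM.
  by have := @cvg_sstep R (x ord0 i - a ord0 i); rewrite subr_gt0 h1.
by have := @cvg_sstep R (b ord0 i - x ord0 i); rewrite subr_gt0 h2.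
Qed.

Lemma compact_rV_box (a b : 'rV[R]_n) : compact (rV_box a b).
Proof.
rewrite (_ : rV_box a b =
    [set v | forall i, `[a ord0 i, b ord0 i]%classic (v ord0 i)]).
  apply: (@rV_compact R n (fun i => `[a ord0 i, b ord0 i]%classic)) => i.
  exact: segment_compact.
by apply/seteqP; split=> x xab i; have := xab i; rewrite /= in_itv.
Qed.

Lemma test_bump Omega a b k : rV_box a b `<=` Omega -> test_function Omega (bump a b k).
Proof.
move=> abO; apply/test_functionP; split; first exact: smooth_bump.
apply: (compact_support_in_closed (@compact_rV_box a b) abO) => x nx.
apply: bump_out => xab; apply: nx => i.
by have /andP[/ltW -> /ltW ->] := xab i.
Qed.

Let oboxes := [set rV_obox p.1 p.2 | p in [set: 'rV[R]_n * 'rV[R]_n]].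

Lemma measurable_rV_oboxE : @measurable _ 'rV[R]_n = <<s oboxes >>.
Proof.
apply/seteqP; split; last first.
  apply: smallest_sub; first exact: sigma_algebra_measurable.
  by move=> _ [p _ <-]; exact: measurable_rV_obox.
pose T := g_sigma_algebraType oboxes.
have mid : measurable_fun [set: T] (id : T -> 'rV[R]_n).
  apply: measurable_fun_rV => i.
  apply: (measurability _ (RGenOpens.measurableE R)).
  move=> _ [_ [a [b ->] <-]]; rewrite setTI.
  pose A (k : nat) : 'rV[R]_n := \row_j if j == i then a else - k%:R.
  pose B (k : nat) : 'rV[R]_n := \row_j if j == i then b else k%:R.
  rewrite (_ : _ @^-1` _ = \bigcup_k (rV_obox (A k) (B k) : set T)).
    apply: bigcup_measurable => k _; apply: sub_sigma_algebra.
    by exists (A k, B k).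
  apply/seteqP; split=> [x /= | x [k _ /(_ i)]]; rewrite /= in_itv /=; last first.
    by rewrite !mxE eqxx.
  move=> xab; have [k kP] := ltr_add_invr (ltr01 : 0 < 1 :> R).
  exists (Num.bound `|x : 'rV[R]_n|) => // j; rewrite !mxE.
  case: eqP => [-> //|_].
  have := le_lt_trans (coord_le_norm (x : 'rV[R]_n) j) (archi_boundP (normr_ge0 (x : 'rV[R]_n))).
  by rewrite ltr_norml.
by move=> A mA; have := mid measurableT A mA; rewrite setTI.
Qed.

Lemma setI_rV_obox (a b c d : 'rV[R]_n) : rV_obox a b `&` rV_obox c d =
  rV_obox (\row_i Num.max (a ord0 i) (c ord0 i)) (\row_i Num.min (b ord0 i) (d ord0 i)).
Proof.
apply/seteqP; split=> x.
  move=> [h1 h2] i; rewrite !mxE; have /andP[p1 p2] := h1 i; have /andP[p3 p4] := h2 i.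
  by rewrite gt_max lt_min p1 p2 p3 p4.
move=> h; split=> i; have := h i; rewrite !mxE gt_max lt_min.
  by move=> /andP[/andP[-> _] /andP[-> _]].
by move=> /andP[/andP[_ ->] /andP[_ ->]].
Qed.

Lemma measurable_rV_box (a b : 'rV[R]_n) : measurable (rV_box a b).
Proof.
apply: closed_measurable_rV; apply: compact_closed; first exact: norm_hausdorff.
exact: compact_rV_box.
Qed.

(** Dominated convergence along the bumps of the box, which are admissible test
    functions. *)
Lemma integral_obox_eq0 Omega (w : 'rV[R]_n -> R) (a b : 'rV[R]_n) :
  open Omega -> loc_integrable Omega w ->
  (forall phi, test_function Omega phi -> \int[mu]_(x in Omega) (w x * phi x) = 0) ->
  rV_box a b `<=` Omega -> (\int[mu]_(x in rV_obox a b) (w x)%:E = 0)%E.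
Proof.
move=> oO [mw iw] w0 abO; set Q := rV_obox a b.
have mO : measurable Omega by exact: open_measurable_rV.
have mQ : measurable Q by exact: measurable_rV_obox.
have Qbox : Q `<=` rV_box a b.
  by move=> x xQ i; have /andP[/ltW -> /ltW ->] := xQ i.
have mB := measurable_rV_box a b.
have iwQ : mu.-integrable Q (EFin \o w).
  apply: (@integrableS _ _ _ _ (rV_box a b)) => //; apply: iw => //.
  exact: compact_rV_box.
have /integrableP[mwQ _] := iwQ.
have mbump k : measurable_fun Q (bump a b k).
  apply: continuous_measurable_rV => //.
  exact: (class_C_continuous (smooth_bump a b k 0)).
have mwb k : measurable_fun Q (fun x => (w x * bump a b k x)%:E).
  apply/measurable_EFinP; apply: measurable_funM => //.
  by apply: (measurable_funS mO) mw; exact: subset_trans Qbox abO.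
have := @dominated_convergence _ _ _ mu Q mQ (fun k x => (w x * bump a b k x)%:E)
  (EFin \o w) (abse \o (EFin \o w)) mwb mwQ.
case.
- apply: aeW => x Qx /=; apply/cvg_EFin; first exact: nearW.
  rewrite -[X in _ --> X]mulr1; apply: cvgM; first exact: cvg_cst.
  exact: cvg_bump.
- exact: integrable_abse.
- apply: aeW => x k Qx /=; rewrite lee_fin normrM ler_piMr//.
  by rewrite ger0_norm ?(bump_bounds _ _ _ _).1 ?(bump_bounds _ _ _ _).2.
move=> _ _.
rewrite (_ : [sequence _]_k = cst 0%E); last first.
  apply/funext => k /=.
  have wE : (\int[mu]_(x in Omega) (w x * bump a b k x)%:E =
             \int[mu]_(x in Q) (w x * bump a b k x)%:E)%E.
    rewrite integral_mkcond [RHS]integral_mkcond; apply: eq_integral => x _.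
    rewrite !patchE; case: ifPn => [|nQ].
      rewrite inE => Ox; case: ifPn => //; rewrite notin_setE => nQ.
      by rewrite bump_out// mulr0.
    case: ifPn => //; rewrite inE => /Qbox /abO Ox.
    by move: nQ; rewrite notin_setE.
  have w0k := w0 _ (test_bump k abO); rewrite /Rintegral wE in w0k.
  rewrite -[LHS]fineK ?w0k//; apply: integrable_fin_num => //.
  apply: (@le_integrable _ _ _ _ _ _ _ (EFin \o w)) => // x Qx /=.
  rewrite lee_fin normrM ler_piMr//.
  by rewrite ger0_norm ?(bump_bounds _ _ _ _).1 ?(bump_bounds _ _ _ _).2.
by move=> /cvg_lim <- //; rewrite lim_cst.
Qed.

(** The measurable sets on which the integral of [w] over the box vanishes form a
    Dynkin system that contains the open boxes. *)
Lemma ae_eq0_obox Omega (w : 'rV[R]_n -> R) (a b : 'rV[R]_n) :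
  open Omega -> loc_integrable Omega w ->
  (forall phi, test_function Omega phi -> \int[mu]_(x in Omega) (w x * phi x) = 0) ->
  rV_box a b `<=` Omega -> {ae mu, forall x, rV_obox a b x -> w x = 0}.
Proof.
move=> oO lw w0 abO; set Q := rV_obox a b.
have mO : measurable Omega by exact: open_measurable_rV.
have mQ : measurable Q by exact: measurable_rV_obox.
have iwQ : mu.-integrable Q (EFin \o w).
  apply: (@integrableS _ _ _ _ (rV_box a b)) => //.
  - exact: measurable_rV_box.
  - by move=> x xQ i; have /andP[/ltW -> /ltW ->] := xQ i.
  - by apply: lw.2 => //; exact: compact_rV_box.
have iS S : measurable S -> mu.-integrable (S `&` Q) (EFin \o w).
  by move=> mS; apply: integrableS iwQ => //; exact: measurableI.
have key S : measurable S -> (\int[mu]_(x in S `&` Q) (w x)%:E = 0)%E.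
  move=> mS.
  apply: (@dynkin_induction _ _ oboxes
    (fun S => (\int[mu]_(x in S `&` Q) (w x)%:E = 0)%E)).
  - exact: measurable_rV_oboxE.
  - move=> _ _ [[a1 b1] _ <-] [[a2 b2] _ <-]; rewrite setI_rV_obox /=.
    by eexists (_, _).
  - by rewrite setTI; exact: integral_obox_eq0 w0 abO.
  - move=> _ [[a1 b1] _ <-]; rewrite setI_rV_obox; apply: integral_obox_eq0 w0 _ => //.
    apply: subset_trans abO => x xB i; have := xB i; rewrite !mxE ge_max le_min.
    by move=> /andP[/andP[_ ->] /andP[_ ->]].
  - move=> A mA A0; have mAC := measurableC mA.
    have QE : (A `&` Q) `|` (~` A `&` Q) = Q by rewrite -setIUl setUv setTI.
    have := @Rintegral_setU _ _ _ mu (A `&` Q) (~` A `&` Q) w (measurableI _ _ mA mQ) (measurableI _ _ mAC mQ).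
    rewrite QE => /(_ iwQ); rewrite /Rintegral A0 add0r.
    rewrite (integral_obox_eq0 oO lw w0 abO) => H.
    rewrite -[LHS]fineK; last first.
      by apply: integrable_fin_num; [exact: measurableI|exact: iS].
    rewrite -H//; apply/disj_setPS => x [[Ax _] [nAx _]]; exact: nAx.
  - move=> F mF tF F0; rewrite setI_bigcupl integral_bigcup.
    + by apply: eseries0 => k _ _; rewrite F0.
    + by apply: trivIset_setIr.
    + by move=> k; apply: measurableI.
    + by rewrite -setI_bigcupl; apply: iS; exact: bigcup_measurable.
  - by rewrite -measurable_rV_oboxE.
have := @integral_ae_eq _ _ _ mu Q mQ (cst 0%E) (EFin \o w) iwQ.
case=> [||N [mN N0 NP]].
- exact: measurable_cst.
- move=> E EQ mE; rewrite integral0 -[RHS](key E mE); congr integral.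
  by rewrite setIidl.
exists N; split=> // x nx; apply: NP => /= H; apply: nx => Qx.
by have /= [] := H Qx.
Qed.

Lemma ae_forall_countable (I : countType) (D : set I) (P : I -> 'rV[R]_n -> Prop) :
  (forall i, D i -> {ae mu, forall x, P i x}) ->
  {ae mu, forall x, forall i, D i -> P i x}.
Proof.
move=> H.
have /ae_foralln : forall k : nat, {ae mu, forall x, forall i : I, unpickle k = Some i -> D i -> P i x}.
  move=> k; case: (unpickle k) => [i|]; last by apply: aeW.
  have [Di|nDi] := pselect (D i).
    by apply: filterS (H i Di) => x Px j [<-].
  by apply: aeW => x j [<-].
by apply: filterS => x Px i; apply: (Px (pickle i)); rewrite pickleK.
Qed.

(** The boxes that lie in [Omega] cover it, and countably many of them suffice. *)
Theorem ae_eq0_test_function Omega (w : 'rV[R]_n -> R) :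
  open Omega -> loc_integrable Omega w ->
  (forall phi, test_function Omega phi -> \int[mu]_(x in Omega) (w x * phi x) = 0) ->
  {ae mu, forall x, Omega x -> w x = 0}.
Proof.
move=> oO lw w0; have [D [a [b [OE abO]]]] := open_bigcup_obox oO.
have : {ae mu, forall x, forall p, D p -> rV_obox (a p) (b p) x -> w x = 0}.
  by apply: ae_forall_countable => p Dp; apply: ae_eq0_obox (abO _ Dp).
by apply: filterS => x H; rewrite OE => -[p Dp xp]; exact: H xp.
Qed.

End test_functions.

(** * Weak gradients *)

Section weak_gradients.
Context {R : realType} {n : nat}.
Local Notation mu := (@lebesgue_rV R n).
Implicit Types (Omega : set 'rV[R]_n) (u w phi psi : 'rV[R]_n -> R)
  (v : 'rV[R]_n -> 'rV[R]_n).

Lemma loc_integrableM Omega w phi : open Omega -> loc_integrable Omega w ->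
  continuous phi -> compact_support_in Omega phi ->
  mu.-integrable Omega (fun x => (w x * phi x)%:E).
Proof.
move=> oO [mw iw] cphi sphi; have mO := open_measurable_rV oO.
have [k k0 kP] := compact_support_bound cphi sphi.
set K := closure [set x | phi x != 0].
have mK : measurable K by apply: closed_measurable_rV; exact: closed_closure.
have iK : mu.-integrable K (EFin \o w) by apply: iw; [exact: sphi.1|exact: sphi.2].
have mwphi : measurable_fun Omega (fun x => w x * phi x).
  by apply: measurable_funM => //; exact: continuous_measurable_rV.
have iKwphi : mu.-integrable K (fun x => (w x * phi x)%:E).
  apply: (@le_integrable _ _ _ _ _ _ _ (fun x => (k%:E * (EFin \o w) x)%E)) => //.
  - by apply/measurable_EFinP; apply: measurable_funS mwphi => //; exact: sphi.2.
  - move=> x Kx /=; rewrite lee_fin !normrM (ger0_norm k0) mulrC ler_wpM2r//.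
  - exact: integrableZl.
apply/(integrable_mkcond _ mO).
have /(integrable_mkcond _ mK) := iKwphi.
rewrite (_ : _ \_ K = (fun x => (w x * phi x)%:E) \_ Omega)//.
apply/funext => x; rewrite !patchE; case: ifPn => [|nK].
  by rewrite inE => /sphi.2 Ox; rewrite mem_set.
case: ifPn => // _.
have -> : phi x = 0; last by rewrite mulr0.
apply: contrapT => /eqP px; move: nK; rewrite notin_setE; apply.
exact: subset_closure.
Qed.

Lemma loc_integrableB Omega u w : loc_integrable Omega u -> loc_integrable Omega w ->
  loc_integrable Omega (fun x => u x - w x).
Proof.
move=> [mu1 iu] [mw iw]; split; first exact: measurable_funB.
move=> K cK KO; have mK : measurable K.
  by apply: closed_measurable_rV; apply: compact_closed => //; exact: norm_hausdorff.
exact: (integrableB mK (iu _ cK KO) (iw _ cK KO)).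
Qed.

Lemma loc_integrable_continuous Omega w : open Omega -> continuous w ->
  loc_integrable Omega w.
Proof.
move=> oO cw; split; first by apply: continuous_measurable_rV => //; exact: open_measurable_rV.
move=> K cK KO; have mK : measurable K.
  by apply: closed_measurable_rV; apply: compact_closed => //; exact: norm_hausdorff.
apply: measurable_bounded_integrable => //.
- by apply: lebesgue_rV_bounded => //; exact: compact_bounded.
- exact: continuous_measurable_rV.
have [k k0 kP] := compact_bounded_fun cw cK.
exists k; split; first exact: num_real.
by move=> N kN x Kx /=; apply: le_trans (kP x Kx) (ltW kN).
Qed.

Lemma test_partial Omega phi i : test_function Omega phi ->
  continuous (partial i phi) /\ compact_support_in Omega (partial i phi).
Proof.
move=> /test_functionP[sm cs]; split.
  by have [_ /(_ i)[_ []]] := sm 1.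
exact: compact_support_partial.
Qed.

Lemma test_continuous Omega phi : test_function Omega phi ->
  continuous phi /\ compact_support_in Omega phi.
Proof. by move=> /test_functionP[sm cs]; split=> //; have [] := sm 0. Qed.

Lemma weak_gradient_unique Omega u v v' : open Omega ->
  weak_gradient Omega u v -> weak_gradient Omega u v' ->
  {ae mu, forall x, Omega x -> v x = v' x}.
Proof.
move=> oO [lu lv Hv] [_ lv' Hv']; have mO := open_measurable_rV oO.
have H (i : 'I_n) : [set: 'I_n] i -> {ae mu, forall x, Omega x -> v x ord0 i - v' x ord0 i = 0}.
  move=> _; apply: ae_eq0_test_function => //; first exact: loc_integrableB.
  move=> phi tphi; have [cphi sphi] := test_continuous tphi.
  under eq_Rintegral do rewrite mulrBl.
  rewrite RintegralB//; first last.
  - exact: loc_integrableM.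
  - exact: loc_integrableM.
  have := Hv phi i tphi; rewrite (Hv' phi i tphi) => /oppr_inj ->.
  by rewrite subrr.
have := ae_forall_countable H.
by apply: filterS => x Hx Ox; apply/rowP => i; apply/eqP; rewrite -subr_eq0; apply/eqP; exact: Hx.
Qed.

Lemma weak_gradient_grad Omega u v : weak_gradient Omega u v ->
  weak_gradient Omega u (grad Omega u).
Proof. by move=> uv; rewrite /grad; case: xgetP => [y _ //|/(_ v)]. Qed.

Lemma grad_ae Omega u v : open Omega -> weak_gradient Omega u v ->
  {ae mu, forall x, Omega x -> grad Omega u x = v x}.
Proof.
move=> oO uv.
exact: weak_gradient_unique (weak_gradient_grad uv) uv.
Qed.

Lemma weak_gradientB Omega u w v v' : open Omega ->
  weak_gradient Omega u v -> weak_gradient Omega w v' ->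
  weak_gradient Omega (fun x => u x - w x) (fun x => v x - v' x).
Proof.
move=> oO [lu lv Hv] [lw lv' Hv']; have mO := open_measurable_rV oO.
split; first exact: loc_integrableB.
  by move=> i; under eq_fun do rewrite !mxE; exact: loc_integrableB.
move=> phi i tphi; have [cphi sphi] := test_continuous tphi.
have [cd sd] := test_partial i tphi.
under eq_Rintegral do rewrite mulrBl.
under [in RHS]eq_Rintegral do rewrite !mxE mulrBl.
rewrite !RintegralB//; try exact: loc_integrableM.
by rewrite Hv// Hv'// opprB opprK addrC.
Qed.

(** The product rule and the vanishing of the integral of the partial derivative
    of [u * phi]. *)
Lemma weak_gradient_class_C Omega u : open Omega -> class_C 1 u ->
  weak_gradient Omega u (fun x => \row_i partial i u x).
Proof.
move=> oO Cu; have [cu Du] := Cu; have mO := open_measurable_rV oO.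
have cd i : continuous (partial i u) by have [_ []] := Du i.
split; first exact: loc_integrable_continuous.
  by move=> i; under eq_fun do rewrite mxE; exact: loc_integrable_continuous.
move=> phi i tphi; have [cphi sphi] := test_continuous tphi.
have [cdp sdp] := test_partial i tphi.
have Cphi : class_C 1 phi by have /test_functionP[] := tphi.
under [in RHS]eq_Rintegral do rewrite mxE.
apply/eqP; rewrite -addr_eq0; apply/eqP.
rewrite -RintegralD//; try by apply: loc_integrableM => //; exact: loc_integrable_continuous.
have Cup : class_C 1 (fun x => u x * phi x) by exact: class_CM.
have sup : compact_support_in Omega (fun x => u x * phi x).
  by apply: compact_support_inW sphi => x ->; rewrite mulr0.
have := integral_partial_compact_support i mO Cup sup.
rewrite (_ : partial i _ = fun x => u x * partial i phi x + partial i u x * phi x).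
  by rewrite /Rintegral => ->.
apply/funext => x.
have D : is_derive x (delta_mx ord0 i) (fun x => u x * phi x)
    (u x * partial i phi x + phi x * partial i u x).
  apply: is_deriveM; apply: is_derive_partial; first exact: (Du i).1.
  by have [_ /(_ i)[]] := Cphi.
by rewrite /partial; case: D => _ ->; rewrite [phi x * _]mulrC.
Qed.

Lemma weak_gradient_affine Omega xi c : open Omega ->
  weak_gradient Omega (affine_fun xi c) (fun=> xi).
Proof.
move=> oO; have := weak_gradient_class_C oO (class_C_affine 1 xi c).
rewrite (_ : (fun x => _) = fun=> xi)//; apply/funext => x; apply/rowP => i.
rewrite mxE /partial; case: (is_derive_affine xi c x (delta_mx ord0 i)) => _ ->.
by rewrite dotv_delta.
Qed.

Lemma measurable_enorm Omega v : measurable Omega ->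
  (forall i, measurable_fun Omega (fun x => v x ord0 i)) ->
  measurable_fun Omega (fun x => enorm (v x)).
Proof.
move=> mO mv; rewrite /enorm.
apply: (measurable_comp measurableT) => //.
  apply: continuous_measurable_fun; exact: sqrt_continuous.
rewrite /dotv; apply: measurable_sum => i.
exact: measurable_funM.
Qed.

Lemma weak_gradient_measurable Omega u v : weak_gradient Omega u v ->
  measurable_fun Omega u /\ forall i, measurable_fun Omega (fun x => v x ord0 i).
Proof. by move=> [[mu1 _] lv _]; split=> // i; have [] := lv i. Qed.

(** The norm is defined through a chosen representative of the weak gradient;
    uniqueness allows computing it with any other one. *)
Lemma norm_W11E Omega u v : open Omega -> weak_gradient Omega u v ->
  norm_W11 Omega u = (\int[mu]_(x in Omega) (`|u x| + enorm (v x))%:E)%E.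
Proof.
move=> oO uv; have mO := open_measurable_rV oO.
have ug := weak_gradient_grad uv.
have [mu1 mv] := weak_gradient_measurable uv.
have [_ mg] := weak_gradient_measurable ug.
have mnu : measurable_fun Omega (fun x => `|u x|).
  by apply: measurableT_comp.
apply: ae_eq_integral => //.
- apply/measurable_EFinP; apply: measurable_funD => //; exact: measurable_enorm.
- apply/measurable_EFinP; apply: measurable_funD => //; exact: measurable_enorm.
- by apply: filterS (grad_ae oO uv) => x H Ox /=; rewrite H.
Qed.

Lemma W11_0_approx Omega phi v (e : R) : open Omega ->
  W11_0 Omega phi -> weak_gradient Omega phi v -> 0 < e ->
  exists psi, [/\ test_function Omega psi,
   (\int[mu]_(x in Omega) `|phi x - psi x|%:E <= e%:E)%E &
   forall i, (\int[mu]_(x in Omega) `|v x ord0 i - partial i psi x|%:E <= e%:E)%E].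
Proof.
move=> oO [_ H] phiv e0; have mO := open_measurable_rV oO.
have [psi tpsi q] := H e e0; exists psi.
have /test_functionP[sm _] := tpsi.
have wg := weak_gradientB oO phiv (weak_gradient_class_C oO (sm 1%N)).
move: q; rewrite (norm_W11E oO wg) => /ltW le_e.
have [mu1 mv] := weak_gradient_measurable wg.
have mnu : measurable_fun Omega (fun x => `|phi x - psi x|).
  by apply: measurableT_comp.
split=> // [|i]; apply: le_trans le_e; apply: ge0_le_integral => //.
- exact/measurable_EFinP.
- by apply/measurable_EFinP; apply: measurable_funD => //; exact: measurable_enorm.
- by move=> x _; rewrite lee_fin lerDl enorm_ge0.
- apply/measurable_EFinP; apply: measurableT_comp => //.
  by move: (mv i); under eq_fun do rewrite !mxE.
- by apply/measurable_EFinP; apply: measurable_funD => //; exact: measurable_enorm.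
- move=> x _; rewrite lee_fin; apply: (@le_trans _ _ (enorm (v x - \row_i partial i psi x))).
    by have := coord_le_enorm (v x - \row_i partial i psi x) i; rewrite !mxE.
  by rewrite lerDr.
Qed.

End weak_gradients.

(** * Zero trace and directional derivatives *)

Section zero_trace.
Context {R : realType} {n : nat}.
Local Notation mu := (@lebesgue_rV R n).
Implicit Types (Omega : set 'rV[R]_n) (u w phi psi : 'rV[R]_n -> R)
  (v : 'rV[R]_n -> 'rV[R]_n).

(** A substitute for the absolute value: smooth, with slopes in [-1, 1], zero only
    at [0], so that its composition with a test function is a test function. *)
Definition sabs (t : R) : R := spos 0 t + spos 0 (- t).
Definition dsabs (t : R) : R := dspos 0 t - dspos 0 (- t).

Lemma is_derive_sabs (t : R) : is_derive t 1 sabs (dsabs t).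
Proof.
have dN : is_derive t 1 (fun s : R => - s) (- 1) by apply: is_deriveN.
have := is_deriveD (is_derive_spos 0 t)
  (@is_derive1_comp _ (spos 0) (fun s : R => - s) t _ _ (is_derive_spos 0 (- t)) dN).
by rewrite mulrN1.
Qed.

Lemma dsabs_bound t : `|dsabs t| <= 1.
Proof.
have [? ?] := dspos_bounds 0 t; have [? ?] := dspos_bounds 0 (- t).
by rewrite /dsabs ler_norml; apply/andP; lra.
Qed.

Lemma sabs_ge0 t : 0 <= sabs t.
Proof. by rewrite addr_ge0 ?spos_ge0. Qed.

Lemma sabs_le_norm t : sabs t <= `|t|.
Proof.
rewrite /sabs; have [t0|t0] := leP t 0.
  rewrite spos_le0// add0r; have [_] := spos_bounds 0 (- t).
  by rewrite max_l ?oppr_ge0// ler0_norm.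
rewrite [spos 0 (- t)]spos_le0 ?oppr_le0 ?(ltW t0)// addr0; have [_] := spos_bounds 0 t.
by rewrite max_l ?(ltW t0)// gtr0_norm.
Qed.

Lemma sabs_eq0 t : sabs t = 0 -> t = 0.
Proof.
have pos (s : R) : 0 < s -> 0 < spos 0 s.
  by move=> s0; rewrite /spos /flat s0 hornerC mul1r mulr_gt0 ?expR_gt0.
move=> t0; apply/eqP; rewrite eq_le; apply/andP; split; rewrite leNgt; apply/negP => h.
  by have := pos _ h; have := spos_ge0 0 (- t); move: t0; rewrite /sabs; lra.
have h' : 0 < - t by lra.
by have := pos _ h'; have := spos_ge0 0 t; move: t0; rewrite /sabs; lra.
Qed.

Lemma continuous_sabs : continuous sabs.
Proof.
move=> t; apply: differentiable_continuous; apply/derivable1_diffP.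
by case: (is_derive_sabs t).
Qed.

Lemma sabs_lipschitz s t : `|sabs s - sabs t| <= `|s - t|.
Proof.
wlog st : s t / t <= s.
  move=> H; have [/H//|/ltW /H] := leP t s.
  by rewrite distrC [leRHS]distrC.
move: st; rewrite le_eqVlt => /predU1P[->|ts]; first by rewrite !subrr normr0.
have [c _ ->] := MVT ts (fun x _ => is_derive_sabs x)
  (continuous_subspaceT continuous_sabs).
by rewrite normrM ler_piMl// dsabs_bound.
Qed.

Lemma class_C_sabs psi k : class_C k psi -> class_C k (fun x => sabs (psi x)).
Proof.
move=> Cpsi; apply: class_CD; first exact: class_C_spos.
apply: (@class_C_spos _ _ _ _ (fun x => - psi x)).
under eq_fun do rewrite -mulN1r.
by apply: class_CM => //; exact: class_C_cst.
Qed.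

Lemma le_of_forall_eps (x k : R) : (forall e : R, 0 < e -> x <= k * e) -> x <= 0.
Proof.
move=> H; rewrite leNgt; apply/negP => x0.
have k0 : 0 < `|k| + 1 by rewrite ltr_wpDl.
have := H (x / (2 * (`|k| + 1))); rewrite divr_gt0 ?mulr_gt0// => /(_ isT).
apply/negP; rewrite -ltNge.
apply: (@le_lt_trans _ _ ((`|k| + 1) * (x / (2 * (`|k| + 1))))).
  rewrite ler_wpM2r ?divr_ge0 ?mulr_ge0 ?(ltW k0) ?(ltW x0)//.
  by rewrite (le_trans (ler_norm k))// lerDl.
rewrite invfM mulrCA [_ * (_^-1 * _)]mulrCA divff ?gt_eqF// mulr1.
by lra.
Qed.

(** The derivatives of the approximating test functions have integral zero. *)
Lemma W11_0_mean0 Omega phi v i : open Omega -> W11_0 Omega phi ->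
  weak_gradient Omega phi v ->
  mu.-integrable Omega (fun x => (v x ord0 i)%:E) ->
  \int[mu]_(x in Omega) v x ord0 i = 0.
Proof.
move=> oO W pv iv; have mO := open_measurable_rV oO.
apply/eqP; rewrite -normr_eq0 eq_le normr_ge0 andbT.
apply: (@le_of_forall_eps _ 1) => e e0; rewrite mul1r.
have [psi [tpsi _ /(_ i) le_e]] := W11_0_approx oO W pv e0.
have [cd sd] := test_partial i tpsi.
have /test_functionP[sm cs] := tpsi.
have id : mu.-integrable Omega (EFin \o partial i psi).
  exact: continuous_compact_support_integrable.
have i0 : \int[mu]_(x in Omega) partial i psi x = 0.
  by rewrite /Rintegral (integral_partial_compact_support i mO (sm 1%N) cs).
have iB : mu.-integrable Omega (fun x => (v x ord0 i - partial i psi x)%:E).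
  exact: (integrableB mO iv id).
rewrite -[X in `|X|]subr0 -[X in _ - X]i0 -RintegralB//.
apply: (le_trans (le_normr_Rintegral mO iB)).
have iN := integrable_norm iB.
by rewrite -lee_fin /Rintegral fineK//; exact: integrable_fin_num.
Qed.

Lemma integrable_dotv Omega v (nu : 'rV[R]_n) : measurable Omega ->
  (forall i, mu.-integrable Omega (fun x => (v x ord0 i)%:E)) ->
  mu.-integrable Omega (fun x => (dotv (v x) nu)%:E).
Proof.
move=> mO iv; rewrite /dotv.
rewrite (_ : (fun x => _) = fun x => (\sum_(i < n) (v x ord0 i * nu ord0 i)%:E)%E); last first.
  by apply/funext => x; rewrite sumEFin.
apply: integrable_sum => // i _.
under eq_fun do rewrite mulrC EFinM; exact: integrableZl.
Qed.

Lemma Rintegral_dotv Omega v (nu : 'rV[R]_n) : measurable Omega ->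
  (forall i, mu.-integrable Omega (fun x => (v x ord0 i)%:E)) ->
  \int[mu]_(x in Omega) dotv (v x) nu =
  \sum_(i < n) nu ord0 i * \int[mu]_(x in Omega) v x ord0 i.
Proof.
move=> mO iv; rewrite /Rintegral /dotv.
have E x : (\sum_(i < n) v x ord0 i * nu ord0 i)%:E =
   (\sum_(i < n) (nu ord0 i)%:E * (v x ord0 i)%:E)%E.
  by rewrite -sumEFin; apply: eq_bigr => i _; rewrite -EFinM mulrC.
under eq_integral do rewrite E.
rewrite integral_sum//; last by move=> i; exact: integrableZl.
rewrite -[RHS]/(fine (_%:E)); congr fine; rewrite -sumEFin.
apply: eq_bigr => i _; rewrite integralZl// EFinM fineK//.
exact: integrable_fin_num.
Qed.

Lemma ae_eq0_of_ge0_integral0 Omega (h : 'rV[R]_n -> R) : measurable Omega ->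
  mu.-integrable Omega (EFin \o h) -> {ae mu, forall x, Omega x -> 0 <= h x} ->
  \int[mu]_(x in Omega) h x = 0 -> {ae mu, forall x, Omega x -> h x = 0}.
Proof.
move=> mO ih h0 I0; have /integrableP[mh _] := ih.
have : (\int[mu]_(x in Omega) `|(h x)%:E| = 0)%E.
  rewrite (@ae_eq_integral _ _ _ mu Omega (EFin \o h)) => //.
  - have := integrable_fin_num mO ih; rewrite /Rintegral in I0.
    by move=> /fineK <-; rewrite I0.
  - exact: measurableT_comp.
  - by apply: filterS h0 => x H Ox /=; rewrite ger0_norm ?H.
move=> /(ae_eq_integral_abs mu mO mh).
by apply: filterS => x H Ox; have [] := H Ox.
Qed.

(** Poincare's inequality in the direction [nu], with [sabs] for the absolute
    value: the derivative of [dotv nu x * sabs (psi x)] in the direction [nu] has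
    integral zero, and the product rule splits it into the integrand of the
    left-hand side and a term that the right-hand side bounds. *)
Lemma poincare_direction Omega psi (nu : 'rV[R]_n) (M : R) : open Omega ->
  test_function Omega psi ->
  (forall x, Omega x -> `|dotv nu x| <= M) ->
  dotv nu nu * \int[mu]_(x in Omega) sabs (psi x) <=
  M * \int[mu]_(x in Omega) `|dotv (\row_i partial i psi x) nu|.
Proof.
move=> oO tpsi bM; have mO := open_measurable_rV oO.
have /test_functionP[sm cs] := tpsi.
have [cpsi _] := sm 0%N.
have C1 : class_C 1 (fun x => sabs (psi x)) := class_C_sabs (sm 1%N).
have sabs0 : sabs 0 = 0 by rewrite /sabs oppr0 !spos_le0// addr0.
have cs1 : compact_support_in Omega (fun x => sabs (psi x)).
  by apply: compact_support_inW cs => x ->.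
have isabs : mu.-integrable Omega (EFin \o (fun x => sabs (psi x))).
  by apply: continuous_compact_support_integrable => //; exact: (class_C_continuous C1).
have CF : class_C 1 (fun x => dotv nu x * sabs (psi x)).
  apply: class_CM => //; have := class_C_affine 1 nu 0.
  by under eq_fun do rewrite addr0.
have csF : compact_support_in Omega (fun x => dotv nu x * sabs (psi x)).
  by apply: compact_support_inW cs1 => x ->; rewrite mulr0.
pose dF i x := nu ord0 i * sabs (psi x) + dotv nu x * (dsabs (psi x) * partial i psi x).
have dFE i : partial i (fun x => dotv nu x * sabs (psi x)) = dF i.
  apply/funext => x; rewrite /partial.
  have D1 : is_derive x (delta_mx ord0 i) (dotv nu) (nu ord0 i).
    have := is_derive_affine nu 0 x (delta_mx ord0 i).
    by under eq_fun do rewrite addr0; rewrite dotv_delta.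
  have D2 : is_derive x (delta_mx ord0 i) (fun x => sabs (psi x)) (dsabs (psi x) * partial i psi x).
    apply: (@is_derive_comp_rV _ _ sabs); first exact: is_derive_sabs.
    by apply: is_derive_partial; have [_ /(_ i)[]] := sm 1%N.
  have := is_deriveM D1 D2; case=> _.
  rewrite /dF /GRing.scale /= => ->; rewrite addrC; congr (_ + _).
  by rewrite mulrC.
have i0 i : \int[mu]_(x in Omega) dF i x = 0.
  by rewrite /Rintegral -dFE (integral_partial_compact_support i mO CF csF).
have idF i : mu.-integrable Omega (fun x => (dF i x)%:E).
  rewrite -dFE; apply: continuous_compact_support_integrable => //.
    by have [_ /(_ i)[_ []]] := CF.
  exact: compact_support_partial.
have ipart i : mu.-integrable Omega (fun x => (partial i psi x)%:E).
  by have [? ?] := test_partial i tpsi; exact: continuous_compact_support_integrable.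
pose v x : 'rV[R]_n := \row_i partial i psi x.
have iv i : mu.-integrable Omega (fun x => (v x ord0 i)%:E).
  by under eq_fun do rewrite mxE; exact: ipart.
pose V x : 'rV[R]_n := \row_i dF i x.
have iV i : mu.-integrable Omega (fun x => (V x ord0 i)%:E).
  by under eq_fun do rewrite mxE; exact: idF.
have VE x : dotv (V x) nu = dotv nu nu * sabs (psi x) +
    dotv nu x * (dsabs (psi x) * dotv (v x) nu).
  rewrite /dotv /V /v; under eq_bigr do rewrite mxE /dF mulrDl.
  rewrite big_split /=; congr (_ + _).
    by rewrite mulr_suml; apply: eq_bigr => i _; rewrite mulrAC.
  rewrite -/(dotv nu x) 2!mulr_sumr; apply: eq_bigr => i _; rewrite mxE.
  by rewrite -!mulrA.
have IV : \int[mu]_(x in Omega) dotv (V x) nu = 0.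
  rewrite Rintegral_dotv// big1// => i _.
  by under eq_Rintegral do rewrite mxE; rewrite i0 mulr0.
have idV := integrable_dotv nu mO iV.
have idv := integrable_dotv nu mO iv.
rewrite -RintegralZl//.
have iZ : mu.-integrable Omega (EFin \o (fun x => dotv nu nu * sabs (psi x))).
  exact: (integrableZl mO _ isabs).
rewrite -[leLHS]subr0 -IV -RintegralB//.
have iab : mu.-integrable Omega (fun x => `|dotv (v x) nu|%:E) by exact: (integrable_norm idv).
rewrite -RintegralZl//.
apply: le_Rintegral => //.
- exact: (integrableB mO iZ idV).
- exact: (integrableZl mO _ iab).
move=> x Ox; rewrite VE opprD addrA subrr add0r.
apply: (le_trans (ler_norm _)); rewrite normrN normrM ler_pM ?bM//.
by rewrite normrM ler_piMl// dsabs_bound.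
Qed.

(** Poincare's inequality for the approximating test functions, whose derivative
    in the direction [nu] is as small in mean as their distance to [phi]. *)
Lemma W11_0_direction Omega phi v (nu : 'rV[R]_n) : open Omega -> bounded_set Omega ->
  W11_0 Omega phi -> weak_gradient Omega phi v ->
  (forall i, mu.-integrable Omega (fun x => (v x ord0 i)%:E)) -> nu != 0 ->
  {ae mu, forall x, Omega x -> dotv (v x) nu = 0} ->
  {ae mu, forall x, Omega x -> phi x = 0}.
Proof.
move=> oO bO W pv iv nu0 v0; have mO := open_measurable_rV oO.
have [M0 M00 OM0] := bounded_setP bO.
pose M := n%:R * `|nu| * M0.
have OM x : Omega x -> `|dotv nu x| <= M.
  move=> Ox; apply: (le_trans (dotv_le_norm _ _)).
  by rewrite ler_wpM2l ?mulr_ge0 ?OM0.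
have M_ge0 : 0 <= M by rewrite !mulr_ge0// ltW.
have [[iphi _] _] := W.
have nn0 : 0 < dotv nu nu := dotvv_gt0 nu0.
have /integrableP[mphiE _] := iphi.
have mphi : measurable_fun Omega phi by exact/measurable_EFinP.
have msabs g : measurable_fun Omega g -> measurable_fun Omega (fun x => sabs (g x)).
  move=> mg; apply: (measurable_comp measurableT) => //.
  by apply: continuous_measurable_fun; exact: continuous_sabs.
have isphi : mu.-integrable Omega (EFin \o (fun x => sabs (phi x))).
  apply: (@le_integrable _ _ _ _ _ _ _ (EFin \o phi)) => //.
    by apply/measurable_EFinP; exact: msabs.
  by move=> x Ox /=; rewrite lee_fin ger0_norm ?sabs_ge0// sabs_le_norm.
suff I0 : \int[mu]_(x in Omega) sabs (phi x) = 0.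
  have := ae_eq0_of_ge0_integral0 mO isphi _ I0.
  have h : {ae mu, forall x, Omega x -> 0 <= sabs (phi x)}.
    by apply: aeW => x _; exact: sabs_ge0.
  by move=> /(_ h); apply: filterS => x H Ox; apply: sabs_eq0; exact: H.
apply/eqP; rewrite eq_le Rintegral_ge0 ?andbT; last by move=> x _; exact: sabs_ge0.
pose k := M * (\sum_(i < n) `|nu ord0 i|) / dotv nu nu + 1.
apply: (@le_of_forall_eps _ k) => e e0.
have [psi [tpsi le1 le2]] := W11_0_approx oO W pv e0.
have /test_functionP[sm cs] := tpsi.
have [cpsi _] := sm 0%N.
have ipsi : mu.-integrable Omega (EFin \o psi) by exact: continuous_compact_support_integrable.
have ispsi : mu.-integrable Omega (EFin \o (fun x => sabs (psi x))).
  apply: (@le_integrable _ _ _ _ _ _ _ (EFin \o psi)) => //.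
    by apply/measurable_EFinP; apply: msabs; exact: continuous_measurable_rV.
  by move=> x Ox /=; rewrite lee_fin ger0_norm ?sabs_ge0// sabs_le_norm.
have iB : mu.-integrable Omega (fun x => `|phi x - psi x|%:E).
  exact: (integrable_norm (integrableB mO iphi ipsi)).
have step1 : \int[mu]_(x in Omega) sabs (phi x) <=
   \int[mu]_(x in Omega) sabs (psi x) + e.
  apply: (@le_trans _ _ (\int[mu]_(x in Omega) (sabs (psi x) + `|phi x - psi x|))).
    apply: le_Rintegral => //; first exact: (integrableD mO ispsi iB).
    move=> x _; have := sabs_lipschitz (phi x) (psi x).
    by rewrite ler_norml => /andP[_]; lra.
  rewrite RintegralD// lerD2l -lee_fin /Rintegral fineK//.
  exact: integrable_fin_num.
have ipart i : mu.-integrable Omega (fun x => (partial i psi x)%:E).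
  by have [? ?] := test_partial i tpsi; exact: continuous_compact_support_integrable.
have idif i : mu.-integrable Omega (fun x => `|v x ord0 i - partial i psi x|%:E).
  exact: (integrable_norm (integrableB mO (iv i) (ipart i))).
have step2 : \int[mu]_(x in Omega) `|dotv (\row_i partial i psi x) nu| <=
   (\sum_(i < n) `|nu ord0 i|) * e.
  have iS : mu.-integrable Omega
      (fun x => (dotv (\row_i `|v x ord0 i - partial i psi x|) (\row_i `|nu ord0 i|))%:E).
    by apply: integrable_dotv => // i; under eq_fun do rewrite mxE.
  apply: (@le_trans _ _ (\int[mu]_(x in Omega)
     dotv (\row_i `|v x ord0 i - partial i psi x|) (\row_i `|nu ord0 i|))); last first.
    rewrite Rintegral_dotv//; last by move=> i; under eq_fun do rewrite mxE.
    rewrite mulr_suml; apply: ler_sum => i _; rewrite mxE ler_wpM2l//.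
    under eq_Rintegral do rewrite mxE.
    by rewrite -lee_fin /Rintegral fineK//; exact: integrable_fin_num.
  have iv2 i : mu.-integrable Omega (fun x => ((\row_i partial i psi x : 'rV[R]_n) ord0 i)%:E).
    by under eq_fun do rewrite mxE.
  rewrite -lee_fin /Rintegral !fineK; try exact: integrable_fin_num.
    apply: ae_ge0_le_integral => //.
    - by case/integrableP : (integrable_norm (integrable_dotv nu mO iv2)).
    - by move=> x _; rewrite lee_fin; apply: sumr_ge0 => i _; rewrite !mxE mulr_ge0.
    - by case/integrableP : iS.
    - apply: filterS v0 => x vx Ox; rewrite lee_fin.
      have -> : dotv (\row_i partial i psi x) nu = - dotv (v x - \row_i partial i psi x) nu.
        by rewrite dotvBl vx// sub0r opprK.
      rewrite normrN; apply: (le_trans (ler_norm_sum _ _ _)); apply: ler_sum => i _.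
      by rewrite normrM !mxE.
  exact: (integrable_fin_num mO (integrable_norm (integrable_dotv nu mO iv2))).
have step3 := poincare_direction oO tpsi OM.
have step4 : \int[mu]_(x in Omega) sabs (psi x) <= M * (\sum_(i < n) `|nu ord0 i|) / dotv nu nu * e.
  rewrite mulrAC ler_pdivlMr// mulrC; apply: (le_trans step3).
  by rewrite -[leRHS]mulrA ler_wpM2l.
by apply: (le_trans step1); rewrite /k mulrDl mul1r lerD2r.
Qed.

End zero_trace.

(** * Energy of admissible functions and limits of test functions *)

Section admissible_functions.
Context {R : realType} {n : nat}.
Local Notation mu := (@lebesgue_rV R n).
Implicit Types (Omega : set 'rV[R]_n) (u w phi psi : 'rV[R]_n -> R)
  (v : 'rV[R]_n -> 'rV[R]_n) (f : 'rV[R]_n -> R).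

Lemma weak_gradient_ae0 Omega phi v : open Omega -> weak_gradient Omega phi v ->
  {ae mu, forall x, Omega x -> phi x = 0} -> {ae mu, forall x, Omega x -> v x = 0}.
Proof.
move=> oO pv p0; have mO := open_measurable_rV oO.
have [lp lv Hv] := pv.
apply: (weak_gradient_unique oO pv); split=> //.
  move=> i; under eq_fun do rewrite mxE.
  by apply: loc_integrable_continuous => // x; exact: cst_continuous.
move=> psi i tpsi; have [cd sd] := test_partial i tpsi.
have iM := loc_integrableM oO lp cd sd; have /integrableP[mM _] := iM.
rewrite /Rintegral (@ae_eq_integral _ _ _ mu Omega (cst 0%E)) => //.
- by under [in RHS]eq_integral do rewrite mxE mul0r; rewrite integral0 oppr0.
- by apply: filterS p0 => x H Ox /=; rewrite H// mul0r.
Qed.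

Lemma ae_nonempty_open Omega (P : 'rV[R]_n -> Prop) : open Omega -> Omega !=set0 ->
  {ae mu, forall x, Omega x -> P x} -> exists2 x, Omega x & P x.
Proof.
move=> oO O0 H; apply: contrapT => nP.
have mO := open_measurable_rV oO.
have := lebesgue_rV_open_gt0 oO O0; rewrite (measure_negligible mO) ?ltxx//.
have [N [mN N0 NP]] := H; exists N; split=> // x Ox; apply: NP => /= /(_ Ox) Px.
by apply: nP; exists x.
Qed.

Lemma admissible_grad Omega xi0 c u : open Omega -> admissible Omega xi0 c u ->
  exists v, [/\ W11_0 Omega (u \- affine_fun xi0 c)%R,
    weak_gradient Omega (u \- affine_fun xi0 c)%R v,
    (forall i, mu.-integrable Omega (fun x => (v x ord0 i)%:E)) &
    {ae mu, forall x, Omega x -> grad Omega u x = v x + xi0}].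
Proof.
move=> oO [W _]; have [[_ [v pv iv]] _] := W; exists v; split=> //.
have := weak_gradientB oO pv (weak_gradient_affine (- xi0) (- c) oO).
rewrite (_ : (fun x => _ - _) = u) => [|].
  move=> /(grad_ae oO); apply: filterS => x H Ox; rewrite H//.
  by rewrite opprK.
apply/funext => x; rewrite /affine_fun /= dotvNl; lra.
Qed.

Lemma energy_le Omega f u (k : R) : (energy Omega f u <= k%:E)%E <->
  {ae mu, forall x, Omega x -> f (grad Omega u x) <= k}.
Proof.
rewrite /energy; split.
  move=> /ess_supP; apply: filterS => x + Ox.
  by rewrite /patch mem_set// lee_fin.
move=> H; apply/ess_supP; apply: filterS H => x H; rewrite /patch.
by case: ifPn => [|_]; rewrite ?leNye// inE => /H; rewrite lee_fin.
Qed.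

(** If the sublevel set [f <= k] lay in a half space through [xi0], the derivative of
    [u - <xi0, .>] in the normal direction would have a sign and mean zero, so it
    would vanish, and [u] would be affine with gradient [xi0]. *)
Lemma energy_surrounds Omega f xi0 c u (k : R) : (0 < n)%N -> open Omega ->
  Omega !=set0 -> bounded_set Omega -> admissible Omega xi0 c u ->
  (energy Omega f u <= k%:E)%E -> k < f xi0 ->
  exists s d, [/\ (forall xi, xi \in s -> f xi <= k), 0 < d & surrounds s xi0 d].
Proof.
move=> n0 oO O0 bO adm /energy_le Ek kf; have mO := open_measurable_rV oO.
have [//|[nu nu0 nuP]] := surrounds_or_halfspace [set xi | f xi <= k] xi0 n0.
have [v [W pv iv gv]] := admissible_grad oO adm.
have pos : {ae mu, forall x, Omega x -> 0 <= dotv (v x) nu}.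
  apply: filterS2 Ek gv => x Ex gx Ox.
  by have := nuP _ (Ex Ox); rewrite gx// addrK.
have zero : {ae mu, forall x, Omega x -> dotv (v x) nu = 0}.
  apply: ae_eq0_of_ge0_integral0 => //; first exact: integrable_dotv.
  rewrite Rintegral_dotv// big1// => i _.
  by rewrite (W11_0_mean0 oO W pv)// mulr0.
have p0 := W11_0_direction oO bO W pv iv nu0 zero.
have v0 := weak_gradient_ae0 oO pv p0.
have : {ae mu, forall x, Omega x -> f xi0 <= k}.
  apply: filterS3 Ek gv v0 => x Ex gx vx Ox.
  by have := Ex Ox; rewrite gx// vx// add0r.
by move=> /(ae_nonempty_open oO O0)[x _]; rewrite leNgt kf.
Qed.

Lemma Linfty_bounded Omega u (C : R) : measurable Omega -> measurable_fun Omega u ->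
  (forall x, Omega x -> `|u x| <= C) -> Linfty Omega u.
Proof.
move=> mO mu1 uC; split=> //.
apply: (@le_lt_trans _ _ (`|C|)%:E); last by rewrite ltry.
rewrite unlock /Lnorm; case: ifP => _; last by rewrite lee_fin.
apply/ess_supP; apply: aeW => x /=; rewrite lee_fin patchE.
case: ifPn => [|_]; last by rewrite normr0.
by rewrite inE => /uC h; apply: le_trans h (ler_norm C).
Qed.

Lemma bounded_integrable Omega u (C : R) : measurable Omega -> bounded_set Omega ->
  measurable_fun Omega u -> (forall x, Omega x -> `|u x| <= C) ->
  mu.-integrable Omega (EFin \o u).
Proof.
move=> mO bO mu1 uC; apply: measurable_bounded_integrable => //.
  exact: lebesgue_rV_bounded.
exists C; split; first exact: num_real.
by move=> N kN x Kx /=; apply: le_trans (uC x Kx) (ltW kN).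
Qed.

Lemma bounded_loc_integrable Omega u (C : R) : measurable Omega -> bounded_set Omega ->
  measurable_fun Omega u -> (forall x, Omega x -> `|u x| <= C) ->
  loc_integrable Omega u.
Proof.
move=> mO bO mu1 uC; split=> // K cK KO.
apply: (@integrableS _ _ _ _ Omega) => //; last exact: bounded_integrable uC.
by apply: closed_measurable_rV; apply: compact_closed => //; exact: norm_hausdorff.
Qed.

Lemma Rintegral_dominated Omega (h : nat -> 'rV[R]_n -> R) (g : 'rV[R]_n -> R) (C : R) :
  measurable Omega -> bounded_set Omega ->
  (forall k, measurable_fun Omega (h k)) -> measurable_fun Omega g ->
  (forall k x, Omega x -> `|h k x| <= C) ->
  {ae mu, forall x, Omega x -> h k x @[k --> \oo] --> g x} ->
  \int[mu]_(x in Omega) h k x @[k --> \oo] --> \int[mu]_(x in Omega) g x.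
Proof.
move=> mO bO mh mg hC hg.
have := @dominated_convergence _ _ _ mu Omega mO (fun k => EFin \o h k)
  (EFin \o g) (cst C%:E).
case.
- by move=> k; apply/measurable_EFinP.
- exact/measurable_EFinP.
- by apply: filterS hg => x H Ox; apply/cvg_EFin; [exact: nearW|exact: H].
- apply: (@bounded_integrable _ (cst C) `|C|) => //.
- by apply: aeW => x k Ox /=; rewrite lee_fin hC.
move=> ig _ H; apply: fine_cvg; rewrite fineK//.
exact: (integrable_fin_num mO ig).
Qed.

(** Dominated convergence gives the weak gradient of the limit and the
    convergence in W^{1,1}, hence zero trace; [Omega] is bounded, so that constants
    are integrable. *)
Lemma test_function_limit Omega (Psi : nat -> 'rV[R]_n -> R) (C : R)
    (v0 : 'rV[R]_n -> 'rV[R]_n) : open Omega -> bounded_set Omega ->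
  (forall N, test_function Omega (Psi N)) -> (forall N x, `|Psi N x| <= C) ->
  (forall N i x, `|partial i (Psi N) x| <= C) ->
  {ae mu, forall x, Omega x -> cvgn (fun N => Psi N x) /\
     forall i, partial i (Psi N) x @[N --> \oo] --> v0 x ord0 i} ->
  exists phi v, [/\ W1oo_0 Omega phi, weak_gradient Omega phi v &
    {ae mu, forall x, Omega x -> v x = v0 x}].
Proof.
move=> oO bO tPsi PsiC dPsiC [N0 [mN0 N00 NP]]; have mO := open_measurable_rV oO.
(* the limit is taken on a measurable set of full measure, to keep measurability *)
pose D := Omega `\` N0.
have mD : measurable D by exact: measurableD.
have C0 : 0 <= C by exact: le_trans (normr_ge0 _) (PsiC 0%N 0).
have DP x : D x -> cvgn (fun N => Psi N x) /\
     forall i, partial i (Psi N) x @[N --> \oo] --> v0 x ord0 i.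
  move=> [Ox nN]; apply: contrapT => H; apply: nN; apply: NP => /= H2; apply: H.
  exact: H2.
have aeD : {ae mu, forall x, Omega x -> D x}.
  exists N0; split=> // x /= H; apply: contrapT => nx; apply: H => Ox.
  by split.
pose phi : 'rV[R]_n -> R := (fun x => limn (fun N => Psi N x)) \_ D.
pose v x : 'rV[R]_n := if x \in D then v0 x else 0.
have mPsi N : measurable_fun Omega (Psi N).
  by apply: continuous_measurable_rV => //; have [] := test_continuous (tPsi N).
have mdPsi N i : measurable_fun Omega (partial i (Psi N)).
  by apply: continuous_measurable_rV => //; have [] := test_partial i (tPsi N).
have cphi x : (fun N => (Psi N \_ D) x) @ \oo --> phi x.
  rewrite /phi; under eq_fun do rewrite patchE; rewrite patchE.
  by case: ifPn => [|_]; [rewrite inE => /DP[]|exact: cvg_cst].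
have cv i x : (fun N => (partial i (Psi N) \_ D) x) @ \oo --> v x ord0 i.
  rewrite /v; under eq_fun do rewrite patchE.
  have [xD|_] := boolP (x \in D); last by rewrite mxE; exact: cvg_cst.
  by have [_] := DP x (set_mem xD); exact.
have mpatch (h : 'rV[R]_n -> R) : measurable_fun Omega h -> measurable_fun Omega (h \_ D).
  move=> mh; apply/measurable_restrict => //.
  by apply: measurable_funS mh => //; exact: subIsetl.
have mphi : measurable_fun Omega phi.
  apply: (@measurable_fun_cvg _ _ _ _ (fun N => Psi N \_ D)).
    by move=> N; exact: mpatch.
  by move=> x _; exact: cphi.
have mv i : measurable_fun Omega (fun x => v x ord0 i).
  apply: (@measurable_fun_cvg _ _ _ _ (fun N => partial i (Psi N) \_ D)).
    by move=> N; exact: mpatch.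
  by move=> x _; exact: cv.
have le_lim (h : nat -> R) l : (forall N, `|h N| <= C) -> h @ \oo --> l -> `|l| <= C.
  move=> hC hl; have hn : (fun N => `|h N|) @ \oo --> `|l| by apply: cvg_norm.
  rewrite -(cvg_lim _ hn)//; apply: limr_le; first by apply/cvg_ex; eexists; exact: hn.
  by near=> N; exact: hC.
have patchC (h : 'rV[R]_n -> R) x : `|h x| <= C -> `|(h \_ D) x| <= C.
  by rewrite patchE; case: ifP => //; rewrite normr0.
have phiC x : `|phi x| <= C by apply: le_lim (cphi x) => N; exact: patchC.
have vC i x : `|v x ord0 i| <= C by apply: le_lim (cv i x) => N; exact: patchC.
have cphi_ae : {ae mu, forall x, Omega x -> Psi N x @[N --> \oo] --> phi x}.
  apply: filterS aeD => x H Ox; have := cphi x.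
  rewrite (_ : (fun N => (Psi N \_ D) x) = Psi ^~ x)//; apply/funext => N.
  by rewrite patchE mem_set//; exact: H.
have cv_ae : {ae mu, forall x, Omega x -> forall i, partial i (Psi N) x @[N --> \oo] --> v x ord0 i}.
  apply: filterS aeD => x H Ox i; have := cv i x.
  rewrite (_ : (fun N => (partial i (Psi N) \_ D) x) = fun N => partial i (Psi N) x)//.
  by apply/funext => N; rewrite patchE mem_set//; exact: H.
have pv : weak_gradient Omega phi v.
  split; first exact: bounded_loc_integrable (fun x _ => phiC x).
    by move=> i; exact: bounded_loc_integrable (fun x _ => vC i x).
  move=> eta i teta; have [ceta seta] := test_continuous teta.
  have [cdeta sdeta] := test_partial i teta.
  have [k1 k10 k1P] := compact_support_bound ceta seta.
  have [k2 k20 k2P] := compact_support_bound cdeta sdeta.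
  have L1 : \int[mu]_(x in Omega) (Psi N x * partial i eta x) @[N --> \oo] -->
      \int[mu]_(x in Omega) (phi x * partial i eta x).
    apply: (@Rintegral_dominated _ _ _ (C * k2)) => //.
    - by move=> N; apply: measurable_funM => //; exact: continuous_measurable_rV.
    - by apply: measurable_funM => //; exact: continuous_measurable_rV.
    - by move=> N x _; rewrite normrM ler_pM.
    - apply: filterS cphi_ae => x H Ox; apply: cvgM; [exact: H|exact: cvg_cst].
  have L2 : \int[mu]_(x in Omega) (partial i (Psi N) x * eta x) @[N --> \oo] -->
      \int[mu]_(x in Omega) (v x ord0 i * eta x).
    apply: (@Rintegral_dominated _ _ _ (C * k1)) => //.
    - by move=> N; apply: measurable_funM => //; exact: continuous_measurable_rV.
    - by apply: measurable_funM => //; exact: continuous_measurable_rV.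
    - by move=> N x _; rewrite normrM ler_pM.
    - apply: filterS cv_ae => x H Ox; apply: cvgM; [exact: H|exact: cvg_cst].
  have E : (fun N => \int[mu]_(x in Omega) (Psi N x * partial i eta x)) =
      (fun N => - \int[mu]_(x in Omega) (partial i (Psi N) x * eta x)).
    apply/funext => N; have /test_functionP[sm _] := tPsi N.
    have [_ _ /(_ eta i teta) ->] := weak_gradient_class_C oO (sm 1%N).
    by congr (- _); apply: eq_Rintegral => x _; rewrite mxE.
  rewrite E in L1.
  have L3 : (fun N => - \int[mu]_(x in Omega) (partial i (Psi N) x * eta x)) @ \oo -->
      - \int[mu]_(x in Omega) (v x ord0 i * eta x) by apply: cvgN.
  exact: (cvg_unique _ L1 L3).
exists phi, v; split=> //; last first.
  by apply: filterS aeD => x H Ox; rewrite /v mem_set//; exact: H.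
have iphi := bounded_integrable mO bO mphi (fun x _ => phiC x).
have iv i := bounded_integrable mO bO (mv i) (fun x _ => vC i x).
split; last first.
  split; first exact: Linfty_bounded (fun x _ => phiC x).
  by exists v => // i; exact: Linfty_bounded (fun x _ => vC i x).
split; first by split=> //; exists v.
move=> e e0.
pose h N x : R := `|phi x - Psi N x| + enorm (v x - \row_i partial i (Psi N) x).
have wg N : weak_gradient Omega (phi \- Psi N)%R (fun x => v x - \row_i partial i (Psi N) x).
  have /test_functionP[sm _] := tPsi N.
  exact: weak_gradientB oO pv (weak_gradient_class_C oO (sm 1%N)).
have mh N : measurable_fun Omega (h N).
  have [m1 m2] := weak_gradient_measurable (wg N).
  apply: measurable_funD; last exact: measurable_enorm.
  exact: measurableT_comp.
have hC N x : Omega x -> `|h N x| <= 2 * C + n%:R * (2 * C).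
  move=> _; rewrite ger0_norm ?addr_ge0 ?enorm_ge0// lerD//.
    by rewrite (le_trans (ler_normB _ _))// mulr2n mulrDl mul1r lerD.
  rewrite (le_trans (enorm_le_norm _))// ler_wpM2l//.
  apply: norm_le_coord => [|i]; first by rewrite mulr_ge0.
  by rewrite !mxE (le_trans (ler_normB _ _))// mulr2n mulrDl mul1r lerD.
have hcvg : {ae mu, forall x, Omega x -> h N x @[N --> \oo] --> (0 : R)}.
  apply: filterS2 cphi_ae cv_ae => x H1 H2 Ox.
  rewrite [X in _ --> X](_ : _ = 0 + 0); last by rewrite addr0.
  apply: cvgD.
    rewrite -(@normr0 R R) -(subrr (phi x)); apply: cvg_norm; apply: cvgB; first exact: cvg_cst.
    exact: H1.
  have S0 : n%:R * \sum_(i < n) `|v x ord0 i - partial i (Psi N) x| @[N --> \oo] --> (0 : R).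
    rewrite [X in _ --> X](_ : _ = n%:R * \sum_(i < n) 0 :> R); last by rewrite big1// mulr0.
    apply: cvgM; first exact: cvg_cst.
    apply: cvg_big => [|i _]; first exact: add_continuous.
    rewrite -(@normr0 R R) -(subrr (v x ord0 i)); apply: cvg_norm; apply: cvgB; first exact: cvg_cst.
    exact: H2.
  apply: (squeeze_cvgr _ (cvg_cst 0) S0); near=> N; rewrite enorm_ge0/=.
  rewrite (le_trans (enorm_le_norm _))// ler_wpM2l//.
  apply: norm_le_coord => [|i]; first exact: sumr_ge0.
  by rewrite !mxE (bigD1 i)//= lerDl sumr_ge0.
have := Rintegral_dominated mO bO mh (measurable_cst _) hC hcvg.
rewrite (_ : \int[mu]_(x in Omega) _ = 0); last by rewrite /Rintegral integral0.
move=> /cvgr0_norm_lt /(_ e e0)[N _ /(_ N (leqnn _))] hN.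
exists (Psi N) => //; rewrite (norm_W11E oO (wg N)).
have ih := bounded_integrable mO bO (mh N) (hC N).
have -> : (\int[mu]_(x in Omega) (`|(phi \- Psi N)%R x| + enorm (v x - \row_i partial i (Psi N) x))%:E
  = (\int[mu]_(x in Omega) h N x)%:E)%E.
  by rewrite /Rintegral fineK//; exact: (integrable_fin_num mO ih).
by rewrite lte_fin (le_lt_trans (ler_norm _)).
Unshelve. all: by end_near. Qed.

End admissible_functions.

(** * Pyramids with prescribed face gradients *)

Section pyramids.
Context {R : realType} {n : nat}.
Implicit Types (s : seq 'rV[R]_n) (a x y xi : 'rV[R]_n) (r M d : R) (k : nat).
Local Notation mu := (@lebesgue_rV R n).

(** The minimum of the height [r] and of the affine functions with value [r] at the
    apex [a] and gradients [s].  The list is folded because the smooth version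
    below smooths one minimum at a time, by [min p l = p - (p - l)^+]. *)
Fixpoint pyramid s a r x : R :=
  if s is xi :: s' then Num.min (pyramid s' a r x) (r + dotv xi (x - a)) else r.

Fixpoint smooth_pyramid k s a r x : R :=
  if s is xi :: s' then
    smooth_pyramid k s' a r x -
    spos k (smooth_pyramid k s' a r x - (r + dotv xi (x - a)))
  else r.

Fixpoint pyramid_grad s a r x : 'rV[R]_n :=
  if s is xi :: s' then
    if pyramid s' a r x <= r + dotv xi (x - a) then pyramid_grad s' a r x else xi
  else 0.

Fixpoint smooth_pyramid_grad k s a r x : 'rV[R]_n :=
  if s is xi :: s' then
    let t := dspos k (smooth_pyramid k s' a r x - (r + dotv xi (x - a))) in
    (1 - t) *: smooth_pyramid_grad k s' a r x + t *: xi
  else 0.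

Lemma pyramid_le_face s a r x xi : xi \in s -> pyramid s a r x <= r + dotv xi (x - a).
Proof.
elim: s => [//|eta s IH] /=; rewrite inE ge_min => /predU1P[->|/IH ->]//.
by rewrite lexx orbT.
Qed.

Lemma pyramid_ge s a r x (c : R) : c <= r ->
  (forall xi, xi \in s -> c <= r + dotv xi (x - a)) -> c <= pyramid s a r x.
Proof.
move=> cr; elim: s => [//|eta s IH] /= H; rewrite le_min IH ?H ?inE ?eqxx//.
by move=> xi xis; apply: H; rewrite inE xis orbT.
Qed.

Lemma pyramid_gradE s a r x : pyramid_grad s a r x \in 0 :: s /\
  pyramid s a r x = r + dotv (pyramid_grad s a r x) (x - a).
Proof.
elim: s => [|xi s [IH1 IH2]] /=; first by rewrite inE eqxx dotvC dotv0r addr0.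
case: ifPn => h.
  by split; [move: IH1; rewrite !inE => /orP[->|->]; rewrite ?orbT|rewrite min_l].
by split; [rewrite !inE eqxx orbT|rewrite min_r// ltW// ltNge].
Qed.

Lemma pyramid_lipschitz s a r M x y : 0 <= M -> (forall xi, xi \in s -> `|xi| <= M) ->
  `|pyramid s a r x - pyramid s a r y| <= n%:R * M * `|x - y|.
Proof.
move=> M0; elim: s => [|xi s IH] sM /=; first by rewrite subrr normr0 !mulr_ge0.
have {}IH := IH (fun z zs => sM z (mem_behead (s := xi :: s) zs)).
have : `|(r + dotv xi (x - a)) - (r + dotv xi (y - a))| <= n%:R * M * `|x - y|.
  rewrite opprD addrACA subrr add0r -dotvBr opprB addrA subrK.
  rewrite (le_trans (dotv_le_norm _ _))// ler_wpM2r// ler_wpM2l// sM// inE eqxx//.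
move: IH; move: (pyramid _ _ _ x) (pyramid _ _ _ y) (r + _) (r + dotv _ (y - a)) (_ * _ * _).
move=> p q l m K; rewrite !ler_norml => /andP[? ?] /andP[? ?].
by rewrite /Num.min; case: ifP => [|/negbT]; case: ifP => [|/negbT]; rewrite -?leNgt => ? ?; apply/andP; lra.
Qed.

Lemma seq_norm_bound s : exists2 M : R, 0 < M & forall xi, xi \in s -> `|xi| <= M.
Proof.
elim: s => [|xi s [M M0 sM]]; first by exists 1.
exists (Num.max `|xi| M); first by rewrite lt_max M0 orbT.
by move=> eta; rewrite inE le_max => /predU1P[->|/sM ->]; rewrite ?lexx ?orbT.
Qed.

Lemma continuous_pyramid s a r : continuous (pyramid s a r).
Proof.
have [M /ltW M0 sM] := seq_norm_bound s.
by apply: (@lipschitz_continuous _ _ _ (n%:R * M)) => x y; exact: pyramid_lipschitz.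
Qed.

Lemma face_affine xi a r x : r + dotv xi (x - a) = dotv xi x + (r - dotv xi a).
Proof. by rewrite dotvBr; lra. Qed.

Lemma smooth_smooth_pyramid k s a r : smooth (smooth_pyramid k s a r).
Proof.
move=> j; elim: s => [|xi s IH] /=; first exact: class_C_cst.
have CN (u : 'rV[R]_n -> R) : class_C j u -> class_C j (fun x => - u x).
  move=> Cu; under eq_fun do rewrite -mulN1r.
  by apply: class_CM => //; exact: class_C_cst.
apply: class_CD => //.
apply: (CN (fun x => spos k (smooth_pyramid k s a r x - (r + dotv xi (x - a))))).
apply: (@class_C_spos _ _ _ _ (fun x => smooth_pyramid k s a r x - (r + dotv xi (x - a)))).
apply: class_CD => //; apply: (CN (fun x => r + dotv xi (x - a))).
by under eq_fun do rewrite face_affine; exact: class_C_affine.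
Qed.

Lemma is_derive_smooth_pyramid k s a r x v :
  is_derive x v (smooth_pyramid k s a r) (dotv (smooth_pyramid_grad k s a r x) v).
Proof.
elim: s => [|xi s IH] /=; first by rewrite dotvC dotv0r; exact: is_derive_cst.
have Df : is_derive x v (fun y => r + dotv xi (y - a)) (dotv xi v).
  by under eq_fun do rewrite face_affine; exact: is_derive_affine.
have D1 : is_derive x v (fun y => smooth_pyramid k s a r y - (r + dotv xi (y - a)))
    (dotv (smooth_pyramid_grad k s a r x) v - dotv xi v) by exact: is_deriveB.
have D2 := is_derive_comp_rV (is_derive_spos k _) D1.
have := is_deriveB IH D2.
set t := dspos _ _; rewrite (_ : _ - t * _ = dotv ((1 - t) *: smooth_pyramid_grad k s a r x + t *: xi) v)//.
by rewrite dotvDl !dotvZl; lra.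
Qed.

Lemma smooth_pyramid_grad_le k s a r x M : 0 <= M ->
  (forall xi, xi \in s -> `|xi| <= M) -> `|smooth_pyramid_grad k s a r x| <= M.
Proof.
move=> M0; elim: s => [|xi s IH] sM /=; first by rewrite normr0.
set t := dspos _ _; have [t0 t1] : 0 <= t /\ t <= 1 by exact: dspos_bounds.
apply: (le_trans (ler_normD _ _)); rewrite !normrZ (ger0_norm t0) ger0_norm; last by lra.
have : t * `|xi| <= t * M by rewrite ler_wpM2l// sM// inE eqxx.
have t1' : 0 <= 1 - t by lra.
have : (1 - t) * `|smooth_pyramid_grad k s a r x| <= (1 - t) * M.
  by rewrite ler_wpM2l// IH// => z zs; rewrite sM// inE zs orbT.
by lra.
Qed.

(** Each smoothed minimum lies above the minimum, by at most [1/(k+1)]. *)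
Lemma smooth_pyramid_bounds k s a r x :
  pyramid s a r x <= smooth_pyramid k s a r x /\
  smooth_pyramid k s a r x <= pyramid s a r x + (size s)%:R * k.+1%:R^-1.
Proof.
elim: s => [|xi s [IH1 IH2]] /=; first by rewrite mul0r addr0; split.
have [] := spos_bounds k (smooth_pyramid k s a r x - (r + dotv xi (x - a))).
have k0 : 0 < k.+1%:R^-1 :> R by rewrite invr_gt0.
rewrite -[in X in _ -> _ -> _ /\ X]natr1 mulrDl mul1r; move: IH1 IH2 k0.
set p := pyramid s a r x; set w := smooth_pyramid k s a r x; set l := r + dotv xi _.
set q := spos k _; set m := _ / _; set e := _^-1.
move: p w l q m e => p w l q m e; rewrite /Num.max /Num.min.
by case: ifPn => ?; case: ifPn => ?; (try move: (_ : ~~ _)); rewrite -?leNgt; split; lra.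
Qed.

Lemma smooth_pyramid_le k s a r x : smooth_pyramid k s a r x <= r.
Proof.
elim: s => [|xi s IH] //=; apply: le_trans IH.
by rewrite gerBl spos_ge0.
Qed.

Lemma cvg_smooth_pyramid s a r x :
  smooth_pyramid k s a r x @[k --> \oo] --> pyramid s a r x.
Proof.
have S0 : pyramid s a r x + (size s)%:R * k.+1%:R^-1 @[k --> \oo] --> pyramid s a r x.
  rewrite -[X in _ --> X]addr0; apply: cvgD; first exact: cvg_cst.
  rewrite -(mulr0 (size s)%:R); apply: cvgM; first exact: cvg_cst.
  exact: cvg_harmonic.
apply: (squeeze_cvgr _ (cvg_cst _) S0); near=> k.
by have [-> ->] := smooth_pyramid_bounds k s a r x.
Unshelve. all: by end_near. Qed.

(** Off the ties exactly one of the affine functions is active, so the pyramid is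
    smooth there and the smoothed gradients converge; the entry [0] stands for the
    constant [r]. *)
Definition tie s a x := exists xi eta, [/\ xi \in 0 :: s, eta \in 0 :: s, xi != eta &
  dotv (xi - eta) (x - a) = 0].

Lemma ae_hyperplane xi a (c : R) : xi != 0 ->
  {ae mu, forall x, dotv xi (x - a) != c}.
Proof.
move=> xi0; exists [set x | dotv xi x = c + dotv xi a]; split.
- exact: measurable_hyperplane.
- exact: lebesgue_rV_hyperplane.
- by move=> x /= /negP; rewrite negbK => /eqP; rewrite dotvBr; lra.
Qed.

Lemma ae_not_tie s a : {ae mu, forall x, ~ tie s a x}.
Proof.
pose I := ('I_(size s).+1 * 'I_(size s).+1)%type.
pose F (i : 'I_(size s).+1) : 'rV[R]_n := nth 0 (0 :: s) i.
have := @ae_forall_countable R n I (fun p => F p.1 != F p.2)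
  (fun p x => dotv (F p.1 - F p.2) (x - a) != 0).
case; first by move=> p Fp; apply: ae_hyperplane; rewrite subr_eq0.
move=> N [mN N0 NP]; exists N; split=> // x nx; apply: NP => /= H; apply: nx.
move=> [xi [eta [xis etas xieta h]]].
pose z : 'rV[R]_n := 0.
have ixi : (index xi (z :: s) < (size s).+1)%N by rewrite -index_mem in xis.
have ieta : (index eta (z :: s) < (size s).+1)%N by rewrite -index_mem in etas.
have := H (Ordinal ixi, Ordinal ieta); rewrite /F /= => {}H.
have Exi : nth 0 (z :: s) (index xi (z :: s)) = xi by rewrite nth_index.
have Eeta : nth 0 (z :: s) (index eta (z :: s)) = eta by rewrite nth_index.
by move: H; rewrite -/z Exi Eeta h eqxx => /(_ xieta).
Qed.

Lemma tie_behead xi s a x : ~ tie (xi :: s) a x -> ~ tie s a x.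
Proof.
move=> H [p [q [ps qs pq h]]]; apply: H; exists p, q; split=> //.
  by move: ps; rewrite !inE => /orP[->|->]; rewrite ?orbT.
by move: qs; rewrite !inE => /orP[->|->]; rewrite ?orbT.
Qed.

Lemma cvg_smooth_pyramid_grad s a r x i : uniq (0 :: s) -> ~ tie s a x ->
  smooth_pyramid_grad k s a r x ord0 i @[k --> \oo] --> pyramid_grad s a r x ord0 i.
Proof.
elim: s => [_ _|xi s IH us nt] /=; first exact: cvg_cst.
have us' : uniq (0 :: s) by move: us => /= /and3P[]; rewrite inE negb_or => /andP[_ ->] _ ->.
have {}IH := IH us' (tie_behead nt).
set l := r + dotv xi (x - a).
have cW : smooth_pyramid k s a r x - l @[k --> \oo] --> pyramid s a r x - l.
  by apply: cvgB; [exact: cvg_smooth_pyramid|exact: cvg_cst].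
have [g0 pE] := pyramid_gradE s a r x.
have W0 : pyramid s a r x - l != 0.
  apply/eqP => h; apply: nt; exists (pyramid_grad s a r x), xi.
  move: us => /= /and3P[h0 h1 _]; split.
  - by move: g0; rewrite !inE => /orP[->|->]; rewrite ?orbT.
  - by rewrite !inE eqxx orbT.
  - apply/eqP => e; move: g0; rewrite e inE => /orP[/eqP xi0|xis].
      by move: h0; rewrite xi0 inE eqxx.
    by rewrite xis in h1.
  - by rewrite dotvBl; move: h; rewrite /l pE; lra.
have ct := cvg_dspos cW W0.
have E k : ((1 - dspos k (smooth_pyramid k s a r x - l)) *: smooth_pyramid_grad k s a r x +
   dspos k (smooth_pyramid k s a r x - l) *: xi) ord0 i =
   (1 - dspos k (smooth_pyramid k s a r x - l)) * smooth_pyramid_grad k s a r x ord0 i +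
   dspos k (smooth_pyramid k s a r x - l) * xi ord0 i by rewrite !mxE.
under eq_fun do rewrite E.
have C2 : (1 - dspos k (smooth_pyramid k s a r x - l)) * smooth_pyramid_grad k s a r x ord0 i +
   dspos k (smooth_pyramid k s a r x - l) * xi ord0 i @[k --> \oo] -->
   (1 - (0 < pyramid s a r x - l)%R%:R) * pyramid_grad s a r x ord0 i +
   (0 < pyramid s a r x - l)%R%:R * xi ord0 i.
  apply: cvgD; apply: cvgM => //; last exact: cvg_cst.
  by apply: cvgB => //; exact: cvg_cst.
have EL : (1 - (0 < pyramid s a r x - l)%R%:R) * pyramid_grad s a r x ord0 i +
   (0 < pyramid s a r x - l)%R%:R * xi ord0 i =
   (if pyramid s a r x <= l then pyramid_grad s a r x else xi) ord0 i.
  rewrite subr_gt0 ltNge; case: ifP => _ /=.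
    by rewrite subr0 mul1r mul0r addr0.
  by rewrite subrr mul0r mul1r add0r.
by rewrite EL in C2; exact: C2.
Qed.

(** Lowering the smooth pyramid by its worst error puts it below the pyramid, so
    that its smooth positive part is supported in the cell where the pyramid is
    nonnegative. *)
Definition bump_pyramid k s a r x : R :=
  spos k (smooth_pyramid k s a r x - (size s)%:R * k.+1%:R^-1).

Lemma smooth_bump_pyramid k s a r : smooth (bump_pyramid k s a r).
Proof.
move=> j; apply: (@class_C_spos _ _ _ _ (fun x => smooth_pyramid k s a r x - (size s)%:R * k.+1%:R^-1)).
by apply: class_CD; [exact: smooth_smooth_pyramid|exact: class_C_cst].
Qed.

Lemma bump_pyramid_out k s a r x : pyramid s a r x <= 0 -> bump_pyramid k s a r x = 0.
Proof.
move=> p0; apply: spos_le0; have [_] := smooth_pyramid_bounds k s a r x.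
by rewrite subr_le0 => /le_trans; apply; rewrite gerDr.
Qed.

Lemma bump_pyramid_bounds k s a r x : 0 <= r ->
  0 <= bump_pyramid k s a r x /\ bump_pyramid k s a r x <= r.
Proof.
move=> r0; split; first exact: spos_ge0.
apply: (le_trans (spos_bounds _ _).2); rewrite ge_max r0 andbT.
rewrite lerBlDr (le_trans (smooth_pyramid_le k s a r x))// lerDl.
by rewrite mulr_ge0 ?invr_ge0.
Qed.

Lemma partial_bump_pyramid k s a r i x : partial i (bump_pyramid k s a r) x =
  dspos k (smooth_pyramid k s a r x - (size s)%:R * k.+1%:R^-1) *
  smooth_pyramid_grad k s a r x ord0 i.
Proof.
have D0 := is_derive_smooth_pyramid k s a r x (delta_mx ord0 i).
rewrite dotv_delta in D0.
have D1 := is_deriveB D0 (is_derive_cst ((size s)%:R * k.+1%:R^-1 : R) x (delta_mx ord0 i)).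
rewrite subr0 in D1.
have := is_derive_comp_rV (is_derive_spos k _) D1.
by rewrite /partial; case=> _ <-.
Qed.

Lemma partial_bump_pyramid_le k s a r i x M : 0 <= M ->
  (forall xi, xi \in s -> `|xi| <= M) -> `|partial i (bump_pyramid k s a r) x| <= M.
Proof.
move=> M0 sM; rewrite partial_bump_pyramid normrM.
have [t0 t1] := dspos_bounds k (smooth_pyramid k s a r x - (size s)%:R * k.+1%:R^-1).
rewrite (ger0_norm t0) -[M]mul1r ler_pM//.
exact: le_trans (coord_le_norm _ i) (smooth_pyramid_grad_le k a r x M0 sM).
Qed.

Lemma cvg_smooth_pyramid_shift s a r x :
  smooth_pyramid k s a r x - (size s)%:R * k.+1%:R^-1 @[k --> \oo] --> pyramid s a r x.
Proof.
rewrite -[X in _ --> X]subr0; apply: cvgB; first exact: cvg_smooth_pyramid.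
rewrite -(mulr0 (size s)%:R); apply: cvgM; first exact: cvg_cst.
exact: cvg_harmonic.
Qed.

Lemma cvg_bump_pyramid s a r x : 0 < pyramid s a r x ->
  cvgn (fun k => bump_pyramid k s a r x).
Proof.
move=> p0; have ct := @cvg_smooth_pyramid_shift s a r x.
apply/cvg_ex; exists (pyramid s a r x).
have k0 : k.+1%:R^-1 @[k --> \oo] --> (0 : R) by exact: cvg_harmonic.
set t := fun k => _ in ct.
have low : t k - k.+1%:R^-1 @[k --> \oo] --> pyramid s a r x.
  by rewrite -[X in _ --> X]subr0; apply: cvgB.
apply: (squeeze_cvgr _ low ct); near=> k.
have tk : 0 <= t k by apply: ltW; near: k; exact: (cvgr_gt (pyramid s a r x)).
have [] := spos_bounds k (t k); rewrite max_l// => h1 h2.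
by rewrite /bump_pyramid -/(t k) h1 h2.
Unshelve. all: by end_near. Qed.

Lemma cvg_partial_bump_pyramid s a r x i : uniq (0 :: s) -> ~ tie s a x ->
  0 < pyramid s a r x ->
  partial i (bump_pyramid k s a r) x @[k --> \oo] --> pyramid_grad s a r x ord0 i.
Proof.
move=> us nt p0; under eq_fun do rewrite partial_bump_pyramid.
have cg := @cvg_smooth_pyramid_grad s a r x i us nt.
have pn0 : pyramid s a r x != 0 by rewrite gt_eqF.
have := cvg_dspos (@cvg_smooth_pyramid_shift s a r x) pn0; rewrite p0 /= => ct.
have C2 := cvgM ct cg; rewrite mul1r in C2; exact: C2.
Qed.

(** As [s] surrounds the origin, some face lies strictly below the height [r] at
    every point but the apex, and the apex is a tie. *)
Lemma pyramid_grad_mem s a r x d : 0 < d -> surrounds s 0 d -> 0 \notin s ->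
  ~ tie s a x -> pyramid_grad s a r x \in s.
Proof.
move=> d0 sd s0 nt; have [] := pyramid_gradE s a r x; rewrite inE => /orP[/eqP -> pE|//].
have [xi xis] := sd (x - a); rewrite subr0 => h.
have := pyramid_le_face a r x xis; rewrite pE dotvC dotv0r addr0 => h2.
exfalso; apply: nt; exists xi, 0.
have xa : `|x - a| = 0.
  apply/eqP; rewrite eq_le normr_ge0 andbT -(pmulr_rle0 _ d0).
  by move: h; rewrite mulNr; lra.
move/eqP: xa; rewrite normr_eq0 => /eqP xa.
split; [by rewrite inE xis orbT|by rewrite inE eqxx| |by rewrite xa dotv0r].
by apply: contraNneq s0 => <-.
Qed.

Lemma pyramid_ge0_norm s a r x d : 0 < d -> surrounds s 0 d -> 0 <= pyramid s a r x ->
  d * `|x - a| <= r.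
Proof.
move=> d0 sd p0; have [xi xis] := sd (x - a); rewrite subr0 => h.
have := le_trans p0 (pyramid_le_face a r x xis).
by move: h; rewrite mulNr; lra.
Qed.

Lemma pyramid_ge0_ball s a r x M : (forall xi, xi \in s -> `|xi| <= M) ->
  n%:R * M * `|x - a| <= r -> 0 <= M -> 0 <= pyramid s a r x.
Proof.
move=> sM xr M0; apply: pyramid_ge => [|xi xis].
  by apply: le_trans xr; rewrite !mulr_ge0.
have := dotv_le_norm xi (x - a); rewrite ler_norml => /andP[h _].
have : n%:R * `|xi| * `|x - a| <= n%:R * M * `|x - a|.
  by rewrite ler_wpM2r// ler_wpM2l// sM.
by move: h; set q := n%:R * `|xi| * _; set q' := n%:R * M * _; set p := dotv _ _; move: xr; rewrite -/q'; lra.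
Qed.

Lemma closed_pyramid_ge0 s a r : closed [set x | 0 <= pyramid s a r x].
Proof.
rewrite (_ : mkset _ = pyramid s a r @^-1` [set t | 0 <= t])//.
by apply: preimage_closed => [x _|]; [exact: continuous_pyramid|exact: closed_ge].
Qed.

Lemma ae_pyramid_neq0 s a r : 0 < r -> 0 \notin s ->
  {ae mu, forall x, pyramid s a r x != 0}.
Proof.
move=> r0 s0; pose F (i : 'I_(size s)) : 'rV[R]_n := nth 0 s i.
have := @ae_forall_countable R n 'I_(size s) setT (fun i x => dotv (F i) (x - a) != - r).
case.
  move=> i _; apply: ae_hyperplane; apply: contraNneq s0 => <-.
  by apply: mem_nth.
move=> N [mN N0 NP]; exists N; split=> // x nx; apply: NP => /= H; apply: nx.
rewrite /=; have [] := pyramid_gradE s a r x; set g := pyramid_grad s a r x.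
move=> + ->; rewrite inE => /orP[/eqP ->|gs].
  by rewrite dotvC dotv0r addr0 gt_eqF.
have ig : (index g s < size s)%N by rewrite index_mem.
have := H (Ordinal ig) Logic.I; rewrite /F /= nth_index//.
by apply: contra => /eqP; rewrite addrC => /eqP; rewrite addr_eq0 => /eqP ->.
Qed.

End pyramids.

(** * Covering an open set by disjoint cells *)

Section vitali_covering.
Context {R : realType} {n : nat}.
Local Notation mu := (@lebesgue_rV R n).
(** Up to the factors [kappa] and [delta], [Cell a r] is the ball of center [a] and
    radius [r]. *)
Variables (Cell : 'rV[R]_n -> R -> set 'rV[R]_n) (kappa delta : R).
Hypotheses (n_gt0 : (0 < n)%N) (kappa_gt0 : 0 < kappa) (delta_gt0 : 0 < delta).
Hypothesis cell_closed : forall a r, 0 < r -> closed (Cell a r).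
Hypothesis cell_ball : forall a r x, 0 < r -> kappa * `|x - a| <= r -> Cell a r x.
Hypothesis cell_norm : forall a r x, 0 < r -> Cell a r x -> delta * `|x - a| <= r.
Variable Omega : set 'rV[R]_n.
Hypotheses (Omega_open : open Omega) (Omega_bounded : bounded_set Omega).

Let K (p : 'rV[R]_n * R) : set 'rV[R]_n := [set x | 0 < p.2 /\ Cell p.1 p.2 x].

Let used (l : seq ('rV[R]_n * R)) := [set x | exists2 p, p \in l & K p x].

Let K_closed p : closed (K p).
Proof.
have [p0|p0] := ltP 0 p.2.
  rewrite (_ : K p = Cell p.1 p.2); first exact: cell_closed.
  by apply/seteqP; split=> [x []|x].
rewrite (_ : K p = set0); first exact: closed0.
by apply/seteqP; split=> // x []; rewrite ltNge p0.
Qed.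

Let free_open l : open (Omega `\` used l).
Proof.
apply: openI => //; apply: closed_openC.
rewrite (_ : used l = \bigcup_(p in [set` l]) K p).
  by apply: closed_bigcup => //; exact: finite_seq.
by apply/seteqP; split=> x [p pl Kp]; exists p.
Qed.

Lemma cell_radius_bounded : exists T, forall a r, 0 < r -> Cell a r `<=` Omega -> r <= T.
Proof.
have [M M0 OM] := bounded_setP Omega_bounded.
exists (kappa * (2 * M)) => a r r0 CO.
have [v v1] := @unit_vector R n n_gt0.
have Oa : `|a| <= M.
  by apply/OM/CO; apply: cell_ball => //; rewrite subrr normr0 mulr0 ltW.
have h0 : 0 < r / kappa by rewrite divr_gt0.
have Ob : `|a + (r / kappa) *: v| <= M.
  apply/OM/CO; apply: cell_ball => //; rewrite addrC addKr normrZ v1 mulr1 gtr0_norm//.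
  by rewrite mulrC divfK// gt_eqF.
have : `|(a + (r / kappa) *: v) - a| <= 2 * M.
  by rewrite (le_trans (ler_normB _ _))//; lra.
rewrite addrC addKr normrZ v1 mulr1 gtr0_norm// ler_pdivrMr// => h.
by rewrite mulrC.
Qed.

(** Cells of maximal size need not exist, but half of the supremum of the sizes is
    enough for the covering argument; once no cell fits, the choice is the empty
    cell of size [0]. *)
Let greedy_step l : exists p, [/\ 0 <= p.2, K p `<=` Omega `\` used l &
  forall q, 0 < q.2 -> K q `<=` Omega `\` used l -> q.2 <= 2 * p.2].
Proof.
pose S := [set t | exists q, [/\ 0 < q.2, K q `<=` Omega `\` used l & t = q.2]].
have [S0|S0] := pselect (S !=set0); last first.
  exists (0, 0); split=> //= [x []|q q0 qU]; first by rewrite ltxx.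
  by exfalso; apply: S0; exists q.2, q.
have [T TP] := cell_radius_bounded.
have Sub : has_ubound S.
  by exists T => _ [q [q0 qU ->]]; apply: (TP q.1 _ q0) => x Cx; have [] := qU x (conj q0 Cx).
have Spos : 0 < sup S.
  have [t [q [q0 qU tq]]] := S0.
  by apply: lt_le_trans (ub_le_sup Sub (x := q.2) _); last by exists q.
have half : 0 < sup S / 2 by rewrite divr_gt0.
have [_ [p [p0 pU ->]] pS] := sup_adherent half (conj S0 Sub).
exists p; split=> //; first exact: ltW.
move=> q q0 qU; have := ub_le_sup Sub (x := q.2); move=> /(_ _).
have Sq : S q.2 by exists q.
by move=> /(_ Sq); lra.
Qed.

(** The cells chosen one after the other have summable measures, since they are
    disjoint and contain balls of comparable size.  A point of [Omega] outside all
    of them is the apex of a small cell that avoids the first [J] choices; as the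
    sizes tend to [0], this cell meets a later choice which is at least half as
    large, so the point lies in a fixed enlargement of that choice.  The
    enlargements of the choices after [J] have total measure tending to [0]. *)
Theorem vitali_covering : exists p : nat -> 'rV[R]_n * R,
  [/\ forall j, 0 <= (p j).2,
      forall j, 0 < (p j).2 -> Cell (p j).1 (p j).2 `<=` Omega,
      forall i j x, i != j -> 0 < (p i).2 -> 0 < (p j).2 ->
        Cell (p i).1 (p i).2 x -> ~ Cell (p j).1 (p j).2 x &
      {ae mu, forall x, Omega x -> exists j, 0 < (p j).2 /\ Cell (p j).1 (p j).2 x}].
Proof.
have [g gP] := choice greedy_step.
pose L := fix L (k : nat) := if k is k'.+1 then rcons (L k') (g (L k')) else [::].
pose p k := g (L k).
have LE k x : used (L k) x <-> exists2 j, (j < k)%N & K (p j) x.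
  elim: k => [|k IH]; first by split=> [[]|[]].
  split=> [[q]|[j]].
    rewrite /= mem_rcons inE => /predU1P[->|qL] Kq; first by exists k.
    have [|j jk Kj] := IH.1; first by exists q.
    by exists j => //; exact: leqW.
  rewrite ltnS leq_eqVlt => /predU1P[->|jk] Kj.
    by exists (p k) => //=; rewrite mem_rcons inE eqxx.
  have [|q qL Kq] := IH.2; first by exists j.
  by exists q => //=; rewrite mem_rcons inE qL orbT.
have p0 j : 0 <= (p j).2 by have [] := gP (L j).
have pU j : K (p j) `<=` Omega `\` used (L j) by have [] := gP (L j).
have pmax j q : 0 < q.2 -> K q `<=` Omega `\` used (L j) -> q.2 <= 2 * (p j).2.
  by have [_ _] := gP (L j); exact.
have pO j : K (p j) `<=` Omega by move=> x /pU[].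
have disj i j x : i != j -> K (p i) x -> K (p j) x -> False.
  wlog ij : i j / (i < j)%N.
    move=> H ij; have [/H|/H] : (i < j)%N \/ (j < i)%N.
      by apply/orP; rewrite -neq_ltn.
    - exact.
    - by rewrite eq_sym => /(_ ij) h h1 h2; exact: h h2 h1.
  move=> _ Ki /pU[_ nu]; apply: nu; apply/LE; by exists i.
have mO := open_measurable_rV Omega_open.
pose B j := if 0 < (p j).2 then
  rV_box ((p j).1 - const_mx ((p j).2 / kappa)) ((p j).1 + const_mx ((p j).2 / kappa))
  else set0.
have boxP (a : 'rV[R]_n) (t : R) x : 0 <= t ->
    rV_box (a - const_mx t) (a + const_mx t) x <-> `|x - a| <= t.
  move=> t0; split=> [H|H i].
    apply: norm_le_coord => // i; have := H i; rewrite !mxE ler_norml.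
    by move=> /andP[? ?]; apply/andP; lra.
  have := le_trans (coord_le_norm _ i) H; rewrite !mxE ler_norml.
  by move=> /andP[? ?]; apply/andP; lra.
have BK j : B j `<=` K (p j).
  rewrite /B; case: ifPn => // pj x /boxP; rewrite divr_ge0 ?(ltW pj) ?(ltW kappa_gt0)// => /(_ isT) h.
  by split=> //; apply: cell_ball => //; rewrite mulrC -ler_pdivlMr.
have mB j : measurable (B j) /\ mu (B j) = ((2 * ((p j).2 / kappa)) ^+ n)%:E.
  rewrite /B; case: ifPn => pj.
    by apply: lebesgue_rV_ball; rewrite divr_ge0// ltW.
  have -> : (p j).2 = 0 by apply/eqP; rewrite eq_le p0 leNgt pj.
  by split=> //; rewrite measure0 mul0r mulr0 expr0n eqn0Ngt n_gt0.
have trivB : trivIset setT B.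
  apply/trivIsetP => i j _ _ ij; apply/seteqP; split=> // x [/BK Ki /BK Kj].
  exact: disj ij Ki Kj.
pose f j := ((2 * ((p j).2 / kappa)) ^+ n)%:E.
have f0 j : (0 <= f j)%E by rewrite lee_fin exprn_ge0// mulr_ge0// divr_ge0// ltW.
have fsum : (\sum_(0 <= j <oo) f j < +oo)%E.
  rewrite (eq_eseriesr (g := mu \o B)); last by move=> j _; rewrite /= (mB j).2.
  have mUB : measurable (\bigcup_j B j) by apply: bigcup_measurable => j _; exact: (mB j).1.
  rewrite -measure_semi_bigcup//; last by move=> j; exact: (mB j).1.
  apply: (@le_lt_trans _ _ (mu Omega)); last exact: lebesgue_rV_bounded.
  apply: le_measure; rewrite ?inE// => x [j _ /BK /pO]; exact.
have tail := nneseries_tail_cvg fsum (fun k _ => f0 k).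
pose C := (3 * kappa / delta) ^+ n.
have C0 : 0 <= C by rewrite exprn_ge0// divr_ge0 ?mulr_ge0 ?ltW.
pose N := Omega `\` \bigcup_j K (p j).
have mN : measurable N.
  apply: measurableD => //; apply: bigcup_measurable => j _.
  exact: closed_measurable_rV.
pose E j := rV_box ((p j).1 - const_mx (3 * (p j).2 / delta))
                   ((p j).1 + const_mx (3 * (p j).2 / delta)).
have mE j : measurable (E j) /\ mu (E j) = (C%:E * f j)%E.
  have t0 : 0 <= 3 * (p j).2 / delta by rewrite divr_ge0 ?mulr_ge0 ?(ltW delta_gt0).
  have [m ->] := lebesgue_rV_ball (p j).1 t0; split=> //.
  rewrite /C /f -EFinM -exprMn; congr ((_ ^+ _)%:E).
  rewrite -{1}(divfK (lt0r_neq0 kappa_gt0) (p j).2).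
  by set w := _ / kappa; set z := delta^-1; lra.
(* the factor [3] is that of the classical argument: the point is at distance
   [rho / delta] at most from a common point of the two cells, with [rho] at most
   twice the size of the later one *)
have NE J : N `<=` \bigcup_(j in ~` `I_J) E j.
  move=> x [Ox nK].
  have Ux k : (Omega `\` used (L k)) x.
    by split=> // /LE[j _ Kj]; apply: nK; exists j.
  have [d d0 dU] := (open_epsdelta (Omega `\` used (L J))).1 (@free_open (L J)) x (Ux J).
  (* the cell of size [rho] lies in the ball of radius [d] by [cell_norm] *)
pose rho := delta * (d / 2).
  have rho0 : 0 < rho by rewrite mulr_gt0// divr_gt0.
  have KU : K (x, rho) `<=` Omega `\` used (L J).
    move=> y [_ /(cell_norm rho0)]; rewrite /= ler_pM2l// => h.
    by apply: dU; rewrite distrC; apply: le_lt_trans h _; lra.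
  have Kx : K (x, rho) x by split=> //; apply: cell_ball => //; rewrite subrr normr0 mulr0 ltW.
  have [k kP] : exists k, ~ (K (x, rho) `<=` Omega `\` used (L k)).
    apply: contrapT => /forallNP H.
    have big k : rho <= 2 * (p k).2 by apply: (pmax k (x, rho)) => //; apply: contrapT; exact: H.
    have : (forall k, (((rho / kappa) ^+ n)%:E <= f k)%E).
      have k0 : 0 <= kappa^-1 by rewrite invr_ge0 ltW.
      move=> k; rewrite lee_fin lerXn2r ?nnegrE//.
      - exact: mulr_ge0 (ltW rho0) k0.
      - by apply: mulr_ge0 => //; exact: mulr_ge0.
      - by rewrite mulrA ler_wpM2r.
    move=> fbig.
    pose e := (rho / kappa) ^+ n.
    have e0 : 0 < e by rewrite exprn_gt0// divr_gt0.
    have Tfin : (\sum_(0 <= j <oo) f j)%E \is a fin_num.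
      by rewrite ge0_fin_numE//; apply: nneseries_ge0.
    pose T := fine (\sum_(0 <= j <oo) f j)%E.
    have me m : m%:R * e <= T.
      rewrite -lee_fin /T fineK//; apply: le_trans (nneseries_lim_ge m _); last by move=> *; exact: f0.
      apply: (@le_trans _ _ (\sum_(0 <= j < m) e%:E)%E); last by apply: lee_sum => *; exact: fbig.
      by rewrite sumEFin lee_fin big_const_nat subn0 iter_addr_0 mulr_natl.
    have := me (Num.bound (T / e)); apply/negP; rewrite -ltNge -ltr_pdivrMr//.
    exact: unstable.ltr_bound.
  have [k' [Jk' Pk' nPk']] : exists k', [/\ (J <= k')%N,
      K (x, rho) `<=` Omega `\` used (L k') & ~ (K (x, rho) `<=` Omega `\` used (L k'.+1))].
    apply: contrapT => H; apply: kP.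
    have PJ i : K (x, rho) `<=` Omega `\` used (L (J + i)%N).
      elim: i => [|i IH]; first by rewrite addn0.
      apply: contrapT => nP; apply: H; exists (J + i)%N; split=> //; first exact: leq_addr.
      by rewrite -addnS.
    move=> y Ky; have [Oy _] := KU y Ky; split=> // /LE[j jk Kj].
    by have [_] := PJ k y Ky; apply; apply/LE; exists j => //; exact: ltn_addl.
  have rr := pmax k' (x, rho) rho0 Pk'; rewrite /= in rr.
  have [y [Ky Kpy]] : exists y, K (x, rho) y /\ K (p k') y.
    apply: contrapT => H; apply: nPk' => y Ky; have [Oy ny] := Pk' y Ky.
    split=> // /LE[j]; rewrite ltnS leq_eqVlt => /predU1P[->|jk] Kj.
      by apply: H; exists y.
    by apply: ny; apply/LE; exists j.
  exists k'; first by rewrite /= ltnNge Jk'.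
  have [_ /(cell_norm rho0) h1] := Ky; have [pk Ck] := Kpy; have h2 := cell_norm pk Ck.
  apply/boxP; first by rewrite divr_ge0 ?mulr_ge0 ?(ltW delta_gt0).
  rewrite ler_pdivlMr// mulrC.
  have -> : x - (p k').1 = (y - (p k').1) - (y - x) by apply/rowP => i; rewrite !mxE; lra.
  apply: (le_trans (ler_wpM2l (ltW delta_gt0) (ler_normB _ _))).
  by rewrite mulrDr; rewrite /= in h1; lra.
have mN0 : mu N = 0%E.
  have le J : (mu N <= C%:E * \sum_(J <= j <oo) f j)%E.
    rewrite -nneseriesZl => [|j _]; last exact: f0.
    rewrite -(eq_eseriesr (f := mu \o E)); last by move=> j _; rewrite /= (mE j).2.
    apply: measure_sigma_subadditive_tail => //; first by move=> j; exact: (mE j).1.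
  have cv : (C%:E * \sum_(J <= j <oo) f j)%E @[J --> \oo] --> 0%E.
    by have := cvgeZl (y := C%:E) isT tail; rewrite mule0.
  apply/eqP; rewrite eq_le measure_ge0 andbT -(cvg_lim _ cv)//.
  apply: lime_ge; first by apply/cvg_ex; exists 0%E.
  by near=> J; exact: le.
exists p; split=> //.
- by move=> j pj x Cx; apply: (pO j).
- by move=> i j x ij pi pj Ci Cj; exact: (disj i j x).
- exists N; split=> // x /= H; split; first by apply: contrapT => nO; apply: H.
  move=> [j _ [pj Cj]]; apply: H => _; by exists j.
Unshelve. all: by end_near. Qed.
End vitali_covering.

(** * A zero trace function with gradient in a finite set *)

Section gradient_inclusion.
Context {R : realType} {n : nat}.
Local Notation mu := (@lebesgue_rV R n).
Implicit Types (Omega : set 'rV[R]_n) (s : seq 'rV[R]_n).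

Lemma class_C_sum (I : Type) (r : seq I) (f : I -> 'rV[R]_n -> R) k :
  (forall i, class_C k (f i)) -> class_C k (fun x => \sum_(i <- r) f i x).
Proof.
move=> Cf; elim: r => [|i r IH].
  by under eq_fun do rewrite big_nil; exact: class_C_cst.
by under eq_fun do rewrite big_cons; apply: class_CD.
Qed.

Lemma partial_sum N (f : 'I_N -> 'rV[R]_n -> R) i x : (forall j, class_C 1 (f j)) ->
  partial i (fun x => \sum_(j < N) f j x) x = \sum_(j < N) partial i (f j) x.
Proof.
move=> Cf; have E : (fun x => \sum_(j < N) f j x) = \sum_(j < N) f j.
  by apply/funext => y; rewrite fct_sumE.
rewrite /partial E derive_sum// => j.
by have [_ /(_ i)[]] := Cf j.
Qed.

Lemma norm_sum_le_single (N : nat) (F : nat -> R) (M : R) : 0 <= M ->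
  (forall j, `|F j| <= M) -> (forall i j, i != j -> F i != 0 -> F j = 0) ->
  `|\sum_(j < N) F j| <= M.
Proof.
move=> M0 FM Fs; have [[j Fj]|H] := pselect (exists j : 'I_N, F j != 0).
  rewrite (bigD1 j)//= big1 ?addr0// => i ij; apply: (Fs j) => //.
  by rewrite eq_sym.
rewrite big1 ?normr0// => j _; apply: contrapT => Fj; apply: H; exists j.
exact/eqP.
Qed.

(** Fill [Omega] with disjoint cells of pyramids, up to a null set.  The partial
    sums of the smooth pyramids, smoothed more and more as more cells are included,
    are test functions with bounded values and gradients, since at each point at
    most one term is active; they converge together with their gradients off the
    ties and the boundaries of the cells. *)
Theorem gradient_inclusion Omega s (d : R) : (0 < n)%N -> open Omega ->
  bounded_set Omega -> 0 < d -> surrounds s 0 d -> 0 \notin s ->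
  exists phi v, [/\ W1oo_0 Omega phi, weak_gradient Omega phi v &
    {ae mu, forall x, Omega x -> v x \in s}].
Proof.
move=> n0 oO bO d0 + s0.
wlog us : s s0 / uniq s.
  move=> H sd; have [] := H (undup s); rewrite ?mem_undup ?undup_uniq//.
    by move=> v; have [xi xis h] := sd v; exists xi; rewrite ?mem_undup.
  move=> phi [v [Wphi vphi vs]]; exists phi, v; split=> //.
  by apply: filterS vs => x H' /H'; rewrite mem_undup.
move=> sd; have u0s : uniq (0 :: s) by rewrite /= s0.
have [M M0 sM] := seq_norm_bound s.
pose Cell a r := [set x | 0 <= pyramid s a r x].
pose kappa := n%:R * M; have kappa0 : 0 < kappa by rewrite mulr_gt0 ?ltr0n.
have cell_closed a r : 0 < r -> closed (Cell a r) by move=> _; exact: closed_pyramid_ge0.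
have cell_ball a r x : 0 < r -> kappa * `|x - a| <= r -> Cell a r x.
  by move=> _ h; apply: pyramid_ge0_ball sM h (ltW M0).
have cell_norm a r x : 0 < r -> Cell a r x -> d * `|x - a| <= r.
  by move=> _; exact: pyramid_ge0_norm.
have [p [p0 pO pdisj pcover]] := vitali_covering n0 kappa0 d0 cell_closed cell_ball cell_norm oO bO.
have [T TP] := cell_radius_bounded n0 kappa0 cell_ball bO.
pose K j := [set x | 0 < (p j).2 /\ Cell (p j).1 (p j).2 x].
have K_closed j : closed (K j).
  have [pj|pj] := ltP 0 (p j).2.
    rewrite (_ : K j = Cell (p j).1 (p j).2); first exact: cell_closed.
    by apply/seteqP; split=> [x []|x].
  rewrite (_ : K j = set0); first exact: closed0.
  by apply/seteqP; split=> // x []; rewrite ltNge pj.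
have K_disj i j x : i != j -> K i x -> ~ K j x.
  by move=> ij [pi Ki] [pj Kj]; exact: (pdisj i j x).
pose B k j : 'rV[R]_n -> R :=
  if 0 < (p j).2 then bump_pyramid k s (p j).1 (p j).2 else cst 0.
have smoothB k j : smooth (B k j).
  move=> m; rewrite /B; case: ifPn => _; last exact: class_C_cst.
  exact: smooth_bump_pyramid.
have outB k j x : ~ K j x -> B k j x = 0.
  rewrite /B; case: ifPn => // pj nK; apply: bump_pyramid_out.
  by rewrite leNgt; apply/negP => h; apply: nK; split=> //; exact: ltW.
have outdB k j i x : ~ K j x -> partial i (B k j) x = 0.
  move=> nK; apply: partial_near0.
    by have [_ /(_ i)[]] := smoothB k j 1.
  have : nbhs x (~` K j) by apply: open_nbhs_nbhs; split=> //; exact: closed_openC.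
  by apply: filterS => y; exact: outB.
have T0 : 0 <= Num.max T 0 by rewrite le_max lexx orbT.
have boundB k j x : `|B k j x| <= Num.max T 0.
  rewrite /B; case: ifPn => pj; last by rewrite normr0.
  have [h1 h2] := bump_pyramid_bounds k s (p j).1 x (p0 j).
  by rewrite ger0_norm// (le_trans h2)// le_max (TP _ _ pj (pO j pj)).
have bounddB k j i x : `|partial i (B k j) x| <= M.
  rewrite /B; case: (0 < (p j).2); first exact: partial_bump_pyramid_le (ltW M0) sM.
  by rewrite /partial derive_cst normr0 ltW.
pose Psi N x := \sum_(j < N) B N j x.
have testPsi N : test_function Omega (Psi N).
  apply/test_functionP; split; first by move=> m; apply: class_C_sum => j; exact: smoothB.
  pose C := \bigcup_(j in `I_N) K j.
  have CO : C `<=` Omega by move=> x [j _ [pj]]; exact: pO.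
  apply: (@compact_support_in_closed _ _ _ C) => //.
    apply: bounded_closed_compact.
      by have [Q [Qr QO]] := bO; exists Q; split=> // t /QO h x /CO; exact: h.
    by apply: closed_bigcup => //; exact: finite_II.
  move=> x nC; rewrite /Psi big1// => j _; apply: outB => Kj; apply: nC.
  by exists j => //=; exact: ltn_ord.
have boundPsi N x : `|Psi N x| <= Num.max T 0.
  apply: (@norm_sum_le_single _ (fun j => B N j x)) => // i j ij Bi.
  apply: (outB); apply: K_disj ij _; apply: contrapT => /outB Bi0.
  by rewrite Bi0 eqxx in Bi.
have dPsi N i x : partial i (Psi N) x = \sum_(j < N) partial i (B N j) x.
  by rewrite partial_sum// => j; exact: smoothB.
have bounddPsi N i x : `|partial i (Psi N) x| <= M.
  rewrite dPsi; apply: (@norm_sum_le_single _ (fun j => partial i (B N j) x)) => //.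
    exact: ltW.
  move=> j l jl Bj; apply: (outdB); apply: K_disj jl _; apply: contrapT => /outdB Bj0.
  by rewrite Bj0 eqxx in Bj.
pose G x := [set g | exists j, [/\ 0 < (p j).2, 0 < pyramid s (p j).1 (p j).2 x &
  g = pyramid_grad s (p j).1 (p j).2 x]].
pose v0 x := xget 0 (G x).
have generic : {ae mu, forall x, Omega x -> exists j,
    [/\ 0 < (p j).2, 0 < pyramid s (p j).1 (p j).2 x & ~ tie s (p j).1 x]}.
  have nt : {ae mu, forall x, forall j, [set: nat] j -> ~ tie s (p j).1 x}.
    by apply: ae_forall_countable => j _; exact: ae_not_tie.
  have nb : {ae mu, forall x, forall j, [set j | 0 < (p j).2] j ->
      pyramid s (p j).1 (p j).2 x != 0}.
    by apply: ae_forall_countable => j pj; exact: ae_pyramid_neq0.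
  apply: filterS3 pcover nt nb => x H1 H2 H3 /H1[j [pj Cj]]; exists j; split=> //.
    by rewrite lt_def H3.
  exact: H2.
have v0E x j : 0 < (p j).2 -> 0 < pyramid s (p j).1 (p j).2 x ->
    v0 x = pyramid_grad s (p j).1 (p j).2 x.
  move=> pj xj; rewrite /v0; case: xgetP => [_ _ [l [pl xl ->]]|/(_ (pyramid_grad s (p j).1 (p j).2 x))].
    have [->//|jl] := eqVneq j l.
    by exfalso; apply: (@K_disj j l x jl); split=> //; exact: ltW.
  by case; exists j.
have limit : {ae mu, forall x, Omega x ->
    cvgn (fun N => Psi N x) /\
    forall i, partial i (Psi N) x @[N --> \oo] --> v0 x ord0 i}.
  apply: filterS generic => x H /H[j [pj xj nt]].
  have Kj : K j x by split=> //; exact: ltW.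
  have PsiE : \forall N \near \oo, bump_pyramid N s (p j).1 (p j).2 x = Psi N x.
    near=> N; have jN : (j < N)%N by near: N; exact: nbhs_infty_gt.
    rewrite /Psi (bigD1 (Ordinal jN))//= {1}/B pj big1 ?addr0// => l lj.
    by apply: outB; apply: K_disj Kj; rewrite eq_sym.
  have dPsiE i : \forall N \near \oo, partial i (bump_pyramid N s (p j).1 (p j).2) x =
      partial i (Psi N) x.
    near=> N; have jN : (j < N)%N by near: N; exact: nbhs_infty_gt.
    rewrite dPsi (bigD1 (Ordinal jN))//= {1}/B pj big1 ?addr0// => l lj.
    by apply: outdB; apply: K_disj Kj; rewrite eq_sym.
  split.
    have /cvg_ex[l cl] := cvg_bump_pyramid xj; apply/cvg_ex; exists l.
    exact: cvg_trans (near_eq_cvg PsiE) cl.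
  move=> i; rewrite (v0E _ _ pj xj).
  have cl := @cvg_partial_bump_pyramid R n s (p j).1 (p j).2 x i u0s nt xj.
  by apply: cvg_trans cl; exact: near_eq_cvg (dPsiE i).
have [phi [v [Wphi vphi vv0]]] : exists phi v, [/\ W1oo_0 Omega phi,
    weak_gradient Omega phi v & {ae mu, forall x, Omega x -> v x = v0 x}].
  apply: (@test_function_limit R n Omega Psi (Num.max (Num.max T 0) M)) => //.
  - by move=> N x; rewrite le_max boundPsi.
  - by move=> N i x; rewrite le_max bounddPsi orbT.
exists phi, v; split=> //.
apply: filterS2 generic vv0 => x H1 H2 Ox; rewrite H2//.
have [j [pj xj nt]] := H1 Ox; rewrite (v0E _ _ pj xj).
exact: pyramid_grad_mem d0 sd s0 nt.
Unshelve. all: by end_near. Qed.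
End gradient_inclusion.

(** * The infimum of the energy *)

Section energy_infimum.
Context {R : realType} {n : nat}.
Local Notation mu := (@lebesgue_rV R n).
Implicit Types (Omega : set 'rV[R]_n) (s : seq 'rV[R]_n) (f : 'rV[R]_n -> R).

Lemma admissible_energy_le Omega f xi0 c s (d k : R) : (0 < n)%N -> open Omega ->
  bounded_set Omega -> 0 < d -> surrounds s xi0 d ->
  (forall xi, xi \in s -> f xi <= k) -> k < f xi0 ->
  exists2 u, admissible Omega xi0 c u & (energy Omega f u <= k%:E)%E.
Proof.
move=> n0 oO bO d0 sd sk kf.
have [||phi [v [Wphi vphi vs]]] := gradient_inclusion
    (s := [seq xi - xi0 | xi <- s]) n0 oO bO d0.
- move=> w; have [xi xis h] := sd w; exists (xi - xi0); last by rewrite subr0.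
  exact: map_f.
- apply/negP => /mapP[xi xis /eqP]; rewrite eq_sym subr_eq0 => /eqP xiE.
  by have := sk _ xis; rewrite xiE leNgt kf.
exists (fun x => phi x + affine_fun xi0 c x).
  rewrite /admissible /= (_ : _ \- _ = phi)//.
  by apply/funext => x; rewrite /= addrK.
have wu : weak_gradient Omega (fun x => phi x + affine_fun xi0 c x) (fun x => v x + xi0).
  have := weak_gradientB oO vphi (weak_gradient_affine (- xi0) (- c) oO).
  rewrite (_ : (fun x => _ - _) = fun x => v x + xi0); last first.
    by apply/funext => x; rewrite opprK.
  rewrite (_ : (fun x => _ - _) = fun x => phi x + affine_fun xi0 c x)//.
  by apply/funext => x; rewrite /affine_fun dotvNl; lra.
apply/energy_le; apply: filterS2 (grad_ae oO wu) vs => x gx vx Ox.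
rewrite gx//; have /mapP[xi xis ->] := vx Ox.
by rewrite subrK; exact: sk.
Qed.

(** If the energy were below the envelope at [xi0], the sublevel set of [f] at an
    intermediate level would contain a list that surrounds [xi0], and the envelope
    at [xi0] would not exceed that level. *)
Lemma lslc_le_energy Omega f xi0 c u : (0 < n)%N -> open Omega -> Omega !=set0 ->
  bounded_set Omega -> (lslc f xi0 < (f xi0)%:E)%E -> admissible Omega xi0 c u ->
  (lslc f xi0 <= energy Omega f u)%E.
Proof.
move=> n0 oO O0 bO gap adm; rewrite leNgt; apply/negP => lt.
have Ef : (energy Omega f u < (f xi0)%:E)%E by exact: lt_trans lt gap.
have [k [Ek kl]] : exists k : R, (energy Omega f u <= k%:E)%E /\ (k%:E < lslc f xi0)%E.
  move: lt gap; case: (energy Omega f u) => [e| |]; case: (lslc f xi0) => [l| |] //=.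
  - by rewrite !lte_fin => el _; exists e; rewrite lte_fin el.
  - by move=> _ _; exists (l - 1); rewrite leNye lte_fin; split=> //; lra.
have kf : k < f xi0 by rewrite -lte_fin; exact: lt_trans kl gap.
have [s [d [sk d0 sd]]] := energy_surrounds n0 oO O0 bO adm Ek kf.
have := lslc_le_surrounds (y := xi0) sk sd; rewrite subrr normr0 mulr0 => /(_ d0).
by rewrite leNgt kl.
Qed.

Lemma inf_energy Omega f xi0 c : (0 < n)%N -> open Omega -> Omega !=set0 ->
  bounded_set Omega -> continuous f -> (forall c, compact [set xi | f xi <= c]) ->
  lslc f xi0 \is a fin_num -> (lslc f xi0 < (f xi0)%:E)%E ->
  ereal_inf [set energy Omega f w | w in admissible Omega xi0 c] = lslc f xi0.
Proof.
move=> n0 oO O0 bO cf kf fin gap; apply/eqP; rewrite eq_le; apply/andP; split; last first.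
  by apply: le_ereal_inf_tmp => _ [w aw <-]; exact: (lslc_le_energy n0 oO O0 bO gap aw).
rewrite -(fineK fin); move: gap; rewrite -(fineK fin) lte_fin.
set c0 := fine _ => gap.
apply/lee_addgt0Pr => e e0.
(* a level just above [c0], but below [f xi0] so that [xi0] is not in the list *)
pose k := Num.min (c0 + e) ((c0 + f xi0) / 2).
have [k1 k2] : c0 < k /\ k < f xi0.
  by rewrite /k lt_min gt_min; split; [apply/andP; split|apply/orP; right]; lra.
have ck : (lslc f xi0 < k%:E)%E by rewrite -(fineK fin) lte_fin.
have [s [d [sk d0 sd]]] := lslc_lt_surrounds n0 cf kf ck.
have [u au Eu] := admissible_energy_le c n0 oO bO d0 sd sk k2.
apply: (@le_trans _ _ (energy Omega f u)); first by apply: ereal_inf_lbound; exists u.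
by apply: le_trans Eu _; rewrite -EFinD lee_fin ge_min lexx.
Qed.
End energy_infimum.

(** * The two conditions *)

Theorem theorem4p15 (R : realType) (n : nat) (Omega : set 'rV[R]_n)
  (Omega_neq0 : Omega !=set0) (Omega_bounded : bounded_set Omega)
  (Omega_open : open Omega) (Omega_lip : lipschitz_boundary Omega)
  (xi0 : 'rV[R]_n) (c : R) (f : 'rV[R]_n -> R) (f_cont : continuous f)
  (gamma : R -> R) (gamma_ge0 : forall t, 0 <= t -> 0 <= gamma t)
  (gamma_cont : {within [set t | 0 <= t], continuous gamma})
  (gamma_incr : forall s t, 0 <= s -> s <= t -> gamma s <= gamma t)
  (gamma_lim : gamma t @[t --> +oo] --> +oo)
  (f_coercive : forall xi, gamma (enorm xi) <= f xi)
  (f_gap : (lslc f xi0 < (f xi0)%:E)%E) :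
  ((exists u, minimizer Omega f xi0 c u) ->
   exists (nu : 'rV[R]_n) (eps : R),
     let H := [set xi | eball xi0 eps xi /\ 0 <= dotv (xi - xi0) nu] in
     [/\ nu != 0, 0 < eps, constant_on H (lslc f) &
         H `<=` level_set (lslc f) (lslc f xi0)]) /\
  ((exists E : set 'rV[R]_n,
     [/\ E `<=` frontier (gap_component f xi0), interior (convex_hull E) xi0 &
         constant_on ([set xi0] `|` E) (lslc f)]) ->
   exists u, minimizer Omega f xi0 c u).
Proof.
have f_ge0 xi : 0 <= f xi by apply: le_trans (f_coercive xi); exact/gamma_ge0/enorm_ge0.
(* in dimension 0 every function is level convex and lower semicontinuous *)
have n0 : (0 < n)%N.
  rewrite lt0n; apply/eqP => n0; subst n.
  by move: f_gap; rewrite lslc0 ltxx.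
have kf := coercive_sublevel_compact f_cont gamma_lim f_coercive.
have fin := lslc_fin_num xi0 f_ge0.
have infE := inf_energy c n0 Omega_open Omega_neq0 Omega_bounded f_cont kf fin f_gap.
have gap : fine (lslc f xi0) < f xi0 by rewrite -lte_fin fineK.
split.
  move=> [u [adm Eu]]; rewrite infE in Eu.
  have Eu' : (energy Omega f u <= (fine (lslc f xi0))%:E)%E by rewrite Eu fineK.
  have [s [d [sk d0 sd]]] := energy_surrounds n0 Omega_open Omega_neq0 Omega_bounded adm Eu' gap.
  have [nu nu0 nuP] := lslc_ge_at_halfspace n0 f_cont kf fin.
  have HE xi : enorm (xi - xi0) < d / n%:R -> 0 <= dotv (xi - xi0) nu ->
      lslc f xi = lslc f xi0.
    move=> xd xnu; apply/eqP; rewrite eq_le nuP// andbT -(fineK fin).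
    apply: (lslc_le_surrounds sk sd); rewrite mulrC -ltr_pdivlMr ?ltr0n//.
    exact: le_lt_trans (norm_le_enorm _) xd.
  exists nu, (d / n%:R); split=> //; first by rewrite divr_gt0 ?ltr0n.
    by exists (lslc f xi0) => xi [xd xnu]; exact: HE.
  by move=> xi [xd xnu]; exact: HE.
move=> [E [EK Eint [l lE]]].
have oK := open_gap_set n0 f_cont kf.
have [s [d [sE d0 sd]]] := surrounds_interior_hull n0 Eint.
have sf xi : xi \in s -> f xi <= fine (lslc f xi0).
  move=> /sE Exi; rewrite -lee_fin fineK// -(frontier_gap_component oK (EK _ Exi)).
  by rewrite (lE xi0) ?(lE xi)//; [right|left].
have [u au Eu] := admissible_energy_le c n0 Omega_open Omega_bounded d0 sd sf gap.
exists u; split=> //; rewrite infE; apply/eqP; rewrite eq_le.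
rewrite fineK// in Eu; rewrite Eu/=.
exact: (lslc_le_energy n0 Omega_open Omega_neq0 Omega_bounded f_gap au).
Qed.
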